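(* If $f\in\mathcal{C}$ and $\sigma=\sigma(f;x)$, then $$\frac1x\,\#\left\{n\le x: \frac{f(n)-\mu(f;x)}{\sigma(f;x)}\ge\Delta\right\}\sim\mathbb{P}\left(\sum_{p\le x}f(p)\Big[X_p-\frac1p\Big]\ge\Delta\sigma\right)$$ uniformly in $1\le\Delta\le o(\sigma)$, as $x\to\infty$.
   Context: The $X_p$ ($p$ prime) are independent random variables with $\mathbb{P}(X_p=1)=1/p$ and $\mathbb{P}(X_p=0)=1-1/p$. For a strongly additive function $g$ (i.e. $g(p^k)=g(p)$ for all primes $p$ and $k\ge1$, and $g(mn)=g(m)+g(n)$ for $(m,n)=1$), let $$\mu(g;x)=\sum_{p\le x}\frac{g(p)}{p},\qquad \sigma^2(g;x)=\sum_{p\le x}\frac{g(p)^2}{p}\Big(1-\frac1p\Big),\quad \sigma(g;x)\ge0.$$ Class $\mathcal{C}$: an additive function $g$ belongs to $\mathcal{C}$ if and only if (i) $g$ is strongly additive and strictly positive ($g(p)>0$ for all primes $p$); (ii) for every $A>0$, for all $t\ge0$, $x\ge2$, $\frac{1}{\pi(x)}\#\{p\le x: g(p)\ge t\}=O_A(e^{-At})$; (iii) there is a distribution function $\Psi(g;t)$ with non-zero second moment such that for all $k>0$, $\frac{1}{\pi(x)}\#\{p\le x: g(p)\le t\}-\Psi(g;t)=O_k\big((\log x)^{-k}\big)$ uniformly in $t\in\mathbb{R}$. Convention: $F(x;\Delta)\sim G(x;\Delta)$ ''uniformly in $1\le\Delta\le o(h(x))$'' means that for every function $\kappa(x)\to0$,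 $F/G\to1$ as $x\to\infty$ uniformly over $1\le\Delta\le\kappa(x)h(x)$. *)

(* Defs.v *)
From HB Require Import structures.
From mathcomp Require Import all_boot all_order all_algebra.
From mathcomp Require Import all_classical all_reals all_analysis.

Set Implicit Arguments.
Unset Strict Implicit.
Unset Printing Implicit Defensive.

Import Order.TTheory GRing.Theory Num.Theory.
Import numFieldNormedType.Exports.

Local Open Scope classical_set_scope.
Local Open Scope ring_scope.

(* Arithmetic functions have type nat -> R; their value at 0 is irrelevant. *)

Definition additive_fun (R : realType) (g : nat -> R) : Prop :=
  forall m n : nat, (0 < m)%N -> (0 < n)%N -> coprime m n ->
    g (m * n)%N = g m + g n.

Definition strongly_additive (R : realType) (g : nat -> R) : Prop :=
  additive_fun g /\
  forall p k : nat, prime p -> (0 < k)%N -> g (p ^ k)%N = g p.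

Definition primes_upto (R : realType) (x : R) : seq nat :=
  [seq p <- index_iota 1 (Num.truncn x).+1 | prime p].

Definition prime_pi (R : realType) (x : R) : nat := size (primes_upto x).

Definition mu (R : realType) (g : nat -> R) (x : R) : R :=
  \sum_(p <- primes_upto x) g p / p%:R.

Definition sigma2 (R : realType) (g : nat -> R) (x : R) : R :=
  \sum_(p <- primes_upto x) g p ^+ 2 / p%:R * (1 - p%:R^-1).

Definition sigma (R : realType) (g : nat -> R) (x : R) : R :=
  Num.sqrt (sigma2 g x).

Definition prime_freq (R : realType) (Q : pred nat) (x : R) : R :=
  (count Q (primes_upto x))%:R / (prime_pi x)%:R.

(* The implied constant depends on A (and g) only. *)
Definition prime_tail_bound (R : realType) (g : nat -> R) : Prop :=
  forall A : R, 0 < A -> exists K : R, forall t x : R, 0 <= t -> 2 <= x ->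
    prime_freq (fun p => t <= g p) x <= K * expR (- (A * t)).

Definition second_moment (R : realType) (Psi : cumulativeBounded (0 : R) (1 : R))
    : \bar R :=
  (\int[lebesgue_stieltjes_measure Psi]_t (t ^+ 2)%:E)%E.

Definition prime_equidistribution (R : realType) (g : nat -> R) : Prop :=
  exists Psi : cumulativeBounded (0 : R) (1 : R),
    second_moment Psi <> 0%E /\
    forall k : R, 0 < k -> exists K : R, forall x : R, 2 <= x ->
      forall t : R,
        `|prime_freq (fun p => g p <= t) x - Psi t| <= K * (ln x `^ (- k)).

Definition classC (R : realType) (g : nat -> R) : Prop :=
  [/\ strongly_additive g,
      forall p : nat, prime p -> 0 < g p,
      prime_tail_bound g &
      prime_equidistribution g].

Definition mutually_independent d (T : measurableType d) (R : realType)
    (P : probability T R) (I : pred nat) (X : nat -> {RV P >-> R}) : Prop :=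
  forall (s : seq nat) (B : nat -> set R), uniq s -> all I s ->
    (forall i, measurable (B i)) ->
    P (\bigcap_(i in [set` s]) (X i @^-1` B i)) =
    (\prod_(i <- s) P (X i @^-1` B i))%E.

Definition prime_bernoulli_model d (T : measurableType d) (R : realType)
    (P : probability T R) (X : nat -> {RV P >-> R}) : Prop :=
  mutually_independent prime X /\
  forall p : nat, prime p ->
    P (X p @^-1` [set 1]) = (p%:R^-1)%:E /\
    P (X p @^-1` [set 0]) = (1 - p%:R^-1)%:E.

Definition natural_tail (R : realType) (f : nat -> R) (x D : R) : R :=
  (count (fun n => D <= (f n - mu f x) / sigma f x)
     (index_iota 1 (Num.truncn x).+1))%:R / x.

Definition model_tail d (T : measurableType d) (R : realType)
    (P : probability T R) (X : nat -> {RV P >-> R}) (f : nat -> R) (x D : R)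
    : R :=
  fine (P [set w | D * sigma f x <=
                   \sum_(p <- primes_upto x) f p * (X p w - p%:R^-1)]).

(* F(x; D) ~ G(x; D) uniformly in 1 <= D <= o(h(x)), as x -> +oo. Since the
   quotient by 0 is 0, this forces G to be nonzero on the range eventually. *)
Definition equiv_unif_upto_o (R : realType) (F G : R -> R -> R) (h : R -> R)
    : Prop :=
  forall kappa : R -> R, kappa x @[x --> +oo] --> (0 : R) ->
  forall eps : R, 0 < eps ->
  \forall x \near +oo, forall D : R, 1 <= D -> D <= kappa x * h x ->
    `|F x D / G x D - 1| < eps.

(* Main.v *)
Require Import Defs.
From HB Require Import structures.
From mathcomp Require Import all_boot all_order all_algebra.
From mathcomp Require Import all_classical all_reals all_analysis.
From mathcomp Require Import ring lra zify.

Set Implicit Arguments.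
Unset Strict Implicit.
Unset Printing Implicit Defensive.

Import Order.TTheory GRing.Theory Num.Theory.
Import numFieldNormedType.Exports.

Local Open Scope ring_scope.

(** Let N be the integer part of x, L the sum of the 1/p and m the sum of the
    f(p)/p over the primes p <= N, and W the sum of the f(p) X_p.  Two
    consequences of the definition of the class C drive the proof: the
    exponential moment of exponent 4 of f over the primes up to n is
    O(pi(n)), and f exceeds some fixed c0 > 0 on a positive proportion of the
    primes.  In particular sigma^2 = O(L), so the thresholds to be
    reached, tau = mu + Delta sigma with Delta = o(sigma), are at most
    m + o(L).  Put G(tau) = P(W >= tau).

    _The tail of the model is flat._  Reaching m + o(L) only takes an
    exponential tilt of parameter o(1), which suggests that
    G(tau - v) <= e^(c (v + 1)) G(tau) for every fixed c > 0, all v >= 0 and N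
    large ([tail_regular]).  To prove it, size-biasing ([expect_size_bias]),
    applied to the indicator of [tau, +oo), bounds
    c0 L (G(tau - c0) - G(tau)), up to a constant factor, by the excess
    E[W; W >= tau] - m G(tau).  This excess is o(L) G(tau): the large values of
    W have a probability controlled by the exponential moments, and this is
    much smaller than G(tau) by [tail_lower_bound].

    _Logarithmic averages._  Let y be a small fixed power of N and write every
    integer as a b, where a has only prime factors <= y and b none.
    Summing 1/a over the a amounts, up to an Euler factor, to taking the
    expectation in the model restricted to the primes <= y
    ([smoothsum_upper], [smoothsum_lower]); f(ab) differs from f(a) by
    a quantity of bounded exponential moment on average, which flatness
    absorbs.  Hence the sum of ln(N/n)/n over the n <= N with f(n) >= tau is
    Theta G(tau) (1 + o(1)) with Theta independent of tau, and the choice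
    tau = 0, where the condition on n is void, shows that
    Theta = (1/2 + o(1)) (ln N)^2.

    _From logarithmic to natural density._  This is Selberg's symmetry
    formula: (ln n)^2 is the sum over the divisors k of n of a function of k
    with partial sums
    2 z ln z + O(z) ([ln_sqr_divsum], [selberg_formula]).  Write n = k m.  As
    f(m) <= f(n) <= f(m) + f(k), flatness allows to replace the condition on
    f(n) by the same condition on f(m), so that the sum of (ln n)^2 over the
    n <= N with f(n) >= tau is (1 + o(1)) 2 N Theta G(tau), that is
    (1 + o(1)) N (ln N)^2 G(tau).  Finally ln n is close to ln N outside
    N^(1-theta) integers, a negligible number since G(tau) is at least
    e^(-c L) with c small, while L <= 1 + ln N.  Discarding the primes between y and N from
    the model changes G(tau) by a factor 1 + o(1), again by flatness.  The
    outcome is [nat_count_tail_uniform]; [model_tailE] and [natural_tailE]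
    translate it into the theorem. *)

(** * Expectations over random sets of primes *)

Section Expectation.
Variable R : realType.
Implicit Types (l S : seq nat) (h : seq nat -> R).

(** Mean of [h] over the random subset of [l] that contains each [p]
    independently with probability [1/p].  The recursion makes independence
    definitional: the identities below are inductions on [l]. *)
Fixpoint expect l h : R :=
  if l is p :: l' then
    (1 - p%:R^-1) * expect l' h + p%:R^-1 * expect l' (fun S => h (p :: S))
  else h [::].

Lemma invn_ge0 (p : nat) : 0 <= p%:R^-1 :> R.
Proof. by rewrite invr_ge0. Qed.

Lemma invn_le1 (p : nat) : p%:R^-1 <= 1 :> R.
Proof.
case: p => [|p]; first by rewrite invr0.
by rewrite invf_le1 ?ltr0n // ler1n.
Qed.

Lemma onem_invn_ge0 (p : nat) : 0 <= 1 - p%:R^-1 :> R.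
Proof. by rewrite subr_ge0 invn_le1. Qed.

Lemma eq_expect l h h' : h =1 h' -> expect l h = expect l h'.
Proof.
elim: l h h' => [|p l IHl] h h' hh' /=; first exact: hh'.
by rewrite (IHl _ _ hh'); congr (_ + _ * _); apply: IHl => S; exact: hh'.
Qed.

Lemma expect_le (P : pred nat) l h h' : all P l ->
  (forall S, all P S -> h S <= h' S) -> expect l h <= expect l h'.
Proof.
elim: l h h' => [|p l IHl] h h' /=; first by move=> _; apply.
move=> /andP[Pp Pl] hh'.
apply: lerD; apply: ler_wpM2l; rewrite ?onem_invn_ge0 ?invn_ge0 //.
  exact: IHl.
by apply: IHl => // S PS; apply: hh'; rewrite /= Pp.
Qed.

Lemma expect_mono l h h' : (forall S, h S <= h' S) -> expect l h <= expect l h'.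
Proof. by move=> hh'; apply: (@expect_le predT) => //; exact: all_predT. Qed.

Lemma expectD l h h' :
  expect l (fun S => h S + h' S) = expect l h + expect l h'.
Proof.
elim: l h h' => [|p l IHl] h h' //=.
by rewrite !IHl; ring.
Qed.

Lemma expectZ l c h : expect l (fun S => c * h S) = c * expect l h.
Proof. by elim: l h => [|p l IHl] h //=; rewrite !IHl; ring. Qed.

Lemma expect_cst l c : expect l (fun=> c) = c.
Proof. by elim: l => [|p l IHl] //=; rewrite !IHl; ring. Qed.

Lemma expectB l h h' :
  expect l (fun S => h S - h' S) = expect l h - expect l h'.
Proof.
by rewrite expectD; congr (_ + _); rewrite -mulN1r -expectZ; apply: eq_expect => S; rewrite mulN1r.
Qed.

Lemma expect_sum l I (r : seq I) (F : I -> seq nat -> R) :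
  expect l (fun S => \sum_(i <- r) F i S) = \sum_(i <- r) expect l (F i).
Proof.
elim: r => [|i r IHr].
  by rewrite big_nil -[RHS](expect_cst l 0); apply: eq_expect => S; rewrite big_nil.
rewrite big_cons -IHr -expectD; apply: eq_expect => S; by rewrite big_cons.
Qed.

Lemma expect_ge0 l h : (forall S, 0 <= h S) -> 0 <= expect l h.
Proof. by move=> h0; rewrite -(expect_cst l 0); exact: expect_mono. Qed.

Lemma expect_cat l1 l2 h :
  expect (l1 ++ l2) h = expect l1 (fun S1 => expect l2 (fun S2 => h (S1 ++ S2))).
Proof. by elim: l1 h => [|p l1 IHl] h //=; rewrite !IHl. Qed.

Lemma expect_swap l1 l2 (h : seq nat -> seq nat -> R) :
  expect l1 (fun S1 => expect l2 (h S1)) =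
  expect l2 (fun S2 => expect l1 (fun S1 => h S1 S2)).
Proof.
elim: l1 h => [|p l1 IHl] h /=; first exact: eq_expect.
by rewrite !IHl -!expectZ -expectD.
Qed.

Lemma expect_prod l (u : nat -> R) :
  expect l (fun S => \prod_(p <- S) u p) =
  \prod_(p <- l) (1 + p%:R^-1 * (u p - 1)).
Proof.
elim: l => [|p l IHl] /=; first by rewrite !big_nil.
rewrite big_cons -IHl.
rewrite (@eq_expect l (fun S => \prod_(i <- p :: S) u i)
  (fun S => u p * \prod_(i <- S) u i)); last by move=> S; rewrite big_cons.
by rewrite expectZ; ring.
Qed.

Definition wt (u : nat -> R) (S : seq nat) : R := \sum_(p <- S) u p.

Lemma wt_cons u p S : wt u (p :: S) = u p + wt u S.
Proof. by rewrite /wt big_cons. Qed.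

Lemma wt_cat u S1 S2 : wt u (S1 ++ S2) = wt u S1 + wt u S2.
Proof. by rewrite /wt big_cat. Qed.

Lemma expect_expR l (u : nat -> R) s :
  expect l (fun S => expR (s * wt u S)) =
  \prod_(p <- l) (1 + p%:R^-1 * (expR (s * u p) - 1)).
Proof.
rewrite -expect_prod; apply: eq_expect => S.
by rewrite /wt mulr_sumr expR_sum.
Qed.

Definition mean l (u : nat -> R) : R := \sum_(p <- l) u p / p%:R.

Lemma mean_cons p l u : mean (p :: l) u = u p / p%:R + mean l u.
Proof. by rewrite /mean big_cons. Qed.

(** Conditioning on the other primes, the covariance of [[p \in S]] and
    [g (w + wt f S)] is [1/p] times the mean of
    [(1 - [p \in S]) (g (w + wt f S + f p) - g (w + wt f S))].  Summing [f p]
    times this over [p] gives the covariance of [wt f S] and [g (w + wt f S)].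
    All terms are nonnegative, so that only the [good] primes need to be kept,
    with the smaller jump [a]; the factors [1 - [p \in S]] account for the
    term [wt]. *)
Lemma expect_size_bias l (f : nat -> R) (good : pred nat) (a : R) (g : R -> R)
    (w : R) :
  (forall x y, x <= y -> g x <= g y) -> 0 <= a ->
  all (fun p => 0 <= f p) l -> {in l, forall p, good p -> a <= f p} ->
  a * expect l (fun S => (mean l (fun p => (good p)%:R)
                          - wt (fun p => (good p)%:R / p%:R) S)
                         * (g (w + wt f S + a) - g (w + wt f S)))
  <= expect l (fun S => wt f S * g (w + wt f S))
     - mean l f * expect l (fun S => g (w + wt f S)).
Proof.
move=> gmono a0; elim: l w => [|p l IHl] w.
  by move=> _ _ /=; rewrite /mean /wt !big_nil; lra.
move=> /= /andP[fp fl] fgood.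
have {}IHl w' := IHl w' fl (fun q ql => fgood q (mem_behead (s := p :: l) ql)).
set q : R := p%:R^-1.
have q0 : 0 <= q := invn_ge0 p.
have q1 : 0 <= 1 - q := onem_invn_ge0 p.
set b : R := (good p)%:R.
set D := fun w S => g (w + wt f S + a) - g (w + wt f S).
set M := mean l f; set M' := mean l (fun p => (good p)%:R).
set Z := wt (fun p => (good p)%:R / p%:R).
have shift S : w + wt f (p :: S) = (w + f p) + wt f S by rewrite wt_cons addrA.
rewrite !mean_cons -/M -/M' -/q -/b.
have -> : expect l (fun S => (b * q + M' - Z S) * D w S) =
  expect l (fun S => (M' - Z S) * D w S) + b * q * expect l (D w).
  rewrite -expectZ -expectD; apply: eq_expect => S; ring.
rewrite (@eq_expect l (fun S => (b * q + M' - Z (p :: S)) * _) (fun S => (M' - Z S) * D (w + f p) S));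
  last by move=> S; rewrite /Z wt_cons -/Z -/b -/q /D shift; ring.
have -> : expect l (fun S => wt f (p :: S) * g (w + wt f (p :: S))) =
    expect l (fun S => wt f S * g (w + f p + wt f S)) +
    f p * expect l (fun S => g (w + f p + wt f S)).
  by rewrite -expectZ -expectD; apply: eq_expect => S; rewrite shift wt_cons; ring.
rewrite (@eq_expect l (fun S => g (w + wt f (p :: S))) (fun S => g (w + f p + wt f S)));
  last by move=> S; rewrite shift.
have H1 := IHl w; have H2 := IHl (w + f p).
rewrite -/D -/M -/M' -/Z in H1 H2.
set e1 := expect l (fun S => g (w + wt f S)) in H1 *.
set e2 := expect l (fun S => g (w + f p + wt f S)) in H2 *.
have H3 : a * b * expect l (D w) <= f p * (e2 - e1).
  rewrite -expectB -!expectZ; apply: expect_mono => S; rewrite /D /b.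
  have mon : g (w + wt f S) <= g (w + f p + wt f S) by apply: gmono; lra.
  case: (boolP (good p)) => gp; last by rewrite mulr0 mul0r mulr_ge0 // subr_ge0.
  have afp : a <= f p by apply: fgood; rewrite ?mem_head.
  rewrite mulr1; apply: ler_pM => //.
    by rewrite subr_ge0; apply: gmono; lra.
  by rewrite lerD2r; apply: gmono; lra.
set d := expect l (D w) in H3 *.
have H1' := ler_wpM2l q1 H1; have H2' := ler_wpM2l q0 H2.
have H3' := ler_wpM2l (mulr_ge0 q0 q1) H3.
move: H1' H2' H3'; rewrite -/q; lra.
Qed.

(** Size-biasing once more: given [p \in S], the remaining part of [S] is a
    random subset of the other primes, and allowing [p] in it twice only
    increases [g]. *)
Lemma expect_wt_le l (u f : nat -> R) (g : R -> R) (w : R) :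
  (forall x y, x <= y -> g x <= g y) ->
  all (fun p => (0 <= u p) && (0 <= f p)) l ->
  expect l (fun S => wt u S * g (w + wt f S)) <=
  \sum_(p <- l) u p / p%:R * expect l (fun S => g (w + f p + wt f S)).
Proof.
move=> gmono; elim: l w => [|p l IHl] w /=.
  by rewrite big_nil /wt big_nil mul0r.
move=> /andP[/andP[up fp] al].
have {}IHl w' := IHl w' al.
set q : R := p%:R^-1.
have q0 : 0 <= q := invn_ge0 p.
have q1 : 0 <= 1 - q := onem_invn_ge0 p.
have shift w' S : w' + wt f (p :: S) = (w' + f p) + wt f S by rewrite wt_cons addrA.
have -> : expect l (fun S => wt u (p :: S) * g (w + wt f (p :: S))) =
    expect l (fun S => wt u S * g (w + f p + wt f S)) +
    u p * expect l (fun S => g (w + f p + wt f S)).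
  by rewrite -expectZ -expectD; apply: eq_expect => S; rewrite shift wt_cons; ring.
rewrite big_cons.
set E := fun w' => expect l (fun S => g (w' + wt f S)).
have Es w' : expect l (fun S => g (w' + wt f (p :: S))) = E (w' + f p).
  by apply: eq_expect => S; rewrite shift.
rewrite Es -/(E (w + f p)).
have Emono w1 w2 : w1 <= w2 -> E w1 <= E w2.
  by move=> ww; apply: expect_mono => S; apply: gmono; lra.
have H1 := ler_wpM2l q1 (IHl w); have H2 := ler_wpM2l q0 (IHl (w + f p)).
have H3 : u p * q * E (w + f p) <=
   u p * q * ((1 - q) * E (w + f p) + q * E (w + f p + f p)).
  apply: ler_wpM2l; first exact: mulr_ge0.
  have := ler_wpM2l q0 (Emono (w + f p) (w + f p + f p) ltac:(lra)); lra.
under [X in _ <= _ + X]eq_bigr => r _ do rewrite Es -/(E (w + f r)) mulrDr.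
rewrite big_split /=.
have -> : \sum_(i <- l) u i / i%:R * ((1 - q) * E (w + f i)) =
    (1 - q) * \sum_(i <- l) u i / i%:R * E (w + f i).
  by rewrite mulr_sumr; apply: eq_bigr => i _; ring.
have -> : \sum_(i <- l) u i / i%:R * (q * E (w + f i + f p)) =
    q * \sum_(i <- l) u i / i%:R * E (w + f p + f i).
  by rewrite mulr_sumr; apply: eq_bigr => i _; rewrite addrAC; ring.
move: H1 H2 H3; rewrite -/q -/(E w) /E.
set A1 := (1 - q) * expect _ _; set A2 := expect l (fun S => wt u S * _).
set A3 := (1 - q) * \sum_(i <- l) _; set A4 := \sum_(i <- l) _.
by move=> H1 H2 H3; lra.
Qed.

End Expectation.

(** * Elementary inequalities, sums over primes *)

Section Preliminaries.
Variable R : realType.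

(** The usual bound [1 - z <= expR (- z)], in the multiplicative form that gives
    upper bounds of the exponential near 0. *)
Lemma expR_onem_le1 (z : R) : expR z * (1 - z) <= 1.
Proof.
have h := expR_ge1Dx (- z); rewrite expRN in h.
by have := ler_wpM2l (expR_ge0 z) h; rewrite divff ?gt_eqF ?expR_gt0.
Qed.

Lemma expR_sub1_le (z : R) : expR z - 1 <= z * expR z.
Proof. have := expR_onem_le1 z; lra. Qed.

Lemma expR_le_quad (z : R) : 0 <= z -> expR z <= 1 + z + z ^+ 2 * expR z.
Proof.
move=> z0; have h1 := expR_sub1_le z.
have := ler_wpM2l z0 h1; rewrite expr2; lra.
Qed.

Lemma expR_ge_quad (z : R) : 0 <= z -> 1 + z + z ^+ 2 / 4 <= expR z.
Proof.
move=> z0.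
have -> : 1 + z + z ^+ 2 / 4 = (1 + z / 2) ^+ 2 by field.
have -> : z = 2%:R * (z / 2) by field.
rewrite expRM_natl; apply: lerXn2r; rewrite ?nnegrE ?expR_ge0 ?expR_ge1Dx //.
  lra.
have -> : 1 + 2%:R * (z / 2) / 2 = 1 + z / 2 by field.
exact: expR_ge1Dx.
Qed.

Lemma expRB_sqr_le (z : R) : 0 <= z -> expR (z - z ^+ 2) <= 1 + z.
Proof.
move=> z0; have h2 := expR_onem_le1 (z - z ^+ 2).
have p0 : 0 < 1 + - (z - z ^+ 2) by have := sqr_ge0 (z - 1 / 2); nra.
rewrite -(ler_pM2r p0); apply: le_trans h2 _.
have -> : (1 + z) * (1 + - (z - z ^+ 2)) = 1 + z ^+ 3 by ring.
by rewrite lerDl exprn_ge0.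
Qed.

Lemma le_expR (x : R) : x <= expR x.
Proof. by have := expR_ge1Dx x; lra. Qed.

Lemma sqr_le_expR (x : R) : 0 <= x -> x ^+ 2 <= expR (2 * x).
Proof.
move=> x0; rewrite (expRM_natl 2 x).
by apply: lerXn2r; rewrite ?nnegrE ?expR_ge0 ?le_expR.
Qed.

(** Abel summation, as a principle of comparison: [a] is a positive combination
    of indicators of initial segments. *)
Lemma abel_le (u v a : nat -> R) (N : nat) :
  (forall n, (n <= N)%N ->
     \sum_(1 <= m < n.+1) u m <= \sum_(1 <= m < n.+1) v m) ->
  (forall n, (0 < n < N)%N -> a n.+1 <= a n) ->
  (forall n, (0 < n <= N)%N -> 0 <= a n) ->
  \sum_(1 <= m < N.+1) u m * a m <= \sum_(1 <= m < N.+1) v m * a m.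
Proof.
move=> uv adec a0.
have key n : (n <= N)%N -> (0 < n)%N ->
    a n * (\sum_(1 <= m < n.+1) v m - \sum_(1 <= m < n.+1) u m) <=
    \sum_(1 <= m < n.+1) v m * a m - \sum_(1 <= m < n.+1) u m * a m.
  elim: n => [//|n IHn] nN _.
  rewrite !(@big_nat_recr _ _ _ n.+1) //=.
  case: n IHn nN => [|n] IHn nN; first by rewrite !big_geq //; lra.
  have {}IHn := IHn (ltnW nN) isT.
  have h1 := adec n.+1 ltac:(by rewrite nN).
  have h2 := uv n.+1 (ltnW nN).
  set V := \sum_(1 <= m < n.+2) v m in IHn h2 *.
  set U := \sum_(1 <= m < n.+2) u m in IHn h2 *.
  have : a n.+2 * (V - U) <= a n.+1 * (V - U) by apply: ler_wpM2r => //; lra.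
  lra.
case: N uv adec a0 key => [|N] uv adec a0 key; first by rewrite !big_geq.
have := key N.+1 (leqnn _) isT.
have h0 := a0 N.+1 ltac:(by rewrite leqnn).
have := ler_wpM2l h0 (uv N.+1 (leqnn _)); lra.
Qed.

Lemma min_lel (x y : R) : Num.min x y <= x.
Proof. by rewrite ge_min lexx. Qed.

Lemma min_ler (x y : R) : Num.min x y <= y.
Proof. by rewrite ge_min lexx orbT. Qed.

Lemma sum_invn_sqr_le (n : nat) : \sum_(1 <= m < n.+1) (m%:R^-1) ^+ 2 <= 2 :> R.
Proof.
suff h k : \sum_(1 <= m < k.+2) (m%:R^-1) ^+ 2 <= 2 - k.+1%:R^-1 :> R.
  case: n => [|n]; first by rewrite big_geq.
  by apply: le_trans (h n) _; rewrite lerBlDr lerDl invr_ge0.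
elim: k => [|k IHk]; first by rewrite big_nat1 invr1 expr1n; lra.
rewrite big_nat_recr //=; apply: le_trans (lerD IHk (lexx _)) _.
have k1 : 0 < k.+1%:R :> R by rewrite ltr0n.
have -> : k.+2%:R = k.+1%:R + 1 :> R by rewrite -natr1.
set x : R := k.+1%:R in k1 *.
rewrite -subr_ge0.
have -> : 2 - (x + 1)^-1 - (2 - x^-1 + (x + 1)^-1 ^+ 2) =
  (x * (x + 1) ^+ 2)^-1 by field; lra.
by rewrite invr_ge0; apply: mulr_ge0; [exact: ltW | exact: sqr_ge0].
Qed.

End Preliminaries.

Definition primes_le (n : nat) : seq nat := [seq p <- index_iota 1 n.+1 | prime p].

Lemma mem_primes_le n p : (p \in primes_le n) = prime p && (p <= n)%N.
Proof.
rewrite mem_filter mem_index_iota ltnS.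
by case: (boolP (prime p)) => // /prime_gt0 ->.
Qed.

Lemma all_prime_primes_le n : all prime (primes_le n).
Proof. by apply/allP => p; rewrite mem_primes_le => /andP[]. Qed.

Lemma uniq_primes_le n : uniq (primes_le n).
Proof. by rewrite filter_uniq // iota_uniq. Qed.

Lemma primes_le_cat m n : (m <= n)%N ->
  primes_le n = primes_le m ++ [seq p <- index_iota m.+1 n.+1 | prime p].
Proof.
move=> mn; rewrite /primes_le -filter_cat; congr [seq p <- _ | prime p].
by rewrite /index_iota !subSS !subn0 -{1}(subnKC mn) iotaD add1n.
Qed.

Section PrimeSums.
Variable R : realType.
Implicit Types F a : nat -> R.

Lemma big_primes_le n F :
  \sum_(p <- primes_le n) F p = \sum_(1 <= m < n.+1) (prime m)%:R * F m.
Proof.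
rewrite big_filter big_mkcond /=; apply: eq_bigr => m _.
by case: (prime m); rewrite ?mul1r ?mul0r.
Qed.

Lemma size_primes_le n : (size (primes_le n))%:R = \sum_(1 <= m < n.+1) (prime m)%:R :> R.
Proof.
under eq_bigr => m _ do rewrite -[_%:R]mulr1.
by rewrite -(big_primes_le n (fun=> 1)) big_const_seq count_predT iter_addr_0.
Qed.

End PrimeSums.

(** * Flatness of the tail of the model *)

Section Regularity.
Variable R : realType.
Variable f : nat -> R.
Hypothesis f_gt0 : forall p, prime p -> 0 < f p.
Variable K4 : R.
Hypothesis K4_ge1 : 1 <= K4.
Hypothesis f_exp_moment : forall n,
  \sum_(p <- primes_le n) expR (4 * f p) <= K4 * (size (primes_le n))%:R.
Variables c0 c1 Kg : R.
Hypothesis c0_gt0 : 0 < c0.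
Hypothesis c1_gt0 : 0 < c1.
Hypothesis Kg_ge0 : 0 <= Kg.
Hypothesis f_often_large : forall n,
  c1 * (size (primes_le n))%:R - Kg <= (count (fun p => c0 < f p) (primes_le n))%:R.

Definition lsum n : R := \sum_(p <- primes_le n) p%:R^-1.
Definition mean_le n : R := mean (primes_le n) f.

Definition tail (l : seq nat) (t : R) : R :=
  expect l (fun S => (t <= wt f S)%R%:R).

Hypothesis lsum_unbounded : forall M : R, exists N0, forall N, (N0 <= N)%N -> M <= lsum N.

Lemma f_ge0 p : prime p -> 0 <= f p.
Proof. by move=> /f_gt0/ltW. Qed.

(** The hypotheses on [f] concern initial segments of the primes; Abel
    summation carries them over to decreasing weights such as [1/p]. *)
Lemma exp_moment_weighted (a : nat -> R) N :
  (forall n, (0 < n < N)%N -> a n.+1 <= a n) ->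
  (forall n, (0 < n <= N)%N -> 0 <= a n) ->
  \sum_(p <- primes_le N) expR (4 * f p) * a p <= K4 * \sum_(p <- primes_le N) a p.
Proof.
move=> adec a0; rewrite mulr_sumr.
rewrite !big_primes_le.
under eq_bigr => m _ do rewrite mulrA.
under [X in _ <= X]eq_bigr => m _ do rewrite mulrA.
apply: abel_le => // n _.
rewrite -mulr_suml -size_primes_le [leRHS]mulrC -big_primes_le.
exact: f_exp_moment.
Qed.

Lemma large_weighted N : (0 < N)%N ->
  c1 * lsum N - Kg <= \sum_(p <- primes_le N) (c0 < f p)%R%:R / p%:R.
Proof.
move=> N0; rewrite lerBlDr.
(* The constant [Kg] becomes a mass at the integer 1, so that the hypothesis
   turns into a comparison of partial sums. *)
have -> : Kg = \sum_(1 <= m < N.+1) (if m == 1%N then Kg else 0) / m%:R.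
  rewrite big_nat_recl //= divr1 big1_seq ?addr0 // => m /andP[_].
  by rewrite mem_index_iota => /andP[m1 _]; case: m m1 => // m _; rewrite mul0r.
rewrite /lsum mulr_sumr !big_primes_le -big_split /=.
under eq_bigr => m _ do rewrite mulrA.
under [X in _ <= X]eq_bigr => m _ do rewrite mulrA -mulrDl.
apply: abel_le => [n nN|n /andP[n1 nN]|n _]; last by rewrite invr_ge0.
  rewrite -mulr_suml -(size_primes_le R n) big_split /=.
  have h := f_often_large n.
  case: n nN h => [|n] nN h.
    by rewrite !big_geq // /primes_le /= mul0r addr0.
  have -> : \sum_(1 <= m < n.+2) (if m == 1%N then Kg else 0) = Kg.
    rewrite big_nat_recl //= big1_seq ?addr0 // => m /andP[_].
    by rewrite mem_index_iota => /andP[m1 _]; case: m m1.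
  rewrite -big_primes_le -lerBlDr mulrC; apply: le_trans h _.
  rewrite -sum1_count big_mkcond natr_sum /=.
  by rewrite ler_sum // => p _; case: (c0 < f p).
by rewrite lef_pV2 ?posrE ?ltr0n // ler_nat.
Qed.

Lemma lsum_ge0 n : 0 <= lsum n.
Proof. by apply: sumr_ge0 => p _; rewrite invr_ge0. Qed.

Lemma exp_moment_lsum N :
  \sum_(p <- primes_le N) expR (4 * f p) / p%:R <= K4 * lsum N.
Proof.
apply: exp_moment_weighted => n /andP[n1 nN].
  by rewrite lef_pV2 ?posrE ?ltr0n // ler_nat.
by rewrite invr_ge0.
Qed.

Lemma exp_moment_sqr N :
  \sum_(p <- primes_le N) expR (4 * f p) * (p%:R^-1) ^+ 2 <= 2 * K4.
Proof.
apply: le_trans (exp_moment_weighted _ _) _ => [n /andP[n1 nN]|n _|].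
- apply: lerXn2r; rewrite ?nnegrE ?invr_ge0 //.
  by rewrite lef_pV2 ?posrE ?ltr0n // ler_nat.
- by rewrite exprn_ge0 // invr_ge0.
rewrite [leRHS]mulrC ler_wpM2l //; first by have := K4_ge1; lra.
apply: le_trans (sum_invn_sqr_le R N); rewrite big_primes_le.
by apply: ler_sum => m _; case: (prime m); rewrite ?mul1r ?mul0r.
Qed.

Lemma expR_f_sub1_le p (s : R) : prime p -> 0 <= s <= 1 ->
  expR (s * f p) - 1 <= s * f p + s ^+ 2 * expR (4 * f p).
Proof.
move=> pp /andP[s0 s1]; have f0 := f_ge0 pp.
have := expR_le_quad (mulr_ge0 s0 f0).
suff : (s * f p) ^+ 2 * expR (s * f p) <= s ^+ 2 * expR (4 * f p) by lra.
rewrite exprMn -mulrA ler_wpM2l ?sqr_ge0 //.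
have -> : 4 * f p = 2 * f p + 2 * f p by ring.
rewrite expRD ler_pM ?sqr_ge0 ?expR_ge0 ?sqr_le_expR // ler_expR.
by rewrite ler_wpM2r //; lra.
Qed.

Lemma mgf_le N s : 0 <= s <= 1 ->
  expect (primes_le N) (fun S => expR (s * wt f S)) <=
  expR (s * mean_le N + s ^+ 2 * (K4 * lsum N)).
Proof.
move=> s01; rewrite expect_expR.
apply: (@le_trans _ _ (\prod_(p <- primes_le N) expR (p%:R^-1 * (expR (s * f p) - 1)))).
  rewrite !big_seq; apply: ler_prod => p; rewrite mem_primes_le => /andP[pp _].
  rewrite expR_ge1Dx andbT addr_ge0 // mulr_ge0 ?invr_ge0 // subr_ge0.
  by rewrite -expR0 ler_expR mulr_ge0 ?f_ge0 //; case/andP: s01.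
rewrite -expR_sum ler_expR.
apply: (@le_trans _ _ (s * mean_le N +
    s ^+ 2 * \sum_(p <- primes_le N) expR (4 * f p) / p%:R)); last first.
  by rewrite lerD2l ler_wpM2l ?sqr_ge0 // exp_moment_lsum.
rewrite /mean_le /mean !mulr_sumr -big_split /= !big_seq.
apply: ler_sum => p; rewrite mem_primes_le => /andP[pp _].
have := ler_wpM2l (invn_ge0 R p) (expR_f_sub1_le pp s01); lra.
Qed.

(** Only the primes with [f p > c0] are counted in the quadratic gain, and the
    loss in [1 + z >= expR (z - z ^+ 2)] is of the order of the convergent sum
    of the [1/p^2]. *)
Lemma mgf_ge N s : (0 < N)%N -> 0 <= s <= 1 ->
  expR (s * mean_le N +
        s ^+ 2 * (c0 ^+ 2 / 4 * (c1 * lsum N - Kg) - 2 * K4)) <=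
  expect (primes_le N) (fun S => expR (s * wt f S)).
Proof.
move=> N0 s01; have [s0 s1] := andP s01; rewrite expect_expR.
pose z p : R := p%:R^-1 * (expR (s * f p) - 1).
have z0 p : prime p -> 0 <= z p.
  move=> pp; rewrite mulr_ge0 ?invr_ge0 // subr_ge0 -expR0 ler_expR.
  by rewrite mulr_ge0 ?f_ge0.
apply: (@le_trans _ _ (\prod_(p <- primes_le N) expR (z p - z p ^+ 2))); last first.
  rewrite !big_seq; apply: ler_prod => p; rewrite mem_primes_le => /andP[pp _].
  by rewrite expR_ge0 expRB_sqr_le ?z0.
rewrite -expR_sum ler_expR.
have h1 := large_weighted N0.
have h2 := exp_moment_sqr N.
have h3 : c0 ^+ 2 / 4 * (c1 * lsum N - Kg) <=
   c0 ^+ 2 / 4 * \sum_(p <- primes_le N) (c0 < f p)%R%:R / p%:R.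
  by rewrite ler_wpM2l // divr_ge0 // sqr_ge0.
apply: (@le_trans _ _ (s * mean_le N + s ^+ 2 *
   (c0 ^+ 2 / 4 * \sum_(p <- primes_le N) (c0 < f p)%R%:R / p%:R -
    \sum_(p <- primes_le N) expR (4 * f p) * (p%:R^-1) ^+ 2))).
  by rewrite lerD2l ler_wpM2l ?sqr_ge0 //; lra.
rewrite /mean_le /mean mulrBr !mulr_sumr addrA -sumrN -!big_split /= !big_seq.
apply: ler_sum => p; rewrite mem_primes_le => /andP[pp _].
have f0 := f_ge0 pp; have i0 := invn_ge0 R p.
have e1 := expR_ge_quad (mulr_ge0 s0 f0).
have e2 : s * (f p / p%:R) + s ^+ 2 * (c0 ^+ 2 / 4 * ((c0 < f p)%R%:R / p%:R)) <= z p.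
  have -> : s * (f p / p%:R) + s ^+ 2 * (c0 ^+ 2 / 4 * ((c0 < f p)%R%:R / p%:R)) =
      p%:R^-1 * (s * f p + s ^+ 2 * (c0 ^+ 2 * (c0 < f p)%R%:R) / 4) by field;
      rewrite pnatr_eq0 -lt0n prime_gt0.
  apply: ler_wpM2l => //.
  suff : s ^+ 2 * (c0 ^+ 2 * (c0 < f p)%R%:R) <= (s * f p) ^+ 2 by lra.
  rewrite exprMn ler_wpM2l ?sqr_ge0 //.
  case: ltP => c0f; rewrite ?mulr0 ?sqr_ge0 // mulr1.
  by apply: lerXn2r; rewrite ?nnegrE // ltW.
suff : z p ^+ 2 <= s ^+ 2 * (expR (4 * f p) * (p%:R^-1) ^+ 2) by lra.
have -> : s ^+ 2 * (expR (4 * f p) * (p%:R^-1) ^+ 2) =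
    (p%:R^-1) ^+ 2 * (s ^+ 2 * expR (4 * f p)) by ring.
rewrite /z exprMn ler_wpM2l ?sqr_ge0 //.
have e3 : expR (s * f p) - 1 <= s * (f p * expR (s * f p)).
  by rewrite mulrA expR_sub1_le.
have e4 : 0 <= expR (s * f p) - 1.
  by rewrite subr_ge0 -expR0 ler_expR mulr_ge0.
apply: (@le_trans _ _ ((s * (f p * expR (s * f p))) ^+ 2)).
  by apply: lerXn2r; rewrite ?nnegrE //; apply: le_trans e4 e3.
rewrite !exprMn ler_wpM2l ?sqr_ge0 //.
have -> : 4 * f p = 2 * f p + 2 * f p by ring.
rewrite expRD ler_pM ?sqr_ge0 ?sqr_le_expR // -expRM_natl ler_expR.
by rewrite ler_wpM2l // -[leRHS]mul1r ler_wpM2r.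
Qed.

Lemma mean_le_lsum N : mean_le N <= K4 * lsum N.
Proof.
apply: le_trans (exp_moment_lsum N); rewrite /mean_le /mean !big_seq.
apply: ler_sum => p; rewrite mem_primes_le => /andP[pp _].
rewrite ler_wpM2r ?invr_ge0 //; apply: le_trans (le_expR (f p)) _.
by rewrite ler_expR; have := f_ge0 pp; lra.
Qed.

Lemma mean_le_ge0 N : 0 <= mean_le N.
Proof.
rewrite /mean_le /mean big_seq; apply: sumr_ge0 => p.
by rewrite mem_primes_le => /andP[pp _]; rewrite divr_ge0 ?f_ge0.
Qed.

Lemma tail_anti l (t t' : R) : t <= t' -> tail l t' <= tail l t.
Proof.
move=> tt; apply: expect_mono => S; rewrite ler_nat.
by case: (leP t' (wt f S)) => // /(le_trans tt) ->.
Qed.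

Lemma tail_ge0 l (t : R) : 0 <= tail l t.
Proof. by apply: expect_ge0 => S; rewrite ler0n. Qed.

(** A second moment argument under the tilt [s]: the tilted mass lies mostly
    above [mean_le N + kappa * lsum N] because the mean is raised
    quadratically in [s] ([mgf_ge]), and it is spread enough because the
    moment of order [2 * s] is not much larger than the square of that of
    order [s]. *)
Lemma tail_lower_bound (eta : R) : 0 < eta ->
  exists2 kappa : R, 0 < kappa & exists N0, forall N, (N0 <= N)%N ->
    expR (- (eta * lsum N)) <= tail (primes_le N) (mean_le N + kappa * lsum N).
Proof.
move=> eta0.
have K40 : 0 < K4 by have := K4_ge1; lra.
pose s : R := eta / (8 * K4 + 2 * eta).
have den0 : 0 < 8 * K4 + 2 * eta by lra.
have s0 : 0 < s by rewrite divr_gt0.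
have s_half : s <= 1 / 2 by rewrite /s ler_pdivrMr //; lra.
have s_eta : 8 * K4 * s <= eta.
  by rewrite /s mulrA ler_pdivrMr //; nra.
clearbody s.
have [c2 c2E] : exists c2 : R, c2 = c0 ^+ 2 / 4 * c1 by eexists.
have c20 : 0 < c2 by rewrite c2E mulr_gt0 // divr_gt0 // exprn_gt0.
pose C3 : R := c0 ^+ 2 / 4 * Kg + 2 * K4.
have C30 : 0 <= C3.
  by apply: addr_ge0; apply: mulr_ge0; rewrite ?divr_ge0 ?sqr_ge0 //; lra.
exists (s * c2 / 2); first by rewrite divr_gt0 // mulr_gt0.
have [N1 hN1] := lsum_unbounded (2 * (C3 * s ^+ 2 + 1) / (s ^+ 2 * c2)).
have [N2 hN2] := lsum_unbounded (2 * (2 + 2 * C3) / eta).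
exists (maxn 1 (maxn N1 N2)) => N; rewrite !geq_max => /andP[N0 /andP[/hN1 L1 /hN2 L2]].
move: L1; rewrite ler_pdivrMr ?mulr_gt0 ?exprn_gt0 // => L1.
move: L2; rewrite ler_pdivrMr // => L2.
have L0 := lsum_ge0 N; set L := lsum N in L0 L1 L2 *.
set mu := mean_le N; set tau := mu + _; set G := tail _ _.
have h1 := @mgf_ge N s N0 ltac:(apply/andP; split; lra).
have h2 := @mgf_le N (2 * s) ltac:(apply/andP; split; lra).
rewrite -/mu -/L in h1 h2.
set M := expect _ _ in h1; set M2 := expect _ _ in h2.
have M0 : 0 < M by apply: lt_le_trans h1; exact: expR_gt0.
have M20 : 0 < M2.
  apply: lt_le_trans (expR_gt0 0) _; rewrite -(expect_cst (primes_le N) (expR 0)).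
  apply: (@expect_le _ prime); rewrite ?all_prime_primes_le // => S pS.
  rewrite ler_expR mulr_ge0 //; first by lra.
  rewrite /wt big_seq; apply: sumr_ge0 => p pin; apply: f_ge0.
  exact: (allP pS).
(* Cauchy-Schwarz in additive form: [a <= lam * a ^+ 2 + nu] pointwise as soon
   as [4 * lam * nu = 1], with the weights that balance the two terms. *)
have key : M <= expR (s * tau) + M / (4 * M2) * M2 + M2 / M * G.
  have [lam lamE] : exists lam : R, lam = M / (4 * M2) by eexists.
  have [nu nuE] : exists nu : R, nu = M2 / M by eexists.
  rewrite -lamE -nuE -[X in X + lam * M2](expect_cst (primes_le N)) -!expectZ -!expectD.
  apply: expect_mono => S; rewrite lamE nuE {lam lamE nu nuE}.
  have -> : 2 * s * wt f S = 2%:R * (s * wt f S) by ring.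
  rewrite expRM_natl.
  set a := expR (s * wt f S); have a0 : 0 < a by exact: expR_gt0.
  have l0 : 0 <= M / (4 * M2) * a ^+ 2 by rewrite mulr_ge0 ?sqr_ge0 ?divr_ge0 // ltW //; lra.
  case: (leP tau (wt f S)) => tW.
    rewrite mulr1; have := expR_gt0 (s * tau).
    suff : a <= M / (4 * M2) * a ^+ 2 + M2 / M by lra.
    rewrite -subr_ge0.
    have -> : M / (4 * M2) * a ^+ 2 + M2 / M - a = (M * a / 2 - M2) ^+ 2 / (M * M2).
      by field; rewrite !gt_eqF.
    by rewrite divr_ge0 ?sqr_ge0 // mulr_ge0 // ltW.
  rewrite mulr0 addr0; apply: le_trans (_ : expR (s * tau) <= _); last by lra.
  by rewrite ler_expR ler_wpM2l // ltW.
have et : expR (s * tau) <= M / 2.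
  apply: le_trans (_ : expR (-1) * expR (s * mu + s ^+ 2 * (c0 ^+ 2 / 4 * (c1 * L - Kg) - 2 * K4)) <= _).
    rewrite -expRD ler_expR.
    have -> : s * mu + s ^+ 2 * (c0 ^+ 2 / 4 * (c1 * L - Kg) - 2 * K4) = s * mu + s ^+ 2 * (c2 * L - C3).
      by rewrite c2E /C3; ring.
    rewrite /tau; move: L1; lra.
  apply: le_trans (_ : expR (-1) * M <= _); first by rewrite ler_wpM2l ?expR_ge0.
  rewrite mulrC ler_wpM2l //; first exact: ltW.
  rewrite expRN lef_pV2 ?posrE ?expR_gt0 //.
  by have := expR_ge1Dx (1 : R); lra.
have e4 : M / (4 * M2) * M2 = M / 4 by field; rewrite gt_eqF.
have GM : M ^+ 2 / (4 * M2) <= G.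
  have : M / 4 <= M2 / M * G by move: key; rewrite e4; lra.
  rewrite -(ler_pM2l (divr_gt0 M0 M20)).
  have -> : M / M2 * (M / 4) = M ^+ 2 / (4 * M2) by field; rewrite gt_eqF.
  by have -> : M / M2 * (M2 / M * G) = G by field; rewrite !gt_eqF.
apply: le_trans GM.
rewrite ler_pdivlMr; last by lra.
apply: le_trans (_ : expR (- (eta * L)) * (expR 2 * expR (2 * s * mu + (2 * s) ^+ 2 * (K4 * L))) <= _).
  rewrite ler_wpM2l ?expR_ge0 //; apply: ler_pM => //; try lra.
  apply: le_trans (_ : 1 + 2 + 2 ^+ 2 / 4 <= _); first by lra.
  by apply: expR_ge_quad.
apply: le_trans (_ : (expR (s * mu + s ^+ 2 * (c0 ^+ 2 / 4 * (c1 * L - Kg) - 2 * K4))) ^+ 2 <= _); last first.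
  by apply: lerXn2r; rewrite ?nnegrE ?expR_ge0 // ltW.
rewrite -expRM_natl -!expRD ler_expR.
have -> : s * mu + s ^+ 2 * (c0 ^+ 2 / 4 * (c1 * L - Kg) - 2 * K4) = s * mu + s ^+ 2 * (c2 * L - C3).
  by rewrite c2E /C3; ring.
have a1 : 0 <= s ^+ 2 * (c2 * L) by rewrite mulr_ge0 ?sqr_ge0 // mulr_ge0 // ltW.
have a2 : s ^+ 2 * C3 <= C3 by rewrite -[leRHS]mul1r ler_wpM2r // expr_le1 //; lra.
have a3 : (2 * s) ^+ 2 * (K4 * L) <= eta / 2 * L.
  rewrite mulrA ler_wpM2r //; rewrite exprMn.
  have : s * (8 * K4 * s) <= 1 / 2 * eta.
    by apply: ler_pM => //; rewrite ?mulr_ge0 // ltW.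
  rewrite expr2; lra.
move: L2; lra.
Qed.

(** Where [wt f S <= mean_le N + eps / 2 * lsum N] the claim is pointwise.  The
    remaining contribution is at most [expR (- (s * eps / 4 * lsum N))], up to
    a factor linear in [lsum N], by the exponential moment of order [2 * s],
    whereas the tail is at least [expR (- (s * eps / 8 * lsum N))] by the choice
    of [kappa]. *)
Lemma truncated_mean_le (eps : R) : 0 < eps ->
  exists2 kappa : R, 0 < kappa & exists N0, forall N, (N0 <= N)%N ->
    forall tau, tau <= mean_le N + kappa * lsum N ->
    expect (primes_le N) (fun S => wt f S * (tau <= wt f S)%R%:R) <=
    (mean_le N + eps * lsum N) * tail (primes_le N) tau.
Proof.
move=> eps0.
have K40 : 0 < K4 by have := K4_ge1; lra.
pose s : R := eps / (16 * K4 + 2 * eps).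
have den0 : 0 < 16 * K4 + 2 * eps by lra.
have s0 : 0 < s by rewrite divr_gt0.
have s_half : s <= 1 / 2 by rewrite /s ler_pdivrMr //; lra.
have s_eps : 16 * K4 * s <= eps by rewrite /s mulrA ler_pdivrMr //; nra.
clearbody s.
have [kappa kappa0 [N1 hN1]] := tail_lower_bound (divr_gt0 (mulr_gt0 s0 eps0) (ltr0Sn R 7)).
exists kappa => //.
have [N2 hN2] := lsum_unbounded (16 * (K4 + s^-1) / (s * eps ^+ 2)).
have [N3 hN3] := lsum_unbounded 1.
exists (maxn N1 (maxn N2 N3)) => N.
rewrite !geq_max => /andP[/hN1 GN /andP[/hN2 L2 /hN3 L3]] tau htau.
have {}GN := le_trans GN (tail_anti (primes_le N) htau).
have L0 := lsum_ge0 N; have mu0 := mean_le_ge0 N; have muL := mean_le_lsum N.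
have h2 := @mgf_le N (2 * s) ltac:(apply/andP; split; lra).
set L := lsum N in GN L0 L2 L3 h2 muL *; set mu := mean_le N in mu0 h2 muL *.
set G := tail _ _ in GN *.
have si0 : 0 < s^-1 by rewrite invr_gt0.
apply: (@le_trans _ _ ((mu + eps / 2 * L) * G + (mu + s^-1) *
   (expR (- (2 * s * mu) - s * (eps / 2 * L)) *
    expect (primes_le N) (fun S => expR (2 * s * wt f S))))).
  rewrite -!expectZ -expectD; apply: expect_mono => S.
  rewrite -expRD; set W := wt f S.
  set E := expR _; have E0 : 0 < E by exact: expR_gt0.
  have x0 : 0 < (mu + s^-1) * E by rewrite mulr_gt0 //; lra.
  case: (leP W (mu + eps / 2 * L)) => hW.
    apply: le_trans (ler_wpM2r (ler0n _ _) hW) _; lra.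
  have a0 : 0 <= (mu + eps / 2 * L) * (tau <= W)%R%:R.
    by rewrite mulr_ge0 // addr_ge0 // mulr_ge0 //; lra.
  have eL : 0 <= eps / 2 * L by rewrite mulr_ge0 //; lra.
  have W0 : 0 <= W by lra.
  apply: le_trans (_ : W <= _); first by rewrite -[leRHS]mulr1 ler_wpM2l // lern1 leq_b1.
  suff : W <= (mu + s^-1) * E by lra.
  apply: le_trans (_ : (mu + s^-1) * expR (s * (W - mu)) <= _); last first.
    apply: ler_wpM2l; first by lra.
    by rewrite ler_expR; have := ler_wpM2l (ltW s0) (ltW hW); lra.
  have e1 : 1 <= expR (s * (W - mu)).
    by rewrite -expR0 ler_expR mulr_ge0 //; lra.
  have e2 : s^-1 * (s * (W - mu)) <= s^-1 * expR (s * (W - mu)).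
    by rewrite ler_wpM2l ?le_expR // ltW.
  rewrite mulrA mulVf ?gt_eqF // mul1r in e2.
  have := ler_wpM2l mu0 e1; lra.
have h3 : expR (- (2 * s * mu) - s * (eps / 2 * L)) *
    expect (primes_le N) (fun S => expR (2 * s * wt f S)) <=
    expR (- (s * eps / 8 * L)) * expR (- (s * eps / 8 * L)).
  apply: le_trans (ler_wpM2l (expR_ge0 _) h2) _.
  rewrite -!expRD ler_expR.
  have : s * (16 * K4 * s) * L <= s * eps * L.
    by rewrite ler_wpM2r // ler_wpM2l // ltW.
  rewrite exprMn expr2; lra.
have h4 : (mu + s^-1) * expR (- (s * eps / 8 * L)) <= eps / 2 * L.
  apply: le_trans (_ : ((K4 + s^-1) * L) * expR (- (s * eps / 8 * L)) <= _).
    rewrite ler_wpM2r ?expR_ge0 //.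
    have : s^-1 * 1 <= s^-1 * L by rewrite ler_wpM2l // ltW.
    lra.
  rewrite expRN.
  set x := s * eps / 8 * L.
  have xL : 0 < x by rewrite mulr_gt0 ?divr_gt0 ?mulr_gt0 //; lra.
  rewrite ler_pdivrMr ?expR_gt0 //.
  apply: le_trans (_ : eps / 2 * L * x <= _); last first.
    by rewrite ler_wpM2l ?le_expR // mulr_ge0 //; lra.
  rewrite -mulrA [L * x]mulrC mulrA ler_wpM2r //.
  move: L2; rewrite ler_pdivrMr ?mulr_gt0 ?exprn_gt0 // /x expr2; lra.
have h5 : (mu + s^-1) * (expR (- (2 * s * mu) - s * (eps / 2 * L)) *
    expect (primes_le N) (fun S => expR (2 * s * wt f S))) <= eps / 2 * L * G.
  apply: le_trans (ler_wpM2l _ h3) _; first by lra.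
  rewrite mulrA; apply: ler_pM => //; rewrite ?expR_ge0 //.
  by rewrite mulr_ge0 ?expR_ge0 //; lra.
by apply: le_trans (lerD (lexx _) h5) _; lra.
Qed.

(** This controls the correction term of [expect_size_bias] below the
    threshold: for [p >= P0] with [f p > c0], the weight [1/p] is at most
    [f p / (c0 * P0)]. *)
Lemma expect_good_weight (P0 : nat) (tau : R) S : (0 < P0)%N ->
  all prime S -> wt f S < tau ->
  wt (fun p => ((P0 <= p)%N && (c0 < f p)%R)%:R / p%:R) S <= tau / (c0 * P0%:R).
Proof.
move=> P00 pS wS.
have P0R : 0 < P0%:R :> R by rewrite ltr0n.
apply: (@le_trans _ _ (wt f S / (c0 * P0%:R))); last first.
  by rewrite ler_wpM2r ?invr_ge0 ?ltW // mulr_gt0.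
rewrite /wt mulr_suml !big_seq; apply: ler_sum => p /(allP pS) pp.
have p0 : 0 < p%:R :> R by rewrite ltr0n prime_gt0.
have fp := f_gt0 pp.
case: (boolP (_ && _)) => [/andP[Pp cf]|_]; last first.
  by rewrite mul0r divr_ge0 ?ltW // mulr_gt0.
rewrite mul1r ler_pdivlMr ?mulr_gt0 //.
rewrite mulrC ler_pdivrMr //; apply: ler_pM; rewrite ?ler_nat //; exact: ltW.
Qed.

Lemma sum_good_ge N P0 : (0 < N)%N ->
  c1 * lsum N - Kg - P0%:R <=
  mean (primes_le N) (fun p => ((P0 <= p)%N && (c0 < f p)%R)%:R).
Proof.
move=> N0; suff h2 : \sum_(p <- primes_le N) (c0 < f p)%R%:R / p%:R <=
  mean (primes_le N) (fun p => ((P0 <= p)%N && (c0 < f p)%R)%:R) + P0%:R :> R.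
  by rewrite lerBlDr; exact: le_trans (large_weighted N0) h2.
apply: (@le_trans _ _ (mean (primes_le N) (fun p => ((P0 <= p)%N && (c0 < f p)%R)%:R) +
   \sum_(p <- primes_le N) (p < P0)%N%:R)).
  rewrite /mean -big_split /=; apply: ler_sum => p _.
  case: ltP => _; last by rewrite andbF mul0r add0r.
  rewrite andbT; case: leqP => pP; rewrite ?addr0 ?mul0r ?add0r //.
  by rewrite mul1r invn_le1.
rewrite lerD2l -natr_sum ler_nat.
have -> : (\sum_(p <- primes_le N) (p < P0) = count (fun p => p < P0) (primes_le N))%N.
  by rewrite -sum1_count [RHS]big_mkcond; apply: eq_bigr => p _; case: ltnP.
rewrite -size_filter.
rewrite -[leqRHS](size_iota 0); apply: uniq_leq_size.
  by rewrite filter_uniq // uniq_primes_le.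
by move=> p; rewrite mem_filter mem_iota => /andP[].
Qed.

(** [expect_size_bias] for the indicator of [tau <= x] and the jump [c0]: the
    right-hand side is the excess bounded in [truncated_mean_le], and on the
    left the jump occurs exactly when [tau - c0 <= wt f S < tau]. *)
Lemma tail_step (eps : R) : 0 < eps ->
  exists2 kappa : R, 0 < kappa & exists N0, forall N, (N0 <= N)%N ->
    forall tau, tau <= mean_le N + kappa * lsum N ->
    tail (primes_le N) (tau - c0) <= (1 + eps) * tail (primes_le N) tau.
Proof.
move=> eps0; have K40 : 0 < K4 by have := K4_ge1; lra.
have c01 : 0 < c0 * c1 by rewrite mulr_gt0.
have [kap kap0 [N1 hN1]] := truncated_mean_le (divr_gt0 (mulr_gt0 eps0 c01) (ltr0Sn R 3)).
pose P0 := (Num.truncn (4 * (K4 + 1) / (c0 * c1))).+1.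
(* [P0] makes the correction term at most half of the sum over good primes. *)
have hP0 : 4 * (K4 + 1) <= P0%:R * (c0 * c1).
  by rewrite -ler_pdivrMr // ltW // truncnS_gt.
have P0R : 0 < P0%:R :> R by rewrite ltr0n.
have P00 : (0 < P0)%N by [].
clearbody P0.
have [N2 hN2] := lsum_unbounded (2 * (Kg + P0%:R) / c1).
exists (Num.min kap 1); first by rewrite lt_min kap0 ltr01.
exists (maxn 1 (maxn N1 N2)) => N; rewrite !geq_max => /andP[N0 /andP[/hN1 L1 /hN2 L2]] tau htau.
have L0 := lsum_ge0 N; have muL := mean_le_lsum N.
have {}L1 := L1 tau (le_trans htau (lerD (lexx _) (ler_wpM2r L0 (min_lel _ _)))).
have {}htau := le_trans htau (lerD (lexx _) (ler_wpM2r L0 (min_ler _ _))).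
move: L2; rewrite ler_pdivrMr // => L2.
have hgood := sum_good_ge P0 N0.
set L := lsum N in L0 L1 L2 muL htau hgood *; set mu := mean_le N in L1 muL htau *.
set good := (fun p => (P0 <= p)%N && (c0 < f p)).
set M' := mean _ _ in hgood.
have hM' : c1 * L / 2 <= M' by move: hgood L2; lra.
pose g (x : R) : R := (tau <= x)%R%:R.
have gmono x y : x <= y -> g x <= g y.
  by move=> xy; rewrite /g ler_nat; case: (leP tau x) => // /le_trans ->.
have af : all (fun p => 0 <= f p) (primes_le N).
  by apply/allP => p; rewrite mem_primes_le => /andP[/f_ge0].
have h := @expect_size_bias R (primes_le N) f good c0 g 0 gmono (ltW c0_gt0) af
  ltac:(by move=> p _ /andP[_ /ltW]).
set lhs := (X in X <= _) in h; set rhs := (X in _ <= X) in h.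
have hr : rhs <= eps * (c0 * c1) / 4 * L * tail (primes_le N) tau.
  have -> : rhs = expect (primes_le N) (fun S => wt f S * (tau <= wt f S)%R%:R) -
       mu * tail (primes_le N) tau.
    rewrite /rhs /g /mu /tail; congr (_ - _ * _); apply: eq_expect => S; by rewrite add0r.
  by move: L1; lra.
have hl : c0 * (c1 * L / 4 * (tail (primes_le N) (tau - c0) - tail (primes_le N) tau)) <= lhs.
  apply: ler_wpM2l; first exact: ltW.
  rewrite /tail -expectB -expectZ.
  apply: (@expect_le _ prime); first exact: all_prime_primes_le.
  move=> S pS; rewrite add0r /g -/M'.
  case: (leP tau (wt f S)) => tW.
    have -> : tau <= wt f S + c0 by move: tW c0_gt0; lra.
    have -> : tau - c0 <= wt f S by move: tW c0_gt0; lra.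
    by rewrite subrr !mulr0.
  rewrite !subr0 lerBlDr; case: (leP tau (wt f S + c0)) => _; last by rewrite !mulr0.
  rewrite !mulr1.
  have := @expect_good_weight P0 tau S P00 pS tW.
  have : tau / (c0 * P0%:R) <= c1 * L / 4.
    rewrite ler_pdivrMr ?mulr_gt0 //.
    apply: le_trans (_ : (K4 + 1) * L <= _); first by move: htau muL; lra.
    by have := ler_wpM2r L0 hP0; lra.
  by rewrite /good; move: hM'; lra.
have {h}h := le_trans hl (le_trans h hr).
have Lpos : 0 < L.
  have : 0 < L * c1 by apply: lt_le_trans L2; rewrite mulr_gt0 // ltr_wpDl.
  by rewrite pmulr_lgt0.
have k0 : 0 < c0 * c1 / 4 * L by rewrite mulr_gt0 // divr_gt0.
rewrite -(ler_pM2l k0); move: h; lra.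
Qed.

Hypothesis c0_le1 : c0 <= 1.

(** Iterating [tail_step]; [c0 <= 1] makes the number of steps cost at most one
    unit of [v]. *)
Lemma tail_regular (c : R) : 0 < c ->
  exists2 kappa : R, 0 < kappa & exists N0, forall N, (N0 <= N)%N ->
    forall tau, tau <= mean_le N + kappa * lsum N ->
    expR (- (c * lsum N)) <= tail (primes_le N) tau /\
    forall v, 0 <= v ->
    tail (primes_le N) (tau - v) <= expR (c * (v + 1)) * tail (primes_le N) tau.
Proof.
move=> c00; have cc : 0 < c * c0 by rewrite mulr_gt0.
have [k1 k10 [N1 hN1]] := tail_step cc.
have [k2 k20 [N2 hN2]] := tail_lower_bound c00.
exists (Num.min k1 k2); first by rewrite lt_min k10.
exists (maxn N1 N2) => N; rewrite geq_max => /andP[/hN1 step /hN2 low] tau htau.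
have L0 := lsum_ge0 N.
have htau1 := le_trans htau (lerD (lexx _) (ler_wpM2r L0 (min_lel _ _))).
have htau2 := le_trans htau (lerD (lexx _) (ler_wpM2r L0 (min_ler _ _))).
split; first exact: le_trans low (tail_anti _ htau2).
move=> v v0.
have iter n : tail (primes_le N) (tau - n%:R * c0) <=
    expR (c * c0 * n%:R) * tail (primes_le N) tau.
  elim: n => [|n IHn]; first by rewrite mul0r mulr0 expR0 mul1r subr0.
  have -> : tau - n.+1%:R * c0 = (tau - n%:R * c0) - c0 by rewrite -natr1; ring.
  apply: le_trans (step _ _) _.
    by have := mulr_ge0 (ler0n R n) (ltW c0_gt0); move: htau1; lra.
  rewrite -natr1 mulrDr mulr1 expRD [expR _ * expR _]mulrC -[leRHS]mulrA.
  apply: ler_pM => //.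
  - by lra.
  - exact: tail_ge0.
  - exact: expR_ge1Dx.
pose n := (Num.truncn (v / c0)).+1.
have vn : v <= n%:R * c0 by rewrite -ler_pdivrMr // ltW // truncnS_gt.
have nv : n%:R * c0 <= v + 1.
  have : (Num.truncn (v / c0))%:R <= v / c0 by rewrite truncn_le // divr_ge0 // ltW.
  rewrite ler_pdivlMr // /n -natr1; move: c0_le1; lra.
apply: le_trans (tail_anti (primes_le N) (_ : tau - n%:R * c0 <= tau - v)) _; first by lra.
apply: le_trans (iter n) _; rewrite ler_wpM2r ?tail_ge0 // ler_expR.
have := ler_wpM2l (ltW c00) nv; lra.
Qed.

End Regularity.

(** * Divisor sums and the von Mangoldt function *)

Section DivisorSums.
Variable R : realType.
Implicit Types h : nat -> R.

Definition divsum (n : nat) h : R := \sum_(1 <= d < n.+1 | (d %| n)%N) h d.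

Lemma sum_multiples N d h : (0 < d)%N ->
  \sum_(1 <= n < N.+1 | (d %| n)%N) h n = \sum_(1 <= m < (N %/ d).+1) h (d * m)%N.
Proof.
move=> d0; elim: N => [|N IHN]; first by rewrite div0n !big_geq.
rewrite big_mkcond big_nat_recr //= -big_mkcond IHN divnS //.
case: (boolP (d %| N.+1)%N) => dN; last by rewrite add0n addr0.
rewrite [RHS](@big_nat_recr _ _ _ (N %/ d).+1) //=; congr (_ + h _).
by have := divnS N d0; rewrite dN /= add1n => <-; rewrite mulnC divnK.
Qed.

Lemma divsum_widen n N h : (0 < n <= N)%N ->
  divsum n h = \sum_(1 <= d < N.+1 | (d %| n)%N) h d.
Proof.
move=> /andP[n0 nN]; rewrite [RHS](@big_cat_nat _ _ _ n.+1) //=.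
rewrite [X in _ + X]big1_seq ?addr0 // => d /andP[/dvdn_leq dn].
by rewrite mem_index_iota ltnNge dn.
Qed.

Lemma sum_trunc N d h : (0 < d)%N ->
  \sum_(1 <= m < (N %/ d).+1) h m = \sum_(1 <= m < N.+1 | (d * m <= N)%N) h m.
Proof.
move=> d0; rewrite [RHS](@big_cat_nat _ _ _ (N %/ d).+1) //=; last first.
  by rewrite ltnS leq_div.
rewrite [X in _ + X]big1_seq ?addr0; last first.
  move=> m /andP[dm]; rewrite mem_index_iota => /andP[].
  by rewrite ltnNge leq_divRL // mulnC dm.
rewrite big_seq [RHS]big_seq_cond; apply: eq_bigl => m.
rewrite mem_index_iota ltnS leq_divRL // mulnC.
by case: (d * m <= N)%N; rewrite ?andbF ?andbT.
Qed.

(** Both sides run over the pairs with [d * m <= N]. *)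
Lemma sum_hyper_swap N (h : nat -> nat -> R) :
  \sum_(1 <= d < N.+1) \sum_(1 <= m < (N %/ d).+1) h d m =
  \sum_(1 <= m < N.+1) \sum_(1 <= d < (N %/ m).+1) h d m.
Proof.
rewrite big_seq [RHS]big_seq.
under eq_bigr => d.
  rewrite mem_index_iota => /andP[d1 _]; rewrite (sum_trunc _ _ d1); over.
under [RHS]eq_bigr => d.
  rewrite mem_index_iota => /andP[d1 _]; rewrite (sum_trunc _ _ d1).
  under eq_bigl do rewrite mulnC.
  over.
rewrite -!big_seq; exact: exchange_big_dep.
Qed.

Lemma sum_divsum N (h : nat -> nat -> R) :
  \sum_(1 <= n < N.+1) divsum n (fun d => h d (n %/ d)%N) =
  \sum_(1 <= d < N.+1) \sum_(1 <= m < (N %/ d).+1) h d m.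
Proof.
transitivity (\sum_(1 <= n < N.+1) \sum_(1 <= d < N.+1 | (d %| n)%N) h d (n %/ d)%N).
  rewrite big_seq [RHS]big_seq; apply: eq_bigr => n.
  by rewrite mem_index_iota ltnS => nN; rewrite (divsum_widen _ nN).
rewrite (exchange_big_dep predT) //= big_seq [RHS]big_seq.
apply: eq_bigr => d; rewrite mem_index_iota => /andP[d1 _].
rewrite sum_multiples //; apply: eq_bigr => m _; by rewrite mulKn.
Qed.

Lemma divsum_assoc n (h : nat -> nat -> R) : (0 < n)%N ->
  divsum n (fun k => divsum k (fun d => h d (k %/ d)%N)) =
  divsum n (fun d => divsum (n %/ d) (fun e => h d e)).
Proof.
move=> n0.
transitivity (\sum_(1 <= k < n.+1 | (k %| n)%N)
   \sum_(1 <= d < n.+1 | (d %| k)%N) h d (k %/ d)%N).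
  rewrite /divsum big_seq_cond [RHS]big_seq_cond; apply: eq_bigr => k.
  rewrite mem_index_iota ltnS => /andP[kn _].
  exact: (@divsum_widen k n (fun d => h d (k %/ d)%N) kn).
rewrite (exchange_big_dep (fun d => (d %| n)%N)) /=; last first.
  by move=> k d kn dk; exact: dvdn_trans dk kn.
rewrite /divsum big_seq_cond [RHS]big_seq_cond; apply: eq_bigr => d.
rewrite mem_index_iota ltnS => /andP[/andP[d1 dn] ddn].
rewrite big_mkcondl /= sum_multiples // big_mkcond [RHS]big_mkcond /=.
apply: eq_bigr => m _; rewrite mulKn //.
by rewrite -{1}(divnK ddn) mulnC dvdn_pmul2r.
Qed.

End DivisorSums.

Section VonMangoldt.
Variable R : realType.

Definition vm (n : nat) : R :=
  if size (primes n) == 1%N then ln (pdiv n)%:R else 0.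

Lemma vm_ge0 n : 0 <= vm n.
Proof. by rewrite /vm; case: ifP => // _; rewrite ln_ge0 // ler1n pdiv_gt0. Qed.

Lemma vm_prime_power p k : prime p -> (0 < k)%N -> vm (p ^ k) = ln p%:R.
Proof.
move=> pp k0; rewrite /vm primesX // primes_prime //=.
by rewrite -(prednK k0) pdiv_pfactor.
Qed.

Lemma vm_prime p : prime p -> vm p = ln p%:R.
Proof. by move=> pp; rewrite -(@vm_prime_power p 1) // expn1. Qed.

Lemma vm_neq0 n : vm n != 0 ->
  exists p k, [/\ prime p, (0 < k)%N & n = (p ^ k)%N].
Proof.
rewrite /vm; case: ifP => [|_]; last by rewrite eqxx.
case E : (primes n) => [|p [|//]] // _ _.
have pn : p \in primes n by rewrite E mem_head.
have [pp n0 pdn] : [/\ prime p, (0 < n)%N & (p %| n)%N].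
  by move: pn; rewrite mem_primes => /and3P[].
exists p, (logn p n); split=> //; first by rewrite -pfactor_dvdn // expn1.
by rewrite [LHS]prod_prime_decomp // prime_decompE E big_seq1.
Qed.

Lemma vm1 : vm 1 = 0.
Proof. by []. Qed.

(** Induction, dividing [n] by its least prime factor [p]: the divisors that
    disappear and carry weight are reduced to the largest power of [p] in
    [n]. *)
Lemma ln_divsum n : (0 < n)%N -> ln n%:R = divsum n vm :> R.
Proof.
elim/ltn_ind: n => n IHn n0.
case: (ltngtP n 1) => [|n1|->]; first by rewrite ltnNge n0.
  2: by rewrite ln1 /divsum big_mkcond big_nat1 /= vm1.
pose p := pdiv n; have pp : prime p := pdiv_prime n1.
pose m := (n %/ p)%N; have nE : n = (p * m)%N by rewrite mulnC divnK ?pdiv_dvd.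
have p0 := prime_gt0 pp.
have m0 : (0 < m)%N by move: n0; rewrite nE muln_gt0 => /andP[].
have mn : (m < n)%N by rewrite nE ltn_Pmull // prime_gt1.
rewrite nE natrM lnM ?posrE ?ltr0n // -nE addrC.
rewrite (IHn m mn m0) /divsum [RHS](bigID (fun d => (d %| m)%N)) /=.
congr (_ + _).
  rewrite -/(divsum m vm) (divsum_widen (N := n)) ?m0 ?(ltnW mn) //.
  apply: eq_bigl => d; rewrite andb_idl // => dm.
  by rewrite nE dvdn_mull.
have l0 : (0 < logn p n)%N by rewrite logn_gt0 mem_primes pp n0 pdiv_dvd.
have lm : logn p n = (logn p m).+1.
  by rewrite nE lognM // logn_prime // eqxx.
pose e := (p ^ logn p n)%N.
have en : (e %| n)%N by rewrite pfactor_dvdn.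
have em : ~~ (e %| m)%N by rewrite pfactor_dvdn // lm ltnn.
rewrite big_mkcond (bigD1_seq e) /= ?iota_uniq //; last first.
  by rewrite mem_index_iota expn_gt0 p0 ltnS dvdn_leq.
rewrite en em /= vm_prime_power // big1_seq ?addr0 // => d /andP[de _].
case: ifP => // /andP[dn dm]; apply/eqP; apply: contraNT de => /vm_neq0.
move=> [q [k [qp k0 dE]]].
have [qp'|qp'] := eqVneq q p.
  rewrite qp' in dE; move: dn dm; rewrite dE !pfactor_dvdn // lm -ltnNge => k1 k2.
  by apply/eqP; rewrite /e lm; congr (_ ^ _)%N; apply/eqP; rewrite eqn_leq k1.
exfalso; move: dm; rewrite -(@Gauss_dvdr _ p) -?nE ?dn //.
by rewrite dE coprimeXl // prime_coprime // dvdn_prime2.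
Qed.

Lemma sum_ln_hyper (n : nat) :
  \sum_(1 <= m < n.+1) ln m%:R = \sum_(1 <= d < n.+1) vm d * (n %/ d)%:R :> R.
Proof.
transitivity (\sum_(1 <= m < n.+1) divsum m (fun d => (fun d _ => vm d) d (m %/ d)%N)).
  by rewrite big_seq [RHS]big_seq; apply: eq_bigr => m;
     rewrite mem_index_iota => /andP[m0 _]; rewrite ln_divsum.
rewrite (sum_divsum n (fun d _ => vm d)); apply: eq_bigr => d _.
by rewrite big_const_nat subn1 /= iter_addr_0 mulr_natr.
Qed.

(** The powers of [p] up to [n] are at most [ln n / ln p] in number, each of
    weight [ln p]. *)
Lemma vm_sum_le (g : nat -> R) n :
  (forall p, prime p -> 0 <= g p) ->
  (forall p k, prime p -> (0 < k)%N -> g (p ^ k)%N = g p) ->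
  \sum_(1 <= d < n.+1) vm d * g d <= ln n%:R * \sum_(p <- primes_le n) g p.
Proof.
move=> g0 gX.
apply: (@le_trans _ _ (\sum_(1 <= d < n.+1) \sum_(p <- primes_le n)
   \sum_(1 <= k < (trunc_log p n).+1) (d == p ^ k)%N%:R * (ln p%:R * g p))).
  rewrite big_seq [leRHS]big_seq; apply: ler_sum => d.
  rewrite mem_index_iota ltnS => /andP[d0 dn].
  have nonneg p : prime p -> 0 <= \sum_(1 <= k < (trunc_log p n).+1) (d == p ^ k)%N%:R * (ln p%:R * g p).
    move=> pp; apply: sumr_ge0 => k _; rewrite mulr_ge0 // mulr_ge0 ?g0 //.
    by rewrite ln_ge0 // ler1n prime_gt0.
  have [->|/vm_neq0[p [k [pp k0 dE]]]] := eqVneq (vm d) 0.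
    rewrite mul0r big_seq; apply: sumr_ge0 => p.
    by rewrite mem_primes_le => /andP[/nonneg].
  have pd : (p <= d)%N by rewrite dE -{1}(expn1 p) leq_exp2l // prime_gt1.
  rewrite (bigD1_seq p) ?uniq_primes_le //=; last first.
    by rewrite mem_primes_le pp (leq_trans pd).
  apply: ler_wpDr.
    rewrite big_seq_cond; apply: sumr_ge0 => q /andP[].
    by rewrite mem_primes_le => /andP[/nonneg].
  have kl : (k <= trunc_log p n)%N.
    by apply: trunc_log_max; rewrite ?prime_gt1 // -dE.
  rewrite (bigD1_seq k) ?iota_uniq //=; last by rewrite mem_index_iota k0.
  rewrite dE eqxx mul1r vm_prime_power // gX //.
  rewrite lerDl; apply: sumr_ge0 => j _; rewrite mulr_ge0 // mulr_ge0 ?g0 //.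
  by rewrite ln_ge0 // ler1n prime_gt0.
rewrite exchange_big /= mulr_sumr !big_seq; apply: ler_sum => p.
rewrite mem_primes_le => /andP[pp pn].
have n0 : (0 < n)%N by apply: leq_trans pn; exact: prime_gt0.
have lp0 : 0 <= ln p%:R :> R by rewrite ln_ge0 // ler1n prime_gt0.
rewrite exchange_big /=.
apply: (@le_trans _ _ (\sum_(1 <= k < (trunc_log p n).+1) ln p%:R * g p)).
  apply: ler_sum => k _; rewrite -mulr_suml -[leRHS]mul1r.
  rewrite ler_wpM2r ?mulr_ge0 ?g0 // -natr_sum lern1.
  have -> : (\sum_(1 <= d < n.+1) (d == p ^ k) = count_mem (p ^ k)%N (index_iota 1 n.+1))%N.
    by rewrite -sum1_count [RHS]big_mkcond; apply: eq_bigr => d _ /=; case: (d == _).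
  by rewrite count_uniq_mem ?iota_uniq // leq_b1.
rewrite big_const_nat subn1 /= iter_addr_0 -mulrnAl ler_wpM2r ?g0 //.
have p0 := prime_gt0 pp.
rewrite -lnXn ?ltr0n // -natrX ler_ln ?posrE ?ltr0n ?expn_gt0 ?p0 //.
by rewrite ler_nat trunc_logP // prime_gt1.
Qed.

End VonMangoldt.

(** * Estimates of Chebyshev and Mertens *)

Section Chebyshev.
Variable R : realType.
Local Notation vm := (@vm R).

Definition lnfact (n : nat) : R := \sum_(1 <= m < n.+1) ln m%:R.
Definition harm (n : nat) : R := \sum_(1 <= m < n.+1) m%:R^-1.
Definition psi (n : nat) : R := \sum_(1 <= d < n.+1) vm d.

Lemma lnfactE n : lnfact n = ln (n`!)%:R.
Proof.
elim: n => [|n IHn]; first by rewrite /lnfact big_geq // fact0 ln1.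
rewrite /lnfact big_nat_recr //= -/(lnfact n) IHn factS natrM.
by rewrite lnM ?posrE ?ltr0n ?fact_gt0 // addrC.
Qed.

Lemma ln_succ_le n : (0 < n)%N -> ln n.+1%:R - ln n%:R <= n%:R^-1 :> R.
Proof.
move=> n0; have n0R : 0 < n%:R :> R by rewrite ltr0n.
rewrite -ln_div ?posrE ?ltr0n //.
have -> : n.+1%:R / n%:R = 1 + n%:R^-1 :> R by rewrite -natr1; field; rewrite gt_eqF.
by apply: le_ln1Dx; apply: lt_le_trans (_ : 0 <= _); rewrite ?invr_ge0 // oppr_lt0.
Qed.

Lemma ln_succ_ge n : (0 < n)%N -> n.+1%:R^-1 <= ln n.+1%:R - ln n%:R :> R.
Proof.
move=> n0; have n0R : 0 < n%:R :> R by rewrite ltr0n.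
have n1R : 0 < n.+1%:R :> R by rewrite ltr0n.
rewrite -lerN2 opprB -ln_div ?posrE //.
have -> : n%:R / n.+1%:R = 1 + - n.+1%:R^-1 :> R.
  by rewrite -natr1; field; rewrite natr1 gt_eqF.
apply: le_ln1Dx; rewrite ltrN2 invf_lt1 // ltr1n //.
Qed.

Lemma harm_ge n : ln n.+1%:R <= harm n.
Proof.
elim: n => [|n IHn]; first by rewrite /harm big_geq // ln1.
rewrite /harm big_nat_recr //= -/(harm n).
by have := @ln_succ_le n.+1 isT; set q := _^-1; lra.
Qed.

Lemma harm_le n : (0 < n)%N -> harm n <= 1 + ln n%:R.
Proof.
case: n => // n _; elim: n => [|n IHn].
  by rewrite /harm big_nat1 ln1 invr1 addr0.
rewrite /harm big_nat_recr //= -/(harm n.+1).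
by have := @ln_succ_ge n.+1 isT; set q := _^-1; lra.
Qed.

Lemma harm_ln_dist n N : (0 < n <= N)%N ->
  0 <= (harm n - ln n%:R) - (harm N - ln N%:R) <= n%:R^-1.
Proof.
move=> /andP[n0 nN].
have dec k : harm n - ln n%:R >= harm (n + k) - ln (n + k)%:R.
  elim: k => [|k IHk]; first by rewrite addn0.
  rewrite addnS {1}/harm big_nat_recr //= -/(harm (n + k)).
  have := @ln_succ_ge (n + k) ltac:(by rewrite addn_gt0 n0); set q := _^-1; lra.
have inc k : harm n - ln n.+1%:R <= harm (n + k) - ln (n + k).+1%:R.
  elim: k => [|k IHk]; first by rewrite addn0.
  rewrite addnS {2}/harm big_nat_recr //= -/(harm (n + k)).
  have := @ln_succ_le (n + k).+1 isT; set q := _^-1; lra.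
have := dec (N - n)%N; have := inc (N - n)%N; rewrite subnKC // => i1 d1.
have := ln_succ_le n0; have := @ln_succ_ge N (leq_trans n0 nN).
have : 0 <= N.+1%:R^-1 :> R by rewrite invr_ge0.
set q := n%:R^-1; set q' := N.+1%:R^-1.
by move=> h1 h2 h3; apply/andP; split; lra.
Qed.

Lemma lnfact_dist n : (0 < n)%N ->
  0 <= lnfact n - (n%:R * ln n%:R - n%:R) <= 1 + ln n%:R.
Proof.
case: n => // k _.
suff h : 0 <= lnfact k.+1 - (k.+1%:R * ln k.+1%:R - k.+1%:R) <= harm k.+1.
  by case/andP: h => -> h; apply: le_trans h (harm_le _).
elim: k => [|k IHk].
  by rewrite /lnfact /harm !big_nat1 ln1 invr1; apply/andP; split; lra.
rewrite /lnfact /harm big_nat_recr //= [\sum_(1 <= m < k.+3) _^-1]big_nat_recr //=.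
rewrite -/(lnfact k.+1) -/(harm k.+1).
have h1 := @ln_succ_le k.+1 isT; have h2 := @ln_succ_ge k.+1 isT.
have k0 : 0 < k.+1%:R :> R by rewrite ltr0n.
have k20 : 0 < k.+2%:R :> R by rewrite ltr0n.
have e : k.+2%:R = k.+1%:R + 1 :> R by rewrite -natr1.
have h1' := ler_wpM2l (ltW k0) h1; have h2' := ler_wpM2l (ltW k0) h2.
rewrite divff ?gt_eqF // in h1'.
have e2 : k.+1%:R / k.+2%:R = 1 - k.+2%:R^-1 :> R.
  by rewrite -[k.+1%:R](addrK 1) -e mulrBl divff ?gt_eqF // mul1r.
rewrite e2 in h2'.
case/andP: IHk => i1 i2.
set l2 := ln k.+2%:R in h1' h2' *; set l1 := ln k.+1%:R in h1' h2' i1 i2 *.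
set q := k.+2%:R^-1 in h2' *; rewrite e {h1 h2}.
by apply/andP; split; lra.
Qed.

Lemma lnfact_ge n : n%:R * ln n%:R - n%:R <= lnfact n.
Proof.
case: n => [|n]; first by rewrite /lnfact big_geq // mul0r subr0.
by case/andP: (@lnfact_dist n.+1 isT); rewrite subr_ge0.
Qed.

Lemma lnfact_le n : lnfact n <= n%:R * ln n%:R.
Proof.
apply: (@le_trans _ _ (\sum_(1 <= m < n.+1) ln n%:R)).
  rewrite /lnfact big_seq [leRHS]big_seq; apply: ler_sum => m.
  rewrite mem_index_iota ltnS => /andP[m0 mn].
  by rewrite ler_ln ?posrE ?ltr0n ?ler_nat // (leq_trans m0).
by rewrite big_const_nat subn1 /= iter_addr_0 mulr_natl.
Qed.

Lemma psi_ge0 n : 0 <= psi n.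
Proof. by apply: sumr_ge0 => d _; exact: vm_ge0. Qed.

Lemma psi_le_mono m n : (m <= n)%N -> psi m <= psi n.
Proof.
move=> mn; rewrite /psi [leRHS](@big_cat_nat _ _ _ m.+1) //= lerDl.
by apply: sumr_ge0 => d _; exact: vm_ge0.
Qed.

(** The logarithm of the central binomial coefficient is the sum of the
    [vm d * (2n %/ d - 2 * (n %/ d))], where the second factor is nonnegative,
    and equal to 1 for [n < d <= 2n]. *)
Lemma psi_double n : psi n.*2 - psi n <= n.*2%:R.
Proof.
have l2 : ln 2 <= 1 :> R by have := @le_ln1Dx R 1 ltac:(lra); have -> : 1 + 1 = 2 :> R by [].
apply: (@le_trans _ _ (lnfact n.*2 - 2 * lnfact n)).
  rewrite /lnfact !sum_ln_hyper.
  have -> : \sum_(1 <= d < n.+1) vm d * (n %/ d)%:R =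
            \sum_(1 <= d < n.*2.+1) vm d * (n %/ d)%:R.
    rewrite [RHS](@big_cat_nat _ _ _ n.+1) //=; last by rewrite ltnS -addnn leq_addr.
    rewrite [X in _ + X]big1_seq ?addr0 // => d /andP[_].
    by rewrite mem_index_iota => /andP[nd _]; rewrite divn_small ?mulr0.
  have -> : psi n = \sum_(1 <= d < n.*2.+1) vm d * (d <= n)%N%:R.
    rewrite [RHS](@big_cat_nat _ _ _ n.+1) //=; last by rewrite ltnS -addnn leq_addr.
    rewrite [X in _ + X]big1_seq ?addr0 /psi => [|d /andP[_]].
      rewrite big_seq [RHS]big_seq; apply: eq_bigr => d.
      by rewrite mem_index_iota ltnS => /andP[_ ->]; rewrite mulr1.
    by rewrite mem_index_iota => /andP[nd _]; rewrite leqNgt nd mulr0.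
  rewrite mulr_sumr /psi -!sumrB big_seq [leRHS]big_seq; apply: ler_sum => d.
  rewrite mem_index_iota ltnS => /andP[d0 dn].
  have -> : vm d - vm d * (d <= n)%N%:R = vm d * (1 - (d <= n)%N%:R) by ring.
  have -> : vm d * (n.*2 %/ d)%:R - 2 * (vm d * (n %/ d)%:R) =
      vm d * ((n.*2 %/ d)%:R - (n %/ d).*2%:R) by rewrite -[(n %/ d).*2]muln2 natrM; ring.
  rewrite ler_wpM2l ?vm_ge0 // -natrB; last by rewrite leq_divRL // -doubleMl leq_double leq_trunc_div.
  case: leqP => nd; first by rewrite subrr.
  by rewrite (divn_small nd) subn0 subr0 ler1n divn_gt0.
have fE : (n.*2`! = 'C(n.*2, n) * (n`! * n`!))%N.
  by rewrite -(@bin_fact n.*2 n) -?addnn ?leq_addr // addnK.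
rewrite !lnfactE fE !natrM.
have f0 : 0 < (n`!)%:R :> R by rewrite ltr0n fact_gt0.
have b0 : 0 < ('C(n.*2, n))%:R :> R by rewrite ltr0n bin_gt0 -addnn leq_addr.
rewrite !lnM ?posrE ?mulr_gt0 //.
have : ln ('C(n.*2, n))%:R <= n.*2%:R :> R; last by lra.
apply: (@le_trans _ _ (ln ((2 ^ n.*2)%N%:R))).
  rewrite ler_ln ?posrE ?ltr0n ?expn_gt0 ?bin_gt0 //; last by lia.
  rewrite ler_nat.
  have -> : (2 ^ n.*2 = \sum_(i < n.*2.+1) 'C(n.*2, i))%N.
    rewrite -[2%N]/(1 + 1)%N expnDn; apply: eq_bigr => i _.
    by rewrite !exp1n !muln1.
  have nn : (n < n.*2.+1)%N by rewrite ltnS -addnn leq_addr.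
  by rewrite (bigD1 (Ordinal nn)) //= leq_addr.
by rewrite natrX lnXn // -[_ *+ n.*2]mulr_natl ler_piMr.
Qed.

Lemma psi_le n : psi n <= 4 * n%:R.
Proof.
elim/ltn_ind: n => n IHn.
case: (leqP n 2) => n2.
  case: n n2 IHn => [|[|[|//]]] _ _; first by rewrite /psi big_geq // mulr0.
    by rewrite /psi big_nat1 vm1; lra.
  rewrite /psi big_nat_recr //= big_nat1 vm1 vm_prime //.
  have := @ln_sublinear R 2 ltac:(lra); lra.
have h : (uphalf n < n)%N by rewrite uphalf_half; have := odd_double_half n; lia.
have := IHn _ h; have := psi_double (uphalf n).
have : psi n <= psi (uphalf n).*2 by apply: psi_le_mono; rewrite -leq_uphalf_double.
have : (uphalf n).*2%:R = 2 * (uphalf n)%:R :> R by rewrite -muln2 natrM mulrC.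
have : 6 * (uphalf n)%:R <= 4 * n%:R :> R.
  by rewrite -!natrM ler_nat uphalf_half; have := odd_double_half n; lia.
lra.
Qed.

(** A prime [m] with [m ^ 2 > n] has [ln n <= 2 * ln m]; the others are paid for
    by the convergent sum of the [1/m^2], through
    [ln (n / m ^ 2) < n / m ^ 2]. *)
Lemma prime_count_le n : (0 < n)%N -> (size (primes_le n))%:R * ln n%:R <= 10 * n%:R :> R.
Proof.
move=> n0; have n0R : 0 < n%:R :> R by rewrite ltr0n.
rewrite size_primes_le mulr_suml.
apply: (@le_trans _ _ (\sum_(1 <= m < n.+1) (2 * vm m + n%:R * (m%:R^-1) ^+ 2))).
  rewrite big_seq [leRHS]big_seq; apply: ler_sum => m.
  rewrite mem_index_iota => /andP[m0 _].
  have m0R : 0 < m%:R :> R by rewrite ltr0n.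
  case: (boolP (prime m)) => pm; last first.
    by rewrite mul0r addr_ge0 // mulr_ge0 ?vm_ge0 ?ltW ?n0R ?exprn_gt0 ?invr_gt0.
  rewrite mul1r vm_prime //.
  have q0 : 0 < n%:R * (m%:R^-1) ^+ 2 :> R by rewrite mulr_gt0 // exprn_gt0 // invr_gt0.
  have : ln (n%:R * (m%:R^-1) ^+ 2) < n%:R * (m%:R^-1) ^+ 2 :> R by exact: ln_sublinear.
  rewrite lnM ?posrE ?exprn_gt0 ?invr_gt0 // lnXn ?invr_gt0 // lnV ?posrE //.
  by rewrite mulr2n; set q := _ ^+ 2; lra.
rewrite big_split /= -!mulr_sumr.
have := psi_le n; have := ler_wpM2l (ltW n0R) (sum_invn_sqr_le R n); rewrite -/(psi n); lra.
Qed.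

(** In the expansion of [lnfact n] given by [sum_ln_hyper], replacing [n %/ d]
    by [n / d] costs at most [psi n]. *)
Lemma mertens_le n : (0 < n)%N -> \sum_(1 <= d < n.+1) vm d / d%:R <= ln n%:R + 4.
Proof.
move=> n0; have n0R : 0 < n%:R :> R by rewrite ltr0n.
rewrite -(ler_pM2l n0R).
apply: (@le_trans _ _ (lnfact n + psi n)); last first.
  by have := lnfact_le n; have := psi_le n; lra.
rewrite /lnfact sum_ln_hyper /psi mulr_sumr -big_split /= big_seq [leRHS]big_seq.
apply: ler_sum => d; rewrite mem_index_iota => /andP[d0 _].
have d0R : 0 < d%:R :> R by rewrite ltr0n.
rewrite -[X in _ + X]mulr1 -mulrDr mulrCA ler_wpM2l ?vm_ge0 //.
rewrite ler_pdivrMr // natr1 -natrM ler_nat; exact/ltnW/ltn_ceil.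
Qed.

Lemma mertens_ge n : (0 < n)%N -> ln n%:R - 1 <= \sum_(1 <= d < n.+1) vm d / d%:R.
Proof.
move=> n0; have n0R : 0 < n%:R :> R by rewrite ltr0n.
rewrite -(ler_pM2l n0R).
apply: (@le_trans _ _ (lnfact n)); first by have := lnfact_ge n; lra.
rewrite /lnfact sum_ln_hyper mulr_sumr big_seq [leRHS]big_seq.
apply: ler_sum => d; rewrite mem_index_iota => /andP[d0 _].
have d0R : 0 < d%:R :> R by rewrite ltr0n.
rewrite mulrCA ler_wpM2l ?vm_ge0 //.
by rewrite ler_pdivlMr // -natrM ler_nat leq_trunc_div.
Qed.

End Chebyshev.

(** * Moebius inversion and Selberg's symmetry formula *)

Section Moebius.
Variable R : realType.
Local Notation vm := (@vm R).

Definition moebius (n : nat) : R :=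
  \prod_(p <- primes n) (if logn p n == 1%N then -1 else 0).

Lemma moebius_norm n : `|moebius n| <= 1.
Proof.
rewrite /moebius normr_prod; apply: prodr_ile1 => p _.
by rewrite normr_ge0 /=; case: ifP => _; rewrite ?normrN1 ?normr0.
Qed.

Lemma moebius_primeM p e : prime p -> (0 < e)%N -> ~~ (p %| e)%N ->
  moebius (p * e) = - moebius e.
Proof.
move=> pp e0 pe; have p0 := prime_gt0 pp.
have pm : perm_eq (primes (p * e)) (p :: primes e).
  apply: uniq_perm; rewrite ?primes_uniq //=.
    by rewrite mem_primes (negbTE pe) !andbF primes_uniq.
  by move=> q; rewrite primesM // primes_prime // !inE.
rewrite /moebius (perm_big _ pm) /= big_cons.
rewrite lognM // logn_prime // eqxx lognE pp e0 (negbTE pe) /= mulN1r; congr (- _).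
rewrite big_seq [RHS]big_seq; apply: eq_bigr => q.
rewrite mem_primes => /and3P[qp _ qe]; rewrite lognM // logn_prime //.
by have [qE|//] := eqVneq q p; case/negP: pe; rewrite -qE.
Qed.

Lemma moebius_primeM0 p e : prime p -> (0 < e)%N -> (p %| e)%N -> moebius (p * e) = 0.
Proof.
move=> pp e0 pe; have p0 := prime_gt0 pp; apply/eqP; rewrite /moebius.
rewrite prodf_seq_eq0; apply/hasP; exists p.
  by rewrite mem_primes pp muln_gt0 p0 e0 dvdn_mulr.
have l0 : (0 < logn p e)%N by rewrite logn_gt0 mem_primes pp e0 pe.
rewrite lognM // logn_prime // eqxx.
by case: (logn p e) l0 => // k _; rewrite eqxx.
Qed.

Lemma dvdn_coprime_part p d n : prime p -> (0 < n)%N -> ~~ (p %| d)%N ->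
  (d %| n %/ p ^ logn p n)%N = (d %| n)%N.
Proof.
move=> pp n0 pd; set q := (p ^ _)%N.
have qn : (q %| n)%N by rewrite pfactor_dvdn.
rewrite -{2}(divnK qn) Gauss_dvdl // coprime_sym coprimeXl //.
by rewrite prime_coprime.
Qed.

(** Divisors are grouped into pairs [d], [p * d] with [d] prime to [p]; those
    divisible by [p ^ 2] vanish.  Both divisor sums of [moebius] used below
    follow by taking for [g] a constant or the logarithm. *)
Lemma moebius_sum_prime (g : nat -> R) p n : prime p -> (0 < n)%N -> (p %| n)%N ->
  divsum n (fun d => moebius d * g d) =
  divsum (n %/ p ^ logn p n) (fun d => moebius d * (g d - g (p * d)%N)).
Proof.
move=> pp n0 pn; have p0 := prime_gt0 pp.
set q := (p ^ logn p n)%N; set k := (n %/ q)%N.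
have qn : (q %| n)%N by rewrite pfactor_dvdn.
have q0 : (0 < q)%N by rewrite expn_gt0 p0.
have k0 : (0 < k)%N by rewrite divn_gt0 // dvdn_leq.
have pk : ~~ (p %| k)%N.
  apply/negP => pk; have : (p ^ (logn p n).+1 %| n)%N.
    by rewrite -[X in (_ %| X)%N](divnK qn) expnS dvdn_mul.
  by rewrite pfactor_dvdn // ltnn.
have l0 : (0 < logn p n)%N by rewrite logn_gt0 mem_primes pp n0 pn.
have kn : (k <= n %/ p)%N.
  by rewrite leq_div2l // dvdn_leq // -{1}(expn1 p) dvdn_exp2l.
have knn : (k <= n)%N by rewrite leq_div.
have npd d : (d %| k)%N -> ~~ (p %| d)%N.
  by move=> dk; apply: contra pk => pd; apply: dvdn_trans pd dk.
rewrite /divsum (bigID (fun d => (p %| d)%N)) /= addrC.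
under [RHS]eq_bigr => d _ do rewrite mulrBr.
rewrite sumrB -!/(divsum k _); congr (_ + _).
  rewrite (divsum_widen (N := n)) ?k0 //; apply: eq_bigl => d.
  case: (boolP (p %| d)%N) => pd /=; last by rewrite andbT dvdn_coprime_part.
  by rewrite andbF; apply/esym/negbTE; apply: contraL pd => /npd.
rewrite big_mkcondl /= sum_multiples // (divsum_widen (N := (n %/ p)%N)) ?k0 //.
rewrite -sumrN [RHS]big_mkcond /= big_seq [RHS]big_seq; apply: eq_bigr => e.
rewrite mem_index_iota => /andP[e0 _].
case: (boolP (p %| e)%N) => pe.
  rewrite moebius_primeM0 // mul0r; have -> : (e %| k)%N = false.
    by apply/negbTE; apply: contraL pe => /npd.
  by case: ifP.
rewrite moebius_primeM // mulNr -[in RHS](dvdn_coprime_part (p := p)) //=.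
have -> : (k %/ p ^ logn p k)%N = k by rewrite lognE pp k0 (negbTE pk) expn0 divn1.
rewrite dvdn_coprime_part //; congr (if _ then _ else _).
rewrite -{1}(divnK pn) mulnC dvdn_pmul2r //.
apply/idP/idP => [/dvdn_trans|en]; first by apply; rewrite dvdn_div.
have : (p * e %| n)%N by rewrite Gauss_dvd ?pn // prime_coprime.
by rewrite -{1}(divnK pn) mulnC dvdn_pmul2r.
Qed.

Lemma moebius_sum n : (0 < n)%N -> divsum n moebius = (n == 1%N)%:R.
Proof.
move=> n0; have [->|n1] := eqVneq n 1%N.
  by rewrite /divsum big_mkcond big_nat1 /= /moebius big_nil.
have pp : prime (pdiv n) by apply: pdiv_prime; rewrite ltn_neqAle eq_sym n1.
transitivity (divsum n (fun d => moebius d * 1)).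
  by apply: eq_bigr => d _; rewrite mulr1.
rewrite (@moebius_sum_prime (fun=> 1) (pdiv n)) ?pdiv_dvd //.
by rewrite /divsum big1 // => d _; rewrite subrr mulr0.
Qed.

Lemma moebius_ln_sum n : (0 < n)%N ->
  divsum n (fun d => moebius d * ln d%:R) = - vm n.
Proof.
move=> n0; have [->|n1] := eqVneq n 1%N.
  by rewrite /divsum big_mkcond big_nat1 /= ln1 mulr0 vm1 oppr0.
set p := pdiv n.
have pp : prime p by apply: pdiv_prime; rewrite ltn_neqAle eq_sym n1.
have p0 := prime_gt0 pp; have pn : (p %| n)%N by exact: pdiv_dvd.
rewrite (@moebius_sum_prime (fun d => ln d%:R) p) //.
set q := (p ^ logn p n)%N; set k := (n %/ q)%N.
have qn : (q %| n)%N by rewrite pfactor_dvdn.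
have q0 : (0 < q)%N by rewrite expn_gt0 p0.
have k0 : (0 < k)%N by rewrite divn_gt0 // dvdn_leq.
have l0 : (0 < logn p n)%N by rewrite logn_gt0 mem_primes pp n0 pn.
transitivity (- ln p%:R * divsum k moebius).
  rewrite /divsum mulr_sumr big_seq_cond [RHS]big_seq_cond; apply: eq_bigr => d.
  rewrite mem_index_iota => /andP[/andP[d0 _] _].
  by rewrite natrM lnM ?posrE ?ltr0n //; ring.
rewrite moebius_sum // mulNr; congr (- _); rewrite mulr_natr.
have [k1|k1] := eqVneq k 1%N.
  by rewrite mulr1n -(divnK qn) -/k k1 mul1n vm_prime_power.
rewrite mulr0n; apply/esym/eqP; apply: contraNT k1 => /vm_neq0[r [j [rp j0 nE]]].
have rE : r = p by rewrite /p nE -(prednK j0) pdiv_pfactor.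
by rewrite /k /q nE rE pfactorK // divnn expn_gt0 p0.
Qed.

End Moebius.

Section Selberg.
Variable R : realType.
Local Notation vm := (@vm R).
Local Notation psi := (@psi R).
Local Notation harm := (@harm R).
Local Notation lnfact := (@lnfact R).

(** Selberg's function, with Dirichlet series zeta''/zeta. *)
Definition vm2 (k : nat) : R :=
  vm k * ln k%:R + divsum k (fun d => vm d * vm (k %/ d)%N).

Lemma vm2_ge0 k : 0 <= vm2 k.
Proof.
rewrite addr_ge0 ?sumr_ge0 // => [|d _]; last by rewrite mulr_ge0 ?vm_ge0.
case: k => [|k]; first by rewrite /vm /= mul0r.
by rewrite mulr_ge0 ?vm_ge0 // ln_ge0 // ler1n.
Qed.

Lemma ln_sqr_divsum n : (0 < n)%N -> ln n%:R ^+ 2 = divsum n vm2.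
Proof.
move=> n0; rewrite /vm2 /divsum big_split /= -!/(divsum _ _).
rewrite (divsum_assoc (fun d e => vm d * vm e)) // -big_split /=.
transitivity (divsum n (fun d => vm d * ln n%:R)).
  by rewrite /divsum -mulr_suml -/(divsum n vm) -ln_divsum // expr2.
rewrite /divsum big_seq_cond [RHS]big_seq_cond; apply: eq_bigr => d.
rewrite mem_index_iota => /andP[/andP[d0 _] dn].
have k0 : (0 < n %/ d)%N by rewrite divn_gt0 // dvdn_leq.
rewrite -mulr_sumr -/(divsum _ vm) -ln_divsum // -mulrDr; congr (_ * _).
by rewrite -lnM ?posrE ?ltr0n // -natrM mulnC divnK.
Qed.

Lemma sum_inv_sqrt_le n : \sum_(1 <= d < n.+1) (Num.sqrt d%:R)^-1 <= 2 * Num.sqrt n%:R :> R.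
Proof.
elim: n => [|n IHn]; first by rewrite big_geq // sqrtr0 mulr0.
rewrite big_nat_recr //=.
set a := Num.sqrt n%:R in IHn *; set b := Num.sqrt n.+1%:R.
have a0 : 0 <= a by exact: sqrtr_ge0.
have b0 : 0 < b by rewrite sqrtr_gt0 ltr0n.
have ab : b ^+ 2 = a ^+ 2 + 1 by rewrite !sqr_sqrtr ?ler0n // natr1.
suff : b^-1 <= 2 * (b - a) by lra.
rewrite -(ler_pM2r b0) mulVf ?gt_eqF //.
by have := sqr_ge0 (b - a); rewrite !expr2 in ab *; lra.
Qed.

Lemma ln_poly_le (t : R) : 1 <= t -> ln t * (3 + ln t) <= 28 * Num.sqrt t.
Proof.
move=> t1; pose r := Num.sqrt (Num.sqrt t).
have s1 : 1 <= Num.sqrt t by rewrite -(sqrtr1 R) ler_wsqrtr.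
have r1 : 1 <= r by rewrite -(sqrtr1 R) ler_wsqrtr.
have r2 : r ^+ 2 = Num.sqrt t by rewrite sqr_sqrtr ?sqrtr_ge0.
have tE : t = r ^+ 4 by rewrite -[4%N]/(2 * 2)%N exprM r2 sqr_sqrtr //; lra.
have lt : ln t = 4 * ln r.
  by rewrite [in LHS]tE lnXn -1?[LHS]mulr_natl //; apply: lt_le_trans r1.
have lr0 : 0 <= ln r by exact: ln_ge0.
have lr : ln r <= r by rewrite ltW // ln_sublinear //; lra.
rewrite -r2 lt; have h1 : ln r * ln r <= r * r by apply: ler_pM.
have h2 : ln r * 1 <= r * r by apply: ler_pM => //; lra.
by rewrite expr2; lra.
Qed.

Lemma sum_vm_ln_ratio n : (0 < n)%N ->
  0 <= \sum_(1 <= k < n.+1) vm k * (ln n%:R - ln k%:R) <= 4 * n%:R.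
Proof.
move=> n0; have lnn k : (0 < k <= n)%N -> 0 <= ln n%:R - ln k%:R :> R.
  move=> /andP[k0 kn]; rewrite subr_ge0 ler_ln ?posrE ?ltr0n ?ler_nat //.
apply/andP; split.
  rewrite big_seq; apply: sumr_ge0 => k; rewrite mem_index_iota ltnS => kn.
  by rewrite mulr_ge0 ?vm_ge0 ?lnn.
apply: (@le_trans _ _ (\sum_(1 <= k < n.+1) 4 * (ln n%:R - ln k%:R))).
  apply: abel_le => [m _|m /andP[m0 mn]|m mn]; last exact: lnn.
    rewrite big_const_nat subn1 /= iter_addr_0 -[_ *+ m]mulr_natr; exact: psi_le.
  by rewrite lerD2l lerN2 ler_ln ?posrE ?ltr0n // ler_nat.
rewrite -mulr_sumr ler_wpM2l // sumrB big_const_nat subn1 /= iter_addr_0.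
by have := lnfact_ge R n; rewrite -[_ *+ n]mulr_natl /lnfact; lra.
Qed.

Lemma sum_psi_quot z : \sum_(1 <= m < z.+1) psi (z %/ m) = lnfact z.
Proof.
rewrite /psi -(sum_hyper_swap z (fun d _ => vm d)) /lnfact sum_ln_hyper.
by apply: eq_bigr => d _; rewrite big_const_nat subn1 /= iter_addr_0 mulr_natr.
Qed.

(** Summed over the multiples of [d] up to [n], the function inverted in
    [selberg_formula] is [lnfact z - t * harm z + c * z] with [t = n / d] and
    [z] its integer part.  The constant [c = harm n - ln n + 1] stands for
    one plus Euler's constant and cancels the terms of order [z]. *)
Lemma selberg_remainder n d : (0 < d <= n)%N ->
  `|\sum_(1 <= m < (n %/ d).+1)
       (psi (n %/ (d * m)) - n%:R / (d * m)%:R + (harm n - ln n%:R + 1))|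
  <= 3 + (ln n%:R - ln d%:R).
Proof.
move=> /andP[d0 dn]; set c := _ + 1; set z := (n %/ d)%N; set t : R := n%:R / d%:R.
have n0 : (0 < n)%N := leq_trans d0 dn.
have z0 : (0 < z)%N by rewrite divn_gt0.
have d0R : 0 < d%:R :> R by rewrite ltr0n.
have z0R : 0 < z%:R :> R by rewrite ltr0n.
have zt : z%:R <= t by rewrite ler_pdivlMr // -natrM ler_nat leq_trunc_div.
have tz : t <= z%:R + 1 by rewrite ler_pdivrMr // natr1 -natrM ler_nat; exact/ltnW/ltn_ceil.
have -> : \sum_(1 <= m < z.+1) (psi (n %/ (d * m)) - n%:R / (d * m)%:R + c) =
   lnfact z - t * harm z + c * z%:R.
  rewrite big_split /=; congr (_ + _); first rewrite big_split /=; first congr (_ + _).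
  - by rewrite -sum_psi_quot; apply: eq_bigr => m _; rewrite divnMA.
  - rewrite sumrN /harm mulr_sumr; congr (- _); apply: eq_bigr => m _.
    by rewrite natrM invfM mulrA.
  - by rewrite big_const_nat subn1 /= iter_addr_0 mulr_natr.
have /andP[e1 e2] := lnfact_dist R z0.
have /andP[h1 h2] := @harm_ln_dist R z n ltac:(by rewrite z0 leq_div).
have h3 : 0 <= harm n - ln n%:R <= 1.
  have := harm_le R n0; have := harm_ge R n.
  have : ln n%:R <= ln n.+1%:R :> R by rewrite ler_ln ?posrE ?ltr0n // ler_nat.
  by move=> *; apply/andP; split; lra.
have lz0 : 0 <= ln z%:R :> R by rewrite ln_ge0 // ler1n.
have lzt : ln z%:R <= ln n%:R - ln d%:R :> R.
  rewrite -ln_div ?posrE ?ltr0n // ler_ln ?posrE //; exact: lt_le_trans zt.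
set e := lnfact z - _ in e1 e2.
set g := harm n - ln n%:R in h1 h2 h3 *; case/andP: h3 => g0 g1.
set e' := harm z - _ - _ in h1 h2.
have -> : lnfact z - t * harm z + c * z%:R =
  e - (t - z%:R) * ln z%:R - (t - z%:R) * g - t * e'.
  by rewrite /e /e' /c -/g; ring.
have te : t * e' <= 2.
  apply: (@le_trans _ _ ((z%:R + 1) * z%:R^-1)); first by apply: ler_pM => //; lra.
  rewrite mulrDl divff ?gt_eqF // mul1r.
  have : z%:R^-1 <= 1 :> R by rewrite invf_le1 // ler1n.
  by set q := _^-1; lra.
have te0 : 0 <= t * e' by rewrite mulr_ge0 //; lra.
have u1 : 0 <= (t - z%:R) * ln z%:R <= ln z%:R.
  by rewrite mulr_ge0 //=; [rewrite ler_piMl //; lra | lra].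
have u2 : 0 <= (t - z%:R) * g <= 1.
  apply/andP; split; first by rewrite mulr_ge0 //; lra.
  by rewrite -[leRHS]mul1r; apply: ler_pM => //; lra.
case/andP: u1 => u1 u1'; case/andP: u2 => u2 u2'.
by rewrite ler_norml; apply/andP; split; lra.
Qed.

(** The argument of Tatuzawa and Iseki.  Let [F m = psi (n / m) - n / m + c].
    Summing [moebius d * ln (n / d)] times the sum of [F] over the multiples of
    [d] gives [F 1 * ln n] plus the sum of the [vm k * F k], by Moebius
    inversion; the result is [O(n)] since by [selberg_remainder] each inner sum
    is logarithmic.  Expanding, the main terms are those of the formula. *)
Theorem selberg_formula : exists2 K : R, 0 <= K & forall n, (0 < n)%N ->
  `|\sum_(1 <= k < n.+1) vm2 k - 2 * (n%:R * ln n%:R)| <= K * n%:R.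
Proof.
exists 80 => // n n0; have n0R : 0 < n%:R :> R by rewrite ltr0n.
set c := harm n - ln n%:R + 1.
pose F m := psi (n %/ m) - n%:R / m%:R + c.
have c12 : 1 <= c <= 2.
  have := harm_le R n0; have := harm_ge R n.
  have : ln n%:R <= ln n.+1%:R :> R by rewrite ler_ln ?posrE ?ltr0n // ler_nat.
  by rewrite /c => *; apply/andP; split; lra.
have key : \sum_(1 <= d < n.+1) moebius R d * (ln n%:R - ln d%:R) *
      \sum_(1 <= m < (n %/ d).+1) F (d * m)%N =
    F 1%N * ln n%:R + \sum_(1 <= k < n.+1) vm k * F k.
  pose h d m := moebius R d * (ln n%:R - ln d%:R) * F (d * m)%N.
  transitivity (\sum_(1 <= k < n.+1) divsum k (fun d => h d (k %/ d)%N)).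
    by rewrite (sum_divsum n h); apply: eq_bigr => d _; rewrite mulr_sumr.
  transitivity (\sum_(1 <= k < n.+1) ((k == 1%N)%:R * (F k * ln n%:R) + vm k * F k)).
    rewrite big_seq [RHS]big_seq; apply: eq_bigr => k.
    rewrite mem_index_iota => /andP[k0 _].
    transitivity (divsum k (fun d => F k * ln n%:R * moebius R d - F k * (moebius R d * ln d%:R))).
      by apply: eq_bigr => d dk; rewrite /h mulnC divnK //; ring.
    rewrite /divsum sumrB -!mulr_sumr -!/(divsum k _).
    by rewrite moebius_sum // moebius_ln_sum //; ring.
  rewrite big_split /=; congr (_ + _).
  rewrite (bigD1_seq 1%N) ?iota_uniq ?mem_index_iota //=.
  rewrite mul1r big1 ?addr0 // => k /negbTE ->; by rewrite mul0r.
have small : `|\sum_(1 <= d < n.+1) moebius R d * (ln n%:R - ln d%:R) *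
      \sum_(1 <= m < (n %/ d).+1) F (d * m)%N| <= 56 * n%:R.
  apply: le_trans (ler_norm_sum _ _ _) _.
  apply: (@le_trans _ _ (\sum_(1 <= d < n.+1) 28 * Num.sqrt n%:R * (Num.sqrt d%:R)^-1)).
    rewrite big_seq [leRHS]big_seq; apply: ler_sum => d; rewrite mem_index_iota ltnS.
    move=> dn; have /andP[d0 dn'] := dn; have d0R : 0 < d%:R :> R by rewrite ltr0n.
    have l0 : 0 <= ln n%:R - ln d%:R :> R.
      by rewrite subr_ge0 ler_ln ?posrE ?ltr0n // ler_nat.
    rewrite !normrM (ger0_norm l0).
    apply: (@le_trans _ _ (1 * (ln n%:R - ln d%:R) * (3 + (ln n%:R - ln d%:R)))).
      apply: ler_pM; rewrite ?mulr_ge0 ?normr_ge0 //.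
        by rewrite ler_wpM2r // moebius_norm.
      exact: selberg_remainder.
    rewrite mul1r -ln_div ?posrE //; apply: le_trans (ln_poly_le _) _.
      by rewrite ler_pdivlMr // mul1r ler_nat.
    by rewrite sqrtrM // sqrtrV // mulrA.
  rewrite -mulr_sumr; apply: le_trans (ler_wpM2l _ (sum_inv_sqrt_le n)) _.
    by rewrite mulr_ge0 ?sqrtr_ge0.
  have -> : 28 * Num.sqrt n%:R * (2 * Num.sqrt n%:R) = 56 * Num.sqrt n%:R ^+ 2 :> R by ring.
  by rewrite sqr_sqrtr.
have bE : \sum_(1 <= k < n.+1) vm k * F k =
   \sum_(1 <= k < n.+1) vm k * psi (n %/ k) - n%:R * \sum_(1 <= k < n.+1) vm k / k%:R
   + c * psi n.
  rewrite /psi !mulr_sumr -sumrB -big_split /=; apply: eq_bigr => k _.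
  by rewrite /F /psi; ring.
have aE : \sum_(1 <= k < n.+1) vm2 k = psi n * ln n%:R
   - \sum_(1 <= k < n.+1) vm k * (ln n%:R - ln k%:R)
   + \sum_(1 <= k < n.+1) vm k * psi (n %/ k).
  rewrite /vm2 big_split /= (sum_divsum n (fun d m => vm d * vm m)); congr (_ + _).
    by rewrite /psi mulr_suml -sumrB; apply: eq_bigr => k _; ring.
  by apply: eq_bigr => d _; rewrite -mulr_sumr.
have F1 : F 1%N = psi n - n%:R + c by rewrite /F divn1 divr1.
rewrite {}key {}bE F1 in small; rewrite aE.
have /andP[r0 r1] := sum_vm_ln_ratio n0.
have m1 := mertens_le R n0; have m2 := mertens_ge R n0.
set Y := \sum_(1 <= k < n.+1) vm k * psi (n %/ k) in small *.
set Z := \sum_(1 <= k < n.+1) vm k * (ln n%:R - ln k%:R) in r0 r1 *.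
set M := \sum_(1 <= k < n.+1) vm k / k%:R in small m1 m2.
have m1' := ler_wpM2l (ltW n0R) m1; have m2' := ler_wpM2l (ltW n0R) m2.
have p0 := psi_ge0 R n; have p4 := psi_le R n; case/andP: c12 => c1 c2.
have cp : 0 <= c * psi n <= 2 * (4 * n%:R).
  by rewrite mulr_ge0 //=; [apply: ler_pM => //; lra | lra].
have ln0 : 0 <= ln n%:R :> R by rewrite ln_ge0 // ler1n.
have lnn : ln n%:R <= n%:R :> R by rewrite ltW // ln_sublinear.
have cl : 0 <= c * ln n%:R <= 2 * n%:R.
  by rewrite mulr_ge0 //=; [apply: ler_pM => //; lra | lra].
case/andP: cp => cp1 cp2; case/andP: cl => cl1 cl2.
move: small; rewrite !ler_norml => /andP[s1 s2].
by apply/andP; split; lra.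
Qed.

End Selberg.

(** * Strongly additive functions on smooth numbers *)

Section AdditiveFunction.
Variable R : realType.
Variable f : nat -> R.
Hypothesis f_add : forall m n, (0 < m)%N -> (0 < n)%N -> coprime m n ->
  f (m * n)%N = f m + f n.
Hypothesis f_prime_power : forall p k, prime p -> (0 < k)%N -> f (p ^ k)%N = f p.
Hypothesis f_gt0 : forall p, prime p -> 0 < f p.

Lemma f1 : f 1 = 0.
Proof.
have := @f_add 1 1 isT isT (coprimen1 _); rewrite muln1 => h.
by move: h; lra.
Qed.

Lemma f_primes n : (0 < n)%N -> f n = \sum_(p <- primes n) f p.
Proof.
elim/ltn_ind: n => n IHn n0; have [->|n1] := eqVneq n 1%N.
  by rewrite big_nil f1.
set p := pdiv n; have pp : prime p by apply: pdiv_prime; rewrite ltn_neqAle eq_sym n1.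
have p0 := prime_gt0 pp; have pn : (p %| n)%N := pdiv_dvd n.
set q := (p ^ logn p n)%N; set k := (n %/ q)%N.
have qn : (q %| n)%N by rewrite pfactor_dvdn.
have q0 : (0 < q)%N by rewrite expn_gt0 p0.
have k0 : (0 < k)%N by rewrite divn_gt0 // dvdn_leq.
have l0 : (0 < logn p n)%N by rewrite logn_gt0 mem_primes pp n0 pn.
have nE : n = (q * k)%N by rewrite mulnC divnK.
have pk : ~~ (p %| k)%N.
  apply/negP => pk; have : (p ^ (logn p n).+1 %| n)%N.
    by rewrite [X in (_ %| X)%N]nE mulnC expnS dvdn_mul.
  by rewrite pfactor_dvdn // ltnn.
have cqk : coprime q k by rewrite coprimeXl // prime_coprime.
have kn : (k < n)%N.
  by rewrite nE ltn_Pmull // -[1%N](expn0 p) ltn_exp2l // prime_gt1.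
have pm : perm_eq (primes n) (p :: primes k).
  apply: uniq_perm; rewrite ?primes_uniq //=.
    by rewrite mem_primes (negbTE pk) !andbF primes_uniq.
  by move=> r; rewrite nE primesM // primesX // primes_prime // !inE.
by rewrite (perm_big _ pm) big_cons -IHn // nE f_add // f_prime_power.
Qed.

Lemma f_nat_ge0 n : (0 < n)%N -> 0 <= f n.
Proof.
move=> n0; rewrite f_primes // big_seq; apply: sumr_ge0 => p.
by rewrite mem_primes => /andP[/f_gt0/ltW].
Qed.

Lemma f_le_mul m n : (0 < m)%N -> (0 < n)%N -> f m <= f (m * n)%N.
Proof.
move=> m0 n0; have mn0 : (0 < m * n)%N by rewrite muln_gt0 m0.
rewrite !f_primes // [leRHS](bigID (mem (primes m))) /=.
have -> : \sum_(p <- primes m) f p = \sum_(p <- primes (m * n) | p \in primes m) f p.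
  rewrite -[RHS]big_filter; apply: perm_big; apply: uniq_perm.
  - exact: primes_uniq.
  - by rewrite filter_uniq // primes_uniq.
  by move=> p; rewrite mem_filter primesM //; case: (p \in primes m).
rewrite lerDl big_seq_cond; apply: sumr_ge0 => p /andP[].
by rewrite mem_primes => /andP[/f_gt0/ltW].
Qed.

(** The primes common to [m] and [n] are counted once on the left. *)
Lemma f_mul_le m n : (0 < m)%N -> (0 < n)%N -> f (m * n)%N <= f m + f n.
Proof.
move=> m0 n0; have mn0 : (0 < m * n)%N by rewrite muln_gt0 m0.
rewrite (f_primes mn0) (bigID (mem (primes m))) /= (f_primes m0); apply: lerD.
  rewrite -[leLHS]big_filter le_eqVlt; apply/orP; left; apply/eqP.
  apply: perm_big; apply: uniq_perm; rewrite ?filter_uniq ?primes_uniq //.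
  by move=> p; rewrite mem_filter primesM //; case: (p \in primes m).
rewrite (f_primes n0) [leRHS](bigID (fun p => p \notin primes m)) /=.
have -> : \sum_(p <- primes (m * n) | p \notin primes m) f p =
          \sum_(p <- primes n | p \notin primes m) f p.
  rewrite -[LHS]big_filter -[RHS]big_filter; apply: perm_big; apply: uniq_perm.
  - by rewrite filter_uniq // primes_uniq.
  - by rewrite filter_uniq // primes_uniq.
  by move=> p; rewrite !mem_filter primesM //; case: (p \in primes m).
rewrite lerDl big_seq_cond; apply: sumr_ge0 => p /andP[].
by rewrite mem_primes => /andP[/f_gt0/ltW].
Qed.

End AdditiveFunction.

Section SmoothSums.
Variable R : realType.
Implicit Types (l : seq nat) (h : nat -> R).

(** Sum of [h] over the products of powers of elements of [l] with exponents at
    most [J], without weights.  Capping the exponents keeps the sum finite. *)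
Fixpoint smoothsum l (J : nat) h : R :=
  if l is p :: l' then \sum_(0 <= j < J.+1) smoothsum l' J (fun a => h (p ^ j * a)%N)
  else h 1%N.

Lemma smoothsum_le l J h h' : all prime l ->
  (forall a, (0 < a)%N -> {subset primes a <= l} -> h a <= h' a) ->
  smoothsum l J h <= smoothsum l J h'.
Proof.
elim: l h h' => [|p l IHl] h h' /=; first by move=> _; apply.
move=> /andP[pp pl] hh'; apply: ler_sum => j _; apply: IHl => // a a0 al.
have pj0 : (0 < p ^ j)%N by rewrite expn_gt0 prime_gt0.
apply: hh' => [|q]; first by rewrite muln_gt0 pj0.
rewrite primesM // inE => /orP[|/al ->]; last by rewrite orbT.
case: j pj0 => [|j] _; first by rewrite expn0.
by rewrite primesX // primes_prime // inE => ->.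
Qed.

Lemma eq_smoothsum l J h h' : all prime l ->
  (forall a, (0 < a)%N -> {subset primes a <= l} -> h a = h' a) ->
  smoothsum l J h = smoothsum l J h'.
Proof.
move=> pl hh'; apply/eqP; rewrite eq_le.
by apply/andP; split; apply: smoothsum_le => // a a0 al; rewrite hh'.
Qed.

Lemma smoothsumZ l J c h : smoothsum l J (fun a => c * h a) = c * smoothsum l J h.
Proof.
elim: l h => [|p l IHl] h //=.
by rewrite mulr_sumr; apply: eq_bigr => j _; rewrite IHl.
Qed.

Lemma smoothsum_sum l J I (r : seq I) (P : pred I) (F : I -> nat -> R) :
  smoothsum l J (fun a => \sum_(i <- r | P i) F i a) =
  \sum_(i <- r | P i) smoothsum l J (F i).
Proof.
elim: l F => [|p l IHl] F //=.
under eq_bigr do rewrite IHl.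
exact: exchange_big.
Qed.

Lemma smoothsumB l J h h' :
  smoothsum l J (fun a => h a - h' a) = smoothsum l J h - smoothsum l J h'.
Proof.
elim: l h h' => [|p l IHl] h h' //=.
by rewrite -sumrB; apply: eq_bigr => j _; rewrite IHl.
Qed.

Definition rough l (b : nat) := all (fun p => ~~ (p %| b)%N) l.

(** Repeated separation of the multiples of [p]; the exponents above [J >= N] are
    not reached since [N < p ^ J.+1]. *)
Lemma sum_split_prime p N J (P : pred nat) h : prime p -> (N <= J)%N ->
  (forall b, P (p * b)%N = P b) ->
  (forall n, (N < n)%N -> h n = 0) ->
  \sum_(1 <= b < N.+1 | P b) h b =
  \sum_(0 <= j < J.+1) \sum_(1 <= b < N.+1 | P b && ~~ (p %| b)%N) h (p ^ j * b)%N.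
Proof.
move=> pp NJ Pp; have p0 := prime_gt0 pp; have p1 := prime_gt1 pp.
have one (g : nat -> R) : (forall n, (N < n)%N -> g n = 0) ->
    \sum_(1 <= b < N.+1 | P b) g b =
    \sum_(1 <= b < N.+1 | P b && ~~ (p %| b)%N) g b +
    \sum_(1 <= b < N.+1 | P b) g (p * b)%N.
  move=> g0; rewrite (bigID (fun b => (p %| b)%N)) /= addrC; congr (_ + _).
  rewrite big_mkcondl /= sum_multiples //.
  rewrite [RHS](@big_cat_nat _ _ _ (N %/ p).+1) //=; last by rewrite ltnS leq_div.
  rewrite [X in _ = _ + X]big1_seq ?addr0.
    by rewrite [RHS]big_mkcond; apply: eq_bigr => b _; rewrite Pp.
  move=> b /andP[_]; rewrite mem_index_iota => /andP[b1 _]; apply: g0.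
  by rewrite mulnC -ltn_divLR.
have iter k (g : nat -> R) : (forall n, (N < n)%N -> g n = 0) ->
    \sum_(1 <= b < N.+1 | P b) g b =
    \sum_(0 <= j < k) \sum_(1 <= b < N.+1 | P b && ~~ (p %| b)%N) g (p ^ j * b)%N +
    \sum_(1 <= b < N.+1 | P b) g (p ^ k * b)%N.
  elim: k g => [|k IHk] g g0.
    rewrite [X in _ = X + _]big_geq // add0r.
    by apply: eq_bigr => b _; rewrite mul1n.
  rewrite (IHk g g0) [X in _ = X + _]big_nat_recr //= -addrA; congr (_ + _).
  rewrite (one (fun b => g (p ^ k * b)%N)); last first.
    move=> n nN; apply: g0; apply: leq_trans nN _.
    by rewrite leq_pmull // expn_gt0 p0.
  by congr (_ + _); apply: eq_bigr => b _; rewrite mulnA -expnSr.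
move=> h0; rewrite (iter J.+1 h h0) [X in _ + X]big1_seq ?addr0 // => b.
rewrite mem_index_iota => /andP[_ /andP[b1 _]]; apply: h0.
apply: leq_trans (_ : (p ^ J.+1 <= _)%N); last by rewrite leq_pmulr.
by apply: leq_ltn_trans NJ _; apply: ltnW; exact: ltn_expl.
Qed.

Lemma smooth_rough_decomposition l N J h : all prime l -> uniq l -> (N <= J)%N ->
  (forall n, (N < n)%N -> h n = 0) ->
  \sum_(1 <= m < N.+1) h m =
  smoothsum l J (fun a => \sum_(1 <= b < N.+1 | rough l b) h (a * b)%N).
Proof.
move=> + + NJ h0; elim: l => [|p l IHl] /=.
  by move=> _ _; apply: eq_bigr => b _; rewrite mul1n.
move=> /andP[pp pl] /andP[pnl ul]; rewrite IHl //.
rewrite -(smoothsum_sum l J (index_iota 0 J.+1) predT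
  (fun j a => \sum_(1 <= b < N.+1 | rough (p :: l) b) h (p ^ j * a * b)%N)).
apply: eq_smoothsum => // a a0 al.
rewrite (sum_split_prime (p := p) (J := J)) //; first last.
- by move=> n nN; apply: h0; apply: leq_trans nN _; rewrite leq_pmull.
- move=> b; apply: eq_in_all => q ql.
  have qp := allP pl q ql; rewrite Euclid_dvdM // dvdn_prime2 //.
  by have [qE|//] := eqVneq q p; move: pnl; rewrite -qE ql.
apply: eq_bigr => j _; apply: eq_big => b; first by rewrite /rough /= andbC.
by move=> _; congr h; rewrite mulnCA mulnA.
Qed.

Definition euler_factor l : R := \prod_(p <- l) (1 - p%:R^-1)^-1.

Lemma euler_factor_cons p l : euler_factor (p :: l) = (1 - p%:R^-1)^-1 * euler_factor l.
Proof. by rewrite /euler_factor big_cons. Qed.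

Lemma inv_prime_le_half p : prime p -> p%:R^-1 <= 1 / 2 :> R.
Proof.
move=> pp; rewrite div1r lef_pV2 ?posrE ?ltr0n ?prime_gt0 //.
by rewrite ler_nat prime_gt1.
Qed.

Lemma euler_factor_gt0 l : all prime l -> 0 < euler_factor l.
Proof.
move=> pl; rewrite /euler_factor big_seq; apply: prodr_gt0 => p /(allP pl) pp.
by rewrite invr_gt0; have := inv_prime_le_half pp; lra.
Qed.

Lemma geom_sum (q : R) J : (1 - q) * \sum_(1 <= j < J.+1) q ^+ j = q - q ^+ J.+1.
Proof.
elim: J => [|J IHJ]; first by rewrite big_geq // mulr0 expr1 subrr.
by rewrite big_nat_recr //= mulrDr IHJ [q ^+ J.+2]exprS; ring.
Qed.

Lemma geom_sum_le (q : R) J : 0 <= q <= 1 / 2 ->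
  \sum_(1 <= j < J.+1) q ^+ j <= q / (1 - q).
Proof.
move=> /andP[q0 q1]; rewrite ler_pdivlMr; last by lra.
by rewrite mulrC geom_sum lerBlDr lerDl exprn_ge0.
Qed.

Lemma geom_sum_ge (q : R) J : 0 <= q <= 1 / 2 ->
  (1 - (1 / 2) ^+ J) * (q / (1 - q)) <= \sum_(1 <= j < J.+1) q ^+ j.
Proof.
move=> /andP[q0 q1]; rewrite mulrA ler_pdivrMr; last by lra.
rewrite [leRHS]mulrC geom_sum exprSr.
have : q ^+ J <= (1 / 2) ^+ J by apply: lerXn2r; rewrite ?nnegrE //; lra.
by move=> h; have := ler_wpM2r q0 h; lra.
Qed.

Lemma arith_geom_sum_le (q : R) J : 0 <= q <= 1 / 2 ->
  \sum_(1 <= j < J.+1) j%:R * q ^+ j <= 2 * (q / (1 - q)).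
Proof.
move=> /andP[q0 q1].
have e : (1 - q) ^+ 2 * \sum_(1 <= j < J.+1) j%:R * q ^+ j =
    q - (J%:R * (1 - q) + 1) * q ^+ J.+1.
  elim: J => [|J IHJ]; first by rewrite big_geq // mulr0 mul0r add0r mul1r subrr.
  rewrite big_nat_recr //= mulrDr IHJ -natr1 [q ^+ J.+2]exprS; ring.
have h : (1 - q) ^+ 2 * \sum_(1 <= j < J.+1) j%:R * q ^+ j <= q.
  rewrite e lerBlDr lerDl mulr_ge0 ?exprn_ge0 // addr_ge0 // mulr_ge0 //; lra.
have s0 : 0 <= \sum_(1 <= j < J.+1) j%:R * q ^+ j.
  by apply: sumr_ge0 => j _; rewrite mulr_ge0 ?exprn_ge0.
have d0 : 0 < 1 - q by lra.
rewrite mulrA ler_pdivlMr //.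
have : 1 / 2 * ((1 - q) * \sum_(1 <= j < J.+1) j%:R * q ^+ j) <=
  (1 - q) * ((1 - q) * \sum_(1 <= j < J.+1) j%:R * q ^+ j).
  by rewrite ler_wpM2r ?mulr_ge0 //; lra.
by rewrite expr2 -mulrA in h; lra.
Qed.

Section WithF.
Variable f : nat -> R.
Hypothesis f_add : forall m n, (0 < m)%N -> (0 < n)%N -> coprime m n ->
  f (m * n)%N = f m + f n.
Hypothesis f_prime_power : forall p k, prime p -> (0 < k)%N -> f (p ^ k)%N = f p.

Lemma f_prime_power_mul p l j a : prime p -> p \notin l -> (0 < a)%N ->
  {subset primes a <= l} -> (0 < j)%N -> f (p ^ j * a)%N = f p + f a.
Proof.
move=> pp pl a0 al j0; have p0 := prime_gt0 pp.
rewrite f_add ?f_prime_power ?expn_gt0 ?p0 //.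
rewrite coprimeXl // prime_coprime //; apply: contra pl => pa.
by apply: al; rewrite mem_primes pp a0.
Qed.

(** Strong additivity: a nonzero exponent [j] of [p] contributes [f p] whatever
    its value, so that the exponents [j > 0] only enter through the geometric
    weights [p ^- j]. *)
Lemma smoothsum_cons p l J (g : R -> R) (u : nat -> R) : prime p -> p \notin l -> all prime l ->
  smoothsum (p :: l) J (fun a => g (f a) * u a / a%:R) =
  smoothsum l J (fun a => g (f a) * u a / a%:R) +
  \sum_(1 <= j < J.+1) p%:R^-1 ^+ j *
     smoothsum l J (fun a => g (f p + f a) * u (p ^ j * a)%N / a%:R).
Proof.
move=> pp pl al /=; rewrite big_ltn //; congr (_ + _).
  by apply: eq_smoothsum => // a _ _; rewrite mul1n.
rewrite big_seq [RHS]big_seq; apply: eq_bigr => j.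
rewrite mem_index_iota => /andP[j0 _].
rewrite -smoothsumZ; apply: eq_smoothsum => // a a0 sa.
rewrite (f_prime_power_mul pp pl a0 sa j0) natrM invfM natrX exprVn; ring.
Qed.

Lemma smoothsum_cons_unweighted p l J (g : R -> R) : prime p -> p \notin l -> all prime l ->
  smoothsum (p :: l) J (fun a => g (f a) / a%:R) =
  smoothsum l J (fun a => g (f a) / a%:R) +
  (\sum_(1 <= j < J.+1) p%:R^-1 ^+ j) *
     smoothsum l J (fun a => g (f p + f a) / a%:R).
Proof.
move=> pp pl al; have h := smoothsum_cons J g (fun=> 1) pp pl al.
have e l' (g' : R -> R) : smoothsum l' J (fun a => g' (f a) / a%:R) =
    smoothsum l' J (fun a => g' (f a) * 1 / a%:R).
  by congr (smoothsum l' J _); apply: boolp.funext => a; rewrite mulr1.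
by rewrite !e (e l (fun x => g (f p + x))) h mulr_suml.
Qed.

Lemma expect_shift l p (g : R -> R) :
  expect l (fun S => g (wt f (p :: S))) = expect l (fun S => g (f p + wt f S)).
Proof. by apply: eq_expect => S; rewrite wt_cons. Qed.

(** The exponents of [p] in a random smooth integer of weight [1/a]: with
    [q = 1/p], exponent 0 has weight 1 and the others together [q / (1 - q)],
    which are the probabilities [1 - q] and [q] up to the Euler factor. *)
Lemma euler_expect_cons p l (x0 x1 : R) : prime p ->
  (1 - p%:R^-1)^-1 * euler_factor l * ((1 - p%:R^-1) * x0 + p%:R^-1 * x1) =
  euler_factor l * x0 + (p%:R^-1 / (1 - p%:R^-1)) * (euler_factor l * x1).
Proof.
move=> pp; have := inv_prime_le_half pp; set q := p%:R^-1 => q1.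
by field; lra.
Qed.

Lemma inv_prime_bounds p : prime p -> 0 <= (p%:R^-1 : R) <= 1 / 2.
Proof. by move=> pp; rewrite invn_ge0 inv_prime_le_half. Qed.

Lemma smoothsum_ge0 l J h : all prime l -> (forall a, 0 <= h a) -> 0 <= smoothsum l J h.
Proof.
elim: l h => [|p l IHl] h //= /andP[_ pl] h0.
by apply: sumr_ge0 => j _; apply: IHl.
Qed.

Lemma smoothsum_upper l J (g : R -> R) : all prime l -> uniq l ->
  (forall x, 0 <= g x) ->
  smoothsum l J (fun a => g (f a) / a%:R) <=
  euler_factor l * expect l (fun S => g (wt f S)).
Proof.
have f1' := f1 f_add.
elim: l g => [|p l IHl] g.
  by move=> _ _ _; rewrite /= /euler_factor big_nil /wt big_nil f1' invr1 mulr1 mul1r.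
move=> /andP[pp pl] /andP[pnl ul] g0.
rewrite smoothsum_cons_unweighted // euler_factor_cons /= expect_shift euler_expect_cons //.
apply: lerD; first exact: IHl.
apply: ler_pM.
- by apply: sumr_ge0 => j _; rewrite exprn_ge0 // invn_ge0.
- by apply: smoothsum_ge0 => // a; rewrite divr_ge0.
- exact/geom_sum_le/inv_prime_bounds.
- by apply: (IHl (fun x => g (f p + x))).
Qed.

(** Capping the exponents at [J] loses at most a factor [1 - 2 ^- J] per prime. *)
Lemma smoothsum_lower l J (g : R -> R) : all prime l -> uniq l ->
  (forall x, 0 <= g x) ->
  (1 - (1 / 2) ^+ J) ^+ size l * (euler_factor l * expect l (fun S => g (wt f S))) <=
  smoothsum l J (fun a => g (f a) / a%:R).
Proof.
have f1' := f1 f_add.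
set dl : R := 1 - _.
have hJ : 0 <= (1 / 2 : R) ^+ J <= 1.
  have h0 : 0 <= 1 / 2 :> R by lra.
  by rewrite exprn_ge0 //= exprn_ile1 //; lra.
have dl01 : 0 <= dl <= 1 by case/andP: hJ => *; apply/andP; split; rewrite /dl; lra.
have [dl0 dl1] := andP dl01.
elim: l g => [|p l IHl] g.
  by move=> _ _ _; rewrite /= /euler_factor big_nil /wt big_nil f1' expr0 invr1 mulr1 !mul1r.
move=> /andP[pp pl] /andP[pnl ul] g0.
rewrite smoothsum_cons_unweighted // euler_factor_cons [size _]/= [expect _ _]/= expect_shift.
rewrite euler_expect_cons // mulrDr; apply: lerD.
  apply: le_trans (IHl g pl ul g0); rewrite exprS -mulrA ler_piMl //.
  rewrite mulr_ge0 ?exprn_ge0 // mulr_ge0 ?expect_ge0 // ltW // euler_factor_gt0 //.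
have h1 := IHl (fun x => g (f p + x)) pl ul (fun x => g0 _).
have h2 := geom_sum_ge J (inv_prime_bounds pp).
rewrite exprS; set q := _ / (1 - _) in h2 *.
have q0 : 0 <= q.
  rewrite divr_ge0 ?invn_ge0 //; have := inv_prime_le_half pp.
  by set r := p%:R^-1; lra.
have -> : dl * dl ^+ size l * (q * (euler_factor l * expect l (fun S => g (f p + wt f S)))) =
  (dl * q) * (dl ^+ size l * (euler_factor l * expect l (fun S => g (f p + wt f S)))) by ring.
apply: ler_pM => //; first exact: mulr_ge0.
apply: mulr_ge0; first exact: exprn_ge0.
by apply: mulr_ge0; [exact/ltW/euler_factor_gt0 | exact: expect_ge0].
Qed.

(** [ln a] is the sum of the [j * ln p], and the weights [j * q ^+ j] add up to
    at most twice those without [j]. *)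
Lemma smoothsum_ln_upper l J (g : R -> R) w : all prime l -> uniq l ->
  (forall x, 0 <= g x) -> 0 <= w ->
  smoothsum l J (fun a => g (f a) * (w + ln a%:R) / a%:R) <=
  euler_factor l *
    expect l (fun S => (w + wt (fun p => 2 * ln p%:R) S) * g (wt f S)).
Proof.
have f1' := f1 f_add.
elim: l g w => [|p l IHl] g w.
  move=> _ _ _ _; rewrite /= /euler_factor big_nil /wt !big_nil f1' ln1 invr1 mulr1 mul1r.
  by rewrite mulrC.
move=> /andP[pp pl] /andP[pnl ul] g0 w0.
rewrite (smoothsum_cons J g (fun a => w + ln a%:R)) // euler_factor_cons [expect _ _]/=.
rewrite euler_expect_cons //.
have lp0 : 0 <= ln p%:R :> R by rewrite ln_ge0 // ler1n prime_gt0.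
apply: lerD; first exact: IHl.
set q : R := p%:R^-1.
set Z := wt (fun p : nat => 2 * ln p%:R).
pose E0 := expect l (fun S => (w + Z S) * g (f p + wt f S)).
pose E1 := expect l (fun S => g (f p + wt f S)).
have e0 := euler_factor_gt0 pl.
have E10 : 0 <= E1 by rewrite expect_ge0.
have q01 := inv_prime_bounds pp; rewrite -/q in q01; have [q0 q1] := andP q01.
apply: (@le_trans _ _ (\sum_(1 <= j < J.+1)
    (euler_factor l * E0 * q ^+ j + euler_factor l * E1 * ln p%:R * (j%:R * q ^+ j)))).
  apply: ler_sum => j _.
  rewrite -/q; set sm := smoothsum _ _ _.
  have : sm <= euler_factor l * (E0 + j%:R * ln p%:R * E1).
    rewrite /E0 /E1 -expectZ -expectD.
    have jl0 : 0 <= j%:R * ln p%:R :> R by rewrite mulr_ge0.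
    have := IHl (fun x => g (f p + x)) (w + j%:R * ln p%:R) pl ul (fun x => g0 _)
      (addr_ge0 w0 jl0).
    rewrite (@eq_expect _ l _ (fun S => (w + Z S) * g (f p + wt f S) +
         j%:R * ln p%:R * g (f p + wt f S))); last by move=> S; rewrite /Z; ring.
    apply: le_trans; rewrite /sm le_eqVlt; apply/orP; left; apply/eqP.
    apply: eq_smoothsum => // a a0 _; congr (_ * _ / _).
    have p0 := prime_gt0 pp.
    rewrite natrM lnM ?posrE ?ltr0n ?expn_gt0 ?p0 // natrX lnXn ?ltr0n //.
    by rewrite -[_ *+ j]mulr_natl; ring.
  move=> h; have := ler_wpM2l (exprn_ge0 j q0) h; lra.
rewrite big_split /= -!mulr_sumr.
have h1 := geom_sum_le J q01; have h2 := arith_geom_sum_le J q01.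
have -> : expect l (fun S => (w + Z (p :: S)) * g (wt f (p :: S))) =
    E0 + 2 * ln p%:R * E1.
  rewrite /E0 /E1 -expectZ -expectD; apply: eq_expect => S.
  by rewrite /Z !wt_cons; ring.
have E00 : 0 <= E0.
  rewrite -(expect_cst l 0); apply: (@expect_le _ prime) => // S pS.
  rewrite mulr_ge0 // addr_ge0 // /Z /wt big_seq; apply: sumr_ge0 => r rS.
  by rewrite mulr_ge0 // ln_ge0 // ler1n prime_gt0 // (allP pS).
have := ler_wpM2l (mulr_ge0 (ltW e0) E00) h1.
have := ler_wpM2l (mulr_ge0 (mulr_ge0 (ltW e0) E10) lp0) h2.
set u := q / (1 - q); set s1 := \sum_(1 <= j < J.+1) q ^+ j; set s2 := \sum_(1 <= j < J.+1) _.
by move=> i1 i2; lra.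
Qed.

End WithF.
End SmoothSums.

(** * Rough numbers *)

Section RoughSums.
Variable R : realType.
Variable f : nat -> R.
Hypothesis f_add : forall m n, (0 < m)%N -> (0 < n)%N -> coprime m n ->
  f (m * n)%N = f m + f n.
Hypothesis f_prime_power : forall p k, prime p -> (0 < k)%N -> f (p ^ k)%N = f p.
Hypothesis f_gt0 : forall p, prime p -> 0 < f p.

Notation Rough y := (rough (primes_le y)).

Definition rough_harm (y N : nat) : R :=
  \sum_(1 <= b < N.+1 | Rough y b) b%:R^-1.
Definition rough_ln (y N : nat) : R :=
  \sum_(1 <= b < N.+1 | Rough y b) (ln N%:R - ln b%:R) / b%:R.

Lemma rough1 y : Rough y 1.
Proof.
apply/allP => p; rewrite mem_primes_le => /andP[pp _].
by rewrite dvdn1; case: p pp => [|[|p]].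
Qed.

Lemma roughM l a b : rough l (a * b) -> rough l a && rough l b.
Proof.
move=> /allP h; apply/andP; split; apply/allP => p /h; apply: contra => pd.
  exact: dvdn_mulr.
exact: dvdn_mull.
Qed.

(** Each [m <= N] is [a * b] with [a] smooth and [b] rough; here
    [f m <= f a + f b], and the sum over [a] is extended to all smooth [a]. *)
Lemma sum_additive_le (y N : nat) (g : R -> R) (om : nat -> R) :
  (forall x x', x <= x' -> g x <= g x') -> (forall x, 0 <= g x) ->
  (forall b, (0 < b <= N)%N -> 0 <= om b) ->
  (forall a b, (0 < a)%N -> (0 < b)%N -> (a * b <= N)%N -> om (a * b)%N <= om b) ->
  \sum_(1 <= m < N.+1) g (f m) * om m / m%:R <=
  euler_factor R (primes_le y) * \sum_(1 <= b < N.+1 | Rough y b)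
     om b / b%:R * expect (primes_le y) (fun S => g (f b + wt f S)).
Proof.
move=> gmono g0 om0 omM; set l := primes_le y.
have pl : all prime l := all_prime_primes_le y.
have ul : uniq l := uniq_primes_le y.
pose h m := if (m <= N)%N then g (f m) * om m / m%:R else 0.
have -> : \sum_(1 <= m < N.+1) g (f m) * om m / m%:R = \sum_(1 <= m < N.+1) h m.
  rewrite big_seq [RHS]big_seq; apply: eq_bigr => m.
  by rewrite mem_index_iota ltnS /h => /andP[_ ->].
rewrite (smooth_rough_decomposition pl ul (leqnn N)); last first.
  by move=> n; rewrite /h ltnNge => /negbTE ->.
apply: (@le_trans _ _ (smoothsum l N (fun a => \sum_(1 <= b < N.+1 | rough l b)
    (om b / b%:R) * (g (f b + f a) / a%:R)))).
  apply: smoothsum_le => // a a0 _.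
  rewrite big_seq_cond [leRHS]big_seq_cond; apply: ler_sum => b.
  rewrite mem_index_iota ltnS => /andP[/andP[b0 bN] _].
  have obN : 0 <= om b by apply: om0; rewrite b0.
  rewrite /h; case: ifP => abN; last first.
    by rewrite mulr_ge0 // divr_ge0.
  have -> : om b / b%:R * (g (f b + f a) / a%:R) = g (f b + f a) * om b / (a * b)%:R.
    by rewrite natrM invfM; ring.
  rewrite ler_wpM2r ?invr_ge0 //; apply: ler_pM; rewrite ?g0 //.
  - by apply: om0; rewrite muln_gt0 a0 b0.
  - by apply: gmono; rewrite addrC; exact: (f_mul_le f_add f_prime_power f_gt0).
  - exact: omM.
rewrite smoothsum_sum mulr_sumr big_seq_cond [leRHS]big_seq_cond; apply: ler_sum => b.
rewrite mem_index_iota ltnS => /andP[/andP[b0 bN] _].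
have obN : 0 <= om b by apply: om0; rewrite b0.
rewrite smoothsumZ mulrCA; apply: ler_wpM2l; first by rewrite divr_ge0.
exact: (smoothsum_upper f_add f_prime_power N (g := fun x => g (f b + x))).
Qed.

(** Here [f a <= f m].  The weight [ln N - ln b - ln a] of [m = a * b] is
    negative for [a * b > N], so that the sum over [a] may be extended to
    all smooth [a] for a lower bound. *)
Lemma sum_additive_ge (y N J : nat) (g : R -> R) : (0 < N <= J)%N ->
  (forall x x', x <= x' -> g x <= g x') -> (forall x, 0 <= g x) ->
  (1 - (1 / 2) ^+ J) ^+ size (primes_le y) *
    (euler_factor R (primes_le y) * expect (primes_le y) (fun S => g (wt f S))) *
    rough_ln y N -
  euler_factor R (primes_le y) *
    expect (primes_le y) (fun S => wt (fun p => 2 * ln p%:R) S * g (wt f S)) *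
    rough_harm y N <=
  \sum_(1 <= m < N.+1) g (f m) * (ln N%:R - ln m%:R) / m%:R.
Proof.
move=> /andP[N0 NJ] gmono g0; set l := primes_le y.
have pl : all prime l := all_prime_primes_le y.
have ul : uniq l := uniq_primes_le y.
pose h m := if (m <= N)%N then g (f m) * (ln N%:R - ln m%:R) / m%:R else 0.
have -> : \sum_(1 <= m < N.+1) g (f m) * (ln N%:R - ln m%:R) / m%:R = \sum_(1 <= m < N.+1) h m.
  rewrite big_seq [RHS]big_seq; apply: eq_bigr => m.
  by rewrite mem_index_iota ltnS /h => /andP[_ ->].
rewrite (smooth_rough_decomposition pl ul NJ); last first.
  by move=> n; rewrite /h ltnNge => /negbTE ->.
set C := rough_ln y N; set B := rough_harm y N.
have C0 : 0 <= C.
  rewrite /C /rough_ln big_seq_cond; apply: sumr_ge0 => b.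
  rewrite mem_index_iota ltnS => /andP[/andP[b0 bN] _].
  by rewrite divr_ge0 // subr_ge0 ler_ln ?posrE ?ltr0n // ler_nat.
have B0 : 0 <= B by apply: sumr_ge0 => b _; rewrite invr_ge0.
apply: (@le_trans _ _ (smoothsum l J (fun a => C * (g (f a) / a%:R) -
    B * (g (f a) * (0 + ln a%:R) / a%:R)))).
  rewrite smoothsumB !smoothsumZ; apply: lerB.
    by rewrite mulrC ler_wpM2l //; exact: smoothsum_lower.
  rewrite [leRHS]mulrC ler_wpM2l //.
  apply: le_trans (smoothsum_ln_upper f_add f_prime_power J pl ul g0 (lexx _)) _.
  apply: ler_wpM2l; first exact/ltW/euler_factor_gt0.
  by apply: expect_mono => S; rewrite add0r.
apply: smoothsum_le => // a a0 _.
have -> : C * (g (f a) / a%:R) - B * (g (f a) * (0 + ln a%:R) / a%:R) =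
   \sum_(1 <= b < N.+1 | rough l b) g (f a) * (ln N%:R - ln b%:R - ln a%:R) / (a * b)%:R.
  rewrite /C /B /rough_ln /rough_harm -/l !mulr_suml -sumrB; apply: eq_bigr => b _.
  by rewrite natrM invfM; ring.
rewrite big_seq_cond [leRHS]big_seq_cond; apply: ler_sum => b.
rewrite mem_index_iota ltnS => /andP[/andP[b0 bN] _].
have ab0 : (0 < a * b)%N by rewrite muln_gt0 a0.
have lab : ln (a * b)%:R = ln a%:R + ln b%:R :> R by rewrite natrM lnM ?posrE ?ltr0n.
rewrite /h; case: ifP => abN.
  rewrite lab ler_wpM2r ?invr_ge0 //.
  have -> : ln N%:R - ln b%:R - ln a%:R = ln N%:R - (ln a%:R + ln b%:R) :> R by ring.
  rewrite ler_wpM2r //.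
    by rewrite -lab subr_ge0 ler_ln ?posrE ?ltr0n // ler_nat.
  by apply: gmono; exact: (f_le_mul f_add f_prime_power f_gt0).
rewrite mulr_le0_ge0 ?invr_ge0 // mulr_ge0_le0 //.
have : ln N%:R <= ln (a * b)%:R :> R.
  by rewrite ler_ln ?posrE ?ltr0n // ler_nat ltnW // ltnNge abN.
by rewrite lab; lra.
Qed.

Lemma rough_ln_ge_ln y N : (0 < N)%N -> ln N%:R <= rough_ln y N.
Proof.
move=> N0; rewrite /rough_ln big_mkcond big_ltn //= rough1 ln1 subr0 divr1 lerDl.
rewrite big_seq; apply: sumr_ge0 => b; rewrite mem_index_iota ltnS => /andP[b1 bN].
have b0 : (0 < b)%N by apply: leq_trans b1.
case: ifP => // _.
by rewrite divr_ge0 // subr_ge0 ler_ln ?posrE ?ltr0n // ler_nat.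
Qed.

(** To bound the rough harmonic sum by the logarithmic one,
    expand [ln b] as a divisor sum of [vm] and apply the bound of Mertens to
    the factor [d] of [b = d * m]. *)
Lemma rough_ln_harm y N : (0 < N)%N -> (ln N%:R - 4) * rough_harm y N <= 2 * rough_ln y N.
Proof.
move=> N0; set C := rough_ln y N; set B := rough_harm y N.
have e : \sum_(1 <= b < N.+1 | Rough y b) ln b%:R / b%:R = ln N%:R * B - C.
  rewrite /B /C /rough_ln /rough_harm mulr_sumr -sumrB.
  by apply: eq_bigr => b _; ring.
suff : ln N%:R * B - C <= C + 4 * B by lra.
rewrite -e; pose h d m : R := if Rough y (d * m) then vm R d / (d * m)%:R else 0.
have -> : \sum_(1 <= b < N.+1 | Rough y b) ln b%:R / b%:R =
   \sum_(1 <= b < N.+1) divsum b (fun d => h d (b %/ d)%N).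
  rewrite big_mkcond /= big_seq [RHS]big_seq; apply: eq_bigr => b.
  rewrite mem_index_iota => /andP[b0 _].
  transitivity (divsum b (fun d => if Rough y b then vm R d / b%:R else 0)).
    case: ifP => _; last by rewrite /divsum big1.
    by rewrite /divsum -mulr_suml -/(divsum b _) -ln_divsum.
  by apply: eq_bigr => d db; rewrite /h mulnC divnK.
rewrite sum_divsum sum_hyper_swap.
apply: (@le_trans _ _ (\sum_(1 <= m < N.+1 | Rough y m)
   (ln N%:R - ln m%:R + 4) / m%:R)); last first.
  rewrite /C /B /rough_ln /rough_harm mulr_sumr -big_split /= le_eqVlt.
  by apply/orP; left; apply/eqP; apply: eq_bigr => b _; ring.
rewrite [leRHS]big_mkcond /= big_seq [leRHS]big_seq; apply: ler_sum => m.
rewrite mem_index_iota ltnS => /andP[m0 mN].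
have m0R : 0 < m%:R :> R by rewrite ltr0n.
case: ifP => rm; last first.
  rewrite big1 // => d _; rewrite /h; case: ifP => // /roughM/andP[_].
  by rewrite rm.
have q0 : (0 < N %/ m)%N by rewrite divn_gt0.
apply: (@le_trans _ _ (\sum_(1 <= d < (N %/ m).+1) vm R d / d%:R / m%:R)).
  apply: ler_sum => d _; rewrite /h; case: ifP => _.
    by rewrite natrM invfM mulrA.
  by rewrite !divr_ge0 ?vm_ge0.
rewrite -mulr_suml ler_wpM2r ?invr_ge0 //.
apply: le_trans (mertens_le R q0) _; rewrite lerD2r -ln_div ?posrE ?ltr0n //.
rewrite ler_ln ?posrE ?ltr0n ?divr_gt0 ?ltr0n //.
by rewrite ler_pdivlMr // -natrM ler_nat leq_trunc_div.
Qed.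

Definition primes_between (y N : nat) : seq nat :=
  [seq p <- index_iota y.+1 N.+1 | prime p].

Lemma mem_primes_between y N p :
  (p \in primes_between y N) = [&& prime p, (y < p)%N & (p <= N)%N].
Proof. by rewrite mem_filter mem_index_iota ltnS. Qed.

Lemma all_prime_between y N : all prime (primes_between y N).
Proof. by apply/allP => p; rewrite mem_filter => /andP[]. Qed.

Lemma sum_inv_between_le y N : (1 < y <= N)%N ->
  \sum_(p <- primes_between y N) p%:R^-1 <= (ln N%:R + 4) / ln y%:R :> R.
Proof.
move=> /andP[y1 yN]; have N0 : (0 < N)%N by rewrite (leq_trans _ yN) // ltnW.
have ly : 0 < ln y%:R :> R by rewrite ln_gt0 // ltr1n.
rewrite ler_pdivlMr //; apply: le_trans (mertens_le R N0).
rewrite [leRHS](@big_cat_nat _ _ _ y.+1) //= ler_wpDl //.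
  by apply: sumr_ge0 => d _; rewrite divr_ge0 ?vm_ge0.
rewrite mulr_suml big_filter big_mkcond /= big_seq [leRHS]big_seq; apply: ler_sum => p.
rewrite mem_index_iota => /andP[yp _].
case: (boolP (prime p)) => pp; last by rewrite divr_ge0 ?vm_ge0.
rewrite vm_prime // mulrC ler_wpM2r ?invr_ge0 // ler_ln ?posrE ?ltr0n //.
- by rewrite ler_nat ltnW.
- exact: ltnW.
- exact: prime_gt0.
Qed.

Lemma expect_expR_between_le l (c : R) : all prime l -> 0 <= c ->
  expect l (fun S => expR (c * wt f S)) <=
  expR (\sum_(p <- l) (expR (c * f p) - 1) / p%:R).
Proof.
move=> pl c0; rewrite expect_expR expR_sum big_seq [leRHS]big_seq; apply: ler_prod => p pin.
have pp := allP pl p pin.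
rewrite [_ / _]mulrC expR_ge1Dx andbT addr_ge0 // mulr_ge0 ?invr_ge0 //.
by rewrite subr_ge0 -expR0 ler_expR mulr_ge0 // ltW // f_gt0.
Qed.

Lemma euler_factor_le l : all prime l ->
  euler_factor R l <= expR (2 * \sum_(p <- l) p%:R^-1).
Proof.
move=> pl; rewrite mulr_sumr expR_sum /euler_factor big_seq [leRHS]big_seq.
apply: ler_prod => p pin; have pp := allP pl p pin.
have q1 := inv_prime_le_half R pp; have q0 := invn_ge0 R p.
set q : R := p%:R^-1 in q0 q1 *.
rewrite invr_ge0; apply/andP; split; first by lra.
apply: le_trans (expR_ge1Dx _); rewrite -div1r ler_pdivrMr; last by lra.
by nra.
Qed.

(** A rough [b <= N] is a product of powers of primes between [y] and [N], to
    which the upper bound for smooth numbers applies. *)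
Lemma rough_exp_sum_le y N (c : R) : 0 <= c ->
  \sum_(1 <= b < N.+1 | Rough y b) expR (c * f b) / b%:R <=
  expR (\sum_(p <- primes_between y N) (1 + expR (c * f p)) / p%:R).
Proof.
move=> c0; set l := primes_between y N.
have pl : all prime l := all_prime_between y N.
have ul : uniq l by rewrite filter_uniq // iota_uniq.
pose h b := if (b <= N)%N && Rough y b then expR (c * f b) / b%:R else 0.
have -> : \sum_(1 <= b < N.+1 | Rough y b) expR (c * f b) / b%:R = \sum_(1 <= b < N.+1) h b.
  rewrite big_mkcond big_seq [RHS]big_seq; apply: eq_bigr => m.
  by rewrite mem_index_iota ltnS /h => /andP[_ ->].
rewrite (smooth_rough_decomposition pl ul (leqnn N)); last first.
  by move=> n; rewrite /h ltnNge => /negbTE ->.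
apply: (@le_trans _ _ (smoothsum l N (fun a => expR (c * f a) / a%:R))).
  apply: smoothsum_le => // a a0 _.
  rewrite big_mkcond; case: (posnP N) => [N0|N0].
    by rewrite N0 big_geq // divr_ge0 ?expR_ge0.
  rewrite (bigD1_seq 1%N) ?iota_uniq ?mem_index_iota //= [X in _ + X]big1_seq ?addr0.
    case: ifP => _; last by rewrite divr_ge0 ?expR_ge0.
    by rewrite muln1 /h; case: ifP => // _; rewrite divr_ge0 ?expR_ge0.
  move=> b /andP[b1]; rewrite mem_index_iota ltnS => /andP[b0 bN].
  case: ifP => // rb; rewrite /h; case: ifP => // /andP[_ /roughM/andP[_ ryb]].
  have pp : prime (pdiv b) by apply: pdiv_prime; rewrite ltn_neqAle eq_sym b1.
  have pbN : (pdiv b <= N)%N by apply: leq_trans bN; exact: pdiv_leq.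
  have [py|yp] := leqP (pdiv b) y.
    by have := allP ryb (pdiv b); rewrite mem_primes_le pp py pdiv_dvd => /(_ isT).
  by have := allP rb (pdiv b); rewrite mem_primes_between pp yp pbN pdiv_dvd => /(_ isT).
apply: le_trans (smoothsum_upper f_add f_prime_power N (g := fun x => expR (c * x)) pl ul _) _.
  by move=> x; exact: expR_ge0.
apply: (@le_trans _ _ (expR (2 * \sum_(p <- l) p%:R^-1) *
   expR (\sum_(p <- l) (expR (c * f p) - 1) / p%:R))).
  apply: ler_pM; first exact/ltW/euler_factor_gt0.
  - by apply: expect_ge0 => S; exact: expR_ge0.
  - exact: euler_factor_le.
  - exact: expect_expR_between_le.
rewrite -expRD ler_expR mulr_sumr -big_split /= le_eqVlt; apply/orP; left; apply/eqP.
by apply: eq_bigr => p _; ring.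
Qed.

(** A Riemann sum of [(ln N - t) dt] over [0 <= t <= ln N], with [t = ln m]. *)
Lemma sum_ln_ratio_bounds N : (0 < N)%N ->
  1 / 2 * ln N%:R ^+ 2 <= \sum_(1 <= m < N.+1) (ln N%:R - ln m%:R) / m%:R :> R /\
  \sum_(1 <= m < N.+1) (ln N%:R - ln m%:R) / m%:R <= 1 / 2 * ln N%:R ^+ 2 + ln N%:R :> R.
Proof.
move=> N0; pose T (n : nat) := \sum_(1 <= m < n.+1) (ln N%:R - ln m%:R) / m%:R : R.
have lo n : (n <= N)%N -> (0 < n)%N ->
    1 / 2 * ln N%:R ^+ 2 - 1 / 2 * (ln N%:R - ln n%:R) ^+ 2 <=
    T n - (ln N%:R - ln n%:R) / n%:R /\
    T n <= 1 / 2 * ln N%:R ^+ 2 - 1 / 2 * (ln N%:R - ln n%:R) ^+ 2 + ln N%:R.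
  elim: n => // -[|n] IHn nN _.
    by rewrite /T big_nat1 ln1 !subr0 !divr1; split; lra.
  have [i1 i2] := IHn (ltnW nN) isT.
  rewrite /T big_nat_recr //= -/(T n.+1).
  set b := (ln N%:R - ln n.+2%:R) / n.+2%:R; rewrite addrK.
  have h1 := @ln_succ_le R n.+1 isT; have h2 := @ln_succ_ge R n.+1 isT.
  have l1 : ln n.+1%:R <= ln N%:R :> R by rewrite ler_ln ?posrE ?ltr0n ?ler_nat // ltnW.
  have l2 : ln n.+2%:R <= ln N%:R :> R by rewrite ler_ln ?posrE ?ltr0n ?ler_nat.
  have q1 : 0 <= n.+1%:R^-1 :> R by rewrite invr_ge0.
  have q2 : 0 <= n.+2%:R^-1 :> R by rewrite invr_ge0.
  rewrite /b in i1 *.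
  set u1 := ln n.+1%:R in h1 h2 l1 i1 i2 *; set u2 := ln n.+2%:R in h1 h2 l2 *.
  set r1 := n.+1%:R^-1 in h1 h2 i1 q1 *; set r2 := n.+2%:R^-1 in h2 q2 *.
  set u := ln N%:R in l1 l2 i1 i2 *.
  split.
    have : (u2 - u1) * (u - u1) <= r1 * (u - u1) by rewrite ler_wpM2r // subr_ge0.
    have := sqr_ge0 (u2 - u1); rewrite !expr2; lra.
  have : r2 * (u - u2) <= (u2 - u1) * (u - u2) by rewrite ler_wpM2r // subr_ge0.
  have := sqr_ge0 (u2 - u1); rewrite !expr2; lra.
have [h1 h2] := lo N (leqnn _) N0; rewrite subrr mul0r expr0n /= mulr0 !subr0 in h1 h2.
by [].
Qed.

(** Euler: the product of the [(1 - 1/p)^-1] dominates the harmonic sum. *)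
Lemma lsum_unbounded_primes (M : R) :
  exists N0, forall N, (N0 <= N)%N -> M <= lsum R N.
Proof.
exists (Num.truncn (expR (expR (2 * M)))).+1 => N hN.
have N0 : (0 < N)%N by apply: leq_trans hN.
have big : expR (expR (2 * M)) <= N%:R :> R.
  by apply: le_trans (ltW (truncnS_gt _)) _; rewrite ler_nat.
have h1 : expR (2 * M) <= ln N%:R.
  by rewrite -(expRK (expR (2 * M))) ler_ln ?posrE ?expR_gt0 ?ltr0n.
have h2 : ln N%:R <= harm R N.
  apply: le_trans (harm_ge R N); rewrite ler_ln ?posrE ?ltr0n // ler_nat //.
have h3 : harm R N <= euler_factor R (primes_le N).
  have := @sum_additive_le N N (fun=> 1) (fun=> 1) (fun _ _ _ => lexx _)
    (fun _ => ler01) (fun _ _ => ler01) (fun _ _ _ _ _ => lexx _).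
  under eq_bigr => m _ do rewrite !mul1r.
  move/le_trans; apply; rewrite big_mkcond (bigD1_seq 1%N) ?iota_uniq ?mem_index_iota //=.
  rewrite rough1 expect_cst invr1 !mulr1 [X in 1 + X]big1_seq ?addr0 ?mulr1 //.
  move=> b /andP[b1]; rewrite mem_index_iota ltnS => /andP[b0 bN].
  case: ifP => // rb.
  have pp : prime (pdiv b) by apply: pdiv_prime; rewrite ltn_neqAle eq_sym b1.
  have pbN : (pdiv b <= N)%N by apply: leq_trans bN; exact: pdiv_leq.
  by have := allP rb (pdiv b); rewrite mem_primes_le pp pbN pdiv_dvd => /(_ isT).
have := euler_factor_le (all_prime_primes_le N); rewrite -/(lsum R N) => h4.
have : expR (2 * M) <= expR (2 * lsum R N).
  by apply: le_trans h1 _; apply: le_trans h2 _; apply: le_trans h3 h4.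
by rewrite ler_expR; lra.
Qed.

End RoughSums.

(** * Values of an additive function up to N *)

Section Comparison.
Variable R : realType.
Variable f : nat -> R.
Hypothesis f_add : forall m n, (0 < m)%N -> (0 < n)%N -> coprime m n ->
  f (m * n)%N = f m + f n.
Hypothesis f_prime_power : forall p k, prime p -> (0 < k)%N -> f (p ^ k)%N = f p.
Hypothesis f_gt0 : forall p, prime p -> 0 < f p.
Variable K4 : R.
Hypothesis K4_ge1 : 1 <= K4.
Hypothesis f_exp_moment : forall n,
  \sum_(p <- primes_le n) expR (4 * f p) <= K4 * (size (primes_le n))%:R.

Definition nat_count (N : nat) (t : R) : R := \sum_(1 <= n < N.+1) (t <= f n)%R%:R.
(** [lnsqr_count] is the quantity that Selberg's formula computes,
    [lnratio_count] its main term and [harm_count] its error term. *)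
Definition lnratio_count (N : nat) (t : R) : R :=
  \sum_(1 <= m < N.+1) (t <= f m)%R%:R * (ln N%:R - ln m%:R) / m%:R.
Definition harm_count (N : nat) (t : R) : R :=
  \sum_(1 <= m < N.+1) (t <= f m)%R%:R * 1 / m%:R.
Definition lnsqr_count (N : nat) (t : R) : R :=
  \sum_(1 <= n < N.+1) (t <= f n)%R%:R * ln n%:R ^+ 2.

Lemma vm_exp_moment n :
  \sum_(1 <= d < n.+1) vm R d * expR (2 * f d) <= 10 * K4 * n%:R.
Proof.
case: (posnP n) => [->|n0]; first by rewrite big_geq // mulr0.
apply: le_trans (@vm_sum_le R (fun d => expR (2 * f d)) n _ _) _.
- by move=> p _; exact: expR_ge0.
- by move=> p k pp k0; rewrite f_prime_power.
have ln0 : 0 <= ln n%:R :> R by rewrite ln_ge0 // ler1n.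
apply: (@le_trans _ _ (ln n%:R * (K4 * (size (primes_le n))%:R))).
  apply: ler_wpM2l => //; apply: le_trans (f_exp_moment n); rewrite big_seq [leRHS]big_seq.
  apply: ler_sum => p; rewrite mem_primes_le => /andP[pp _].
  by rewrite ler_expR; have := f_gt0 pp; lra.
have K40 : 0 <= K4 by have := K4_ge1; lra.
have := ler_wpM2l K40 (prime_count_le R n0); lra.
Qed.

Lemma vm_exp_moment_div n : (0 < n)%N ->
  \sum_(1 <= d < n.+1) vm R d * expR (2 * f d) / d%:R <= 10 * K4 * (1 + ln n%:R).
Proof.
move=> n0; apply: (@le_trans _ _ (\sum_(1 <= d < n.+1) 10 * K4 * d%:R^-1)).
  apply: abel_le => [m _|m /andP[m0 _]|m _].
  - rewrite big_const_nat subn1 /= iter_addr_0 -[leRHS]mulr_natr.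
    exact: vm_exp_moment.
  - by rewrite lef_pV2 ?posrE ?ltr0n // ler_nat.
  - by rewrite invr_ge0.
rewrite -mulr_sumr -/(harm R n); apply: ler_wpM2l; last exact: harm_le.
by have := K4_ge1; lra.
Qed.

Definition K_vm2 : R := 10 * K4 + (10 * K4) ^+ 2.

(** This makes large values of [f] at the factor [k] of [n = k * m] negligible
    in [lnsqr_count_upper]. *)
Lemma vm2_exp_moment n : (0 < n)%N ->
  \sum_(1 <= k < n.+1) vm2 R k * expR (2 * f k) <= K_vm2 * (n%:R * (1 + ln n%:R)).
Proof.
move=> n0; have ln0 : 0 <= ln n%:R :> R by rewrite ln_ge0 // ler1n.
have K40 : 0 <= 10 * K4 by have := K4_ge1; lra.
pose h d m := vm R d * expR (2 * f d) * (vm R m * expR (2 * f m)).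
apply: (@le_trans _ _ (\sum_(1 <= k < n.+1) (ln n%:R * (vm R k * expR (2 * f k)) +
    divsum k (fun d => h d (k %/ d)%N)))).
  rewrite big_seq [leRHS]big_seq; apply: ler_sum => k.
  rewrite mem_index_iota ltnS => /andP[k0 kn].
  rewrite /vm2 mulrDl; apply: lerD.
    rewrite mulrAC [leRHS]mulrC; apply: ler_wpM2l.
      by rewrite mulr_ge0 ?vm_ge0 ?expR_ge0.
    by rewrite ler_ln ?posrE ?ltr0n ?ler_nat // (leq_trans k0).
  rewrite /divsum mulr_suml big_seq_cond [leRHS]big_seq_cond; apply: ler_sum => d.
  rewrite mem_index_iota ltnS => /andP[/andP[d0 dk] ddk].
  have q0 : (0 < k %/ d)%N by rewrite divn_gt0.
  have -> : h d (k %/ d)%N = vm R d * vm R (k %/ d)%N * (expR (2 * f d) * expR (2 * f (k %/ d)%N)).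
    by rewrite /h; ring.
  apply: ler_wpM2l; first by rewrite mulr_ge0 ?vm_ge0.
  rewrite -expRD ler_expR -mulrDr ler_wpM2l //.
  rewrite -{1}(divnK ddk) addrC; exact: (f_mul_le f_add f_prime_power f_gt0).
rewrite big_split /= -mulr_sumr sum_divsum.
have h1 := ler_wpM2l ln0 (vm_exp_moment n).
have h2 : \sum_(1 <= d < n.+1) \sum_(1 <= m < (n %/ d).+1) h d m <=
    10 * K4 * n%:R * (10 * K4 * (1 + ln n%:R)).
  apply: (@le_trans _ _ (\sum_(1 <= d < n.+1) 10 * K4 * n%:R * (vm R d * expR (2 * f d) / d%:R))).
    rewrite big_seq [leRHS]big_seq; apply: ler_sum => d.
    rewrite mem_index_iota ltnS => /andP[d0 dn].
    rewrite /h -mulr_sumr.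
    have -> : 10 * K4 * n%:R * (vm R d * expR (2 * f d) / d%:R) =
       vm R d * expR (2 * f d) * (10 * K4 * (n%:R / d%:R)) by ring.
    apply: ler_wpM2l; first by rewrite mulr_ge0 ?vm_ge0 ?expR_ge0.
    apply: le_trans (vm_exp_moment _) _; apply: ler_wpM2l => //.
    by rewrite ler_pdivlMr ?ltr0n // -natrM ler_nat leq_trunc_div.
  rewrite -mulr_sumr; apply: ler_wpM2l; first by rewrite mulr_ge0.
  exact: vm_exp_moment_div.
apply: le_trans (lerD h1 h2) _; rewrite /K_vm2.
have : 0 <= 10 * K4 * n%:R by rewrite mulr_ge0.
rewrite expr2; lra.
Qed.

Lemma tail_le_cat (y N : nat) (t : R) : (y <= N)%N ->
  tail f (primes_le y) t <= tail f (primes_le N) t.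
Proof.
move=> yN; rewrite (primes_le_cat yN) /tail expect_cat.
apply: (@expect_le _ prime); first exact: all_prime_primes_le.
move=> S pS; rewrite -[leLHS](expect_cst [seq p <- index_iota y.+1 N.+1 | prime p]).
apply: (@expect_le _ prime) => [|S' pS'].
  by apply/allP => p; rewrite mem_filter => /andP[].
rewrite ler_nat wt_cat; case: (leP t (wt f S)) => // tW.
suff -> : t <= wt f S + wt f S' by [].
have : 0 <= wt f S'.
  by rewrite /wt big_seq; apply: sumr_ge0 => p /(allP pS') /f_gt0/ltW.
by lra.
Qed.

(** The smoothness bound [y] is fixed together with the parameters: [c] is the
    flatness exponent of the model at [tau], and [D], [X] bound the
    contribution of the primes between [y] and [N]. *)
Section FixedScale.
Variables (y N : nat) (c tau X D KS : R).
Hypothesis y_gt1 : (1 < y)%N.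
Hypothesis y_le : (y <= N)%N.
Hypothesis c_gt0 : 0 < c.
Hypothesis c_le : c <= 1 / 2.
Notation G := (tail f (primes_le y)).
Hypothesis reg : forall v, 0 <= v -> G (tau - v) <= expR (c * (v + 1)) * G tau.
Hypothesis D_bound :
  \sum_(p <- primes_between y N) (1 + expR (2 * f p)) / p%:R <= D.
Hypothesis X_def : expR D <= X.
Hypothesis KS_ge0 : 0 <= KS.
Hypothesis selberg : forall n, (0 < n)%N ->
  `|\sum_(1 <= k < n.+1) vm2 R k - 2 * (n%:R * ln n%:R)| <= KS * n%:R.

Let V := euler_factor R (primes_le y).
Let C := rough_ln R y N.
Let B := rough_harm R y N.

Let V_gt0 : 0 < V.
Proof. exact/euler_factor_gt0/all_prime_primes_le. Qed.

Let N_gt0 : (0 < N)%N.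
Proof. by apply: leq_trans y_le; exact: ltnW. Qed.

Let lnN_ge0 : 0 <= ln N%:R :> R.
Proof. by rewrite ln_ge0 // ler1n. Qed.

Let G_ge0 t : 0 <= G t.
Proof. exact: tail_ge0. Qed.

Let C_ge_ln : ln N%:R <= C.
Proof. exact: rough_ln_ge_ln. Qed.

Lemma rough_exp_le_X (a : R) : 0 <= a <= 2 ->
  \sum_(1 <= b < N.+1 | rough (primes_le y) b) expR (a * f b) / b%:R <= X.
Proof.
move=> /andP[a0 a2]; apply: le_trans X_def.
apply: le_trans (rough_exp_sum_le f_add f_prime_power f_gt0 y N a0) _.
rewrite ler_expR; apply: le_trans D_bound.
rewrite big_seq [leRHS]big_seq; apply: ler_sum => p.
rewrite mem_primes_between => /andP[pp _].
by rewrite ler_wpM2r ?invr_ge0 // lerD2l ler_expR ler_wpM2r // ltW // f_gt0.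
Qed.

Lemma expect_shift_tail (t x : R) :
  expect (primes_le y) (fun S => (t <= x + wt f S)%R%:R) = G (t - x).
Proof. by apply: eq_expect => S; rewrite lerBlDl. Qed.

Lemma ind_mono (t x x' : R) : x <= x' -> (t <= x)%R%:R <= (t <= x')%R%:R :> R.
Proof. by move=> xx; rewrite ler_nat; case: (leP t x) => // /le_trans ->. Qed.

Lemma reg_shift v b : 0 <= v -> (0 < b)%N ->
  G (tau - v - f b) <= expR (c * v) * expR c * expR (c * f b) * G tau.
Proof.
move=> v0 b0; have fb0 := f_nat_ge0 f_add f_prime_power f_gt0 b0.
have -> : tau - v - f b = tau - (v + f b) by ring.
apply: le_trans (reg (addr_ge0 v0 fb0)) _.
by rewrite -!expRD le_eqVlt; apply/orP; left; apply/eqP; congr (expR _ * _); ring.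
Qed.

(** For [m = a * b] the rough part shifts the threshold by [f b].  By flatness
    this multiplies the tail by [expR (c * f b) <= 1 + c * expR (2 * f b)], which
    is harmless on average. *)
Lemma lnratio_count_upper v : 0 <= v ->
  lnratio_count N (tau - v) <= V * C * G tau * expR (c * v) * (expR c * (1 + c * X)).
Proof.
move=> v0; rewrite /lnratio_count.
have lnn b : (0 < b <= N)%N -> 0 <= ln N%:R - ln b%:R :> R.
  by move=> /andP[b0 bN]; rewrite subr_ge0 ler_ln ?posrE ?ltr0n // ler_nat.
apply: le_trans (sum_additive_le f_add f_prime_power f_gt0 y
   (g := fun x => (tau - v <= x)%R%:R) (om := fun m => ln N%:R - ln m%:R) _ _ _ _) _.
- exact: ind_mono.
- by [].
- exact: lnn.
- move=> a b a0 b0 abN; rewrite lerD2l lerN2 ler_ln ?posrE ?ltr0n ?muln_gt0 ?a0 //.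
  by rewrite ler_nat leq_pmull.
rewrite -/V -!mulrA; apply: ler_wpM2l; first exact: ltW.
apply: (@le_trans _ _ (\sum_(1 <= b < N.+1 | rough (primes_le y) b)
   (expR (c * v) * expR c * G tau) * ((ln N%:R - ln b%:R) / b%:R +
     c * ln N%:R * (expR (2 * f b) / b%:R)))).
  rewrite big_seq_cond [leRHS]big_seq_cond; apply: ler_sum => b.
  rewrite mem_index_iota ltnS => /andP[/andP[b0 bN] _].
  have lb : 0 <= ln N%:R - ln b%:R :> R by apply: lnn; rewrite b0.
  have fb0 := f_nat_ge0 f_add f_prime_power f_gt0 b0.
  rewrite expect_shift_tail.
  apply: (@le_trans _ _ ((ln N%:R - ln b%:R) / b%:R *
     (expR (c * v) * expR c * expR (c * f b) * G tau))).
    by apply: ler_wpM2l; [rewrite divr_ge0 | exact: reg_shift].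
  have e1 : expR (c * f b) <= 1 + c * expR (2 * f b).
    have := expR_sub1_le (c * f b).
    have : c * f b * expR (c * f b) <= c * expR (2 * f b).
      rewrite -mulrA; apply: ler_wpM2l; first exact: ltW.
      have -> : 2 * f b = f b + f b by ring.
      rewrite expRD; apply: ler_pM; rewrite ?expR_ge0 ?le_expR // ler_expR.
      by rewrite -[leRHS]mul1r ler_wpM2r //; have := c_le; lra.
    lra.
  have -> : (ln N%:R - ln b%:R) / b%:R * (expR (c * v) * expR c * expR (c * f b) * G tau) =
     (expR (c * v) * expR c * G tau) * ((ln N%:R - ln b%:R) * expR (c * f b) / b%:R) by ring.
  apply: ler_wpM2l; first by rewrite !mulr_ge0 ?expR_ge0.
  have -> : (ln N%:R - ln b%:R) / b%:R + c * ln N%:R * (expR (2 * f b) / b%:R) =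
     ((ln N%:R - ln b%:R) + c * ln N%:R * expR (2 * f b)) / b%:R by ring.
  rewrite ler_wpM2r ?invr_ge0 //.
  have := ler_wpM2l lb e1.
  have lb0 : 0 <= ln b%:R :> R by rewrite ln_ge0 // ler1n.
  have : 0 <= ln b%:R * (c * expR (2 * f b)).
    by rewrite mulr_ge0 // mulr_ge0 ?expR_ge0 // ltW.
  lra.
rewrite -mulr_sumr big_split /= -/(rough_ln R y N) -/C -mulr_sumr.
have hX := @rough_exp_le_X 2 ltac:(apply/andP; split; lra).
have X0 : 0 <= X by apply: le_trans X_def; exact: expR_ge0.
have -> : C * (G tau * (expR (c * v) * (expR c * (1 + c * X)))) =
  expR (c * v) * expR c * G tau * (C + c * C * X) by ring.
apply: ler_wpM2l; first by rewrite !mulr_ge0 ?expR_ge0.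
rewrite lerD2l; apply: ler_pM => //.
- by rewrite mulr_ge0 // ltW.
- by apply: sumr_ge0 => b _; rewrite divr_ge0 ?expR_ge0.
by apply: ler_wpM2l; first exact: ltW.
Qed.

Lemma harm_additive_upper (g : R -> R) :
  (forall x x', x <= x' -> g x <= g x') -> (forall x, 0 <= g x) ->
  \sum_(1 <= m < N.+1) g (f m) * 1 / m%:R <=
  V * \sum_(1 <= b < N.+1 | rough (primes_le y) b)
     1 / b%:R * expect (primes_le y) (fun S => g (f b + wt f S)).
Proof.
move=> gm g0; exact: (sum_additive_le f_add f_prime_power f_gt0 y (om := fun=> 1)).
Qed.

Lemma harm_count_upper v : 0 <= v ->
  harm_count N (tau - v) <= V * G tau * expR (c * v) * (expR 1 * X).
Proof.
move=> v0; apply: le_trans (harm_additive_upper (g := fun x => (tau - v <= x)%R%:R) _ _) _.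
- exact: ind_mono.
- by [].
rewrite -!mulrA; apply: ler_wpM2l; first exact: ltW.
have hX := @rough_exp_le_X 2 ltac:(apply/andP; split; lra).
have -> : G tau * (expR (c * v) * (expR 1 * X)) = G tau * expR (c * v) * expR 1 * X by ring.
apply: le_trans (ler_wpM2l _ hX); last by rewrite !mulr_ge0 ?expR_ge0.
rewrite mulr_sumr big_seq_cond [leRHS]big_seq_cond; apply: ler_sum => b.
rewrite mem_index_iota ltnS => /andP[/andP[b0 bN] _].
have fb0 := f_nat_ge0 f_add f_prime_power f_gt0 b0.
rewrite expect_shift_tail.
apply: le_trans (ler_wpM2l _ (reg_shift v0 b0)) _; first by rewrite divr_ge0.
have -> : 1 / b%:R * (expR (c * v) * expR c * expR (c * f b) * G tau) =
  G tau * expR (c * v) / b%:R * (expR c * expR (c * f b)) by ring.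
have -> : G tau * expR (c * v) * expR 1 * (expR (2 * f b) / b%:R) =
  G tau * expR (c * v) / b%:R * (expR 1 * expR (2 * f b)) by ring.
apply: ler_wpM2l; first by rewrite divr_ge0 // mulr_ge0 ?expR_ge0.
rewrite -!expRD ler_expR; apply: lerD; first by have := c_le; lra.
by rewrite ler_wpM2r //; have := c_le; lra.
Qed.

Lemma sum_ln_primes_le n : (0 < n)%N ->
  \sum_(p <- primes_le n) (1 + ln p%:R) / p%:R <= 3 * (ln n%:R + 4) :> R.
Proof.
move=> n0; apply: (@le_trans _ _ (3 * \sum_(1 <= d < n.+1) vm R d / d%:R)); last first.
  by have := mertens_le R n0; lra.
rewrite big_primes_le mulr_sumr big_seq [leRHS]big_seq; apply: ler_sum => p.
rewrite mem_index_iota => /andP[p0 _].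
case: (boolP (prime p)) => pp; last by rewrite mul0r mulr_ge0 // divr_ge0 ?vm_ge0.
rewrite mul1r vm_prime // mulrA ler_wpM2r ?invr_ge0 //.
have l2 : 1 / 2 <= ln p%:R :> R.
  apply: (@le_trans _ _ (ln 2%:R)).
    by have := @ln_succ_ge R 1 isT; rewrite ln1 subr0; lra.
  by rewrite ler_ln ?posrE ?ltr0n // ler_nat prime_gt1.
lra.
Qed.

Definition K_lnwt : R := 6 * expR 1 * K4.

(** The primes [p <= y] of a random set satisfying [tau <= wt f S] have no larger
    logarithmic mass than in the model, up to a constant: given [p \in S] the
    threshold is lowered by [f p], and flatness applies. *)
Lemma expect_ln_le :
  expect (primes_le y) (fun S => wt (fun p => 2 * ln p%:R) S * (tau <= wt f S)%R%:R) <=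
  K_lnwt * (ln y%:R + 4) * G tau.
Proof.
have y0 : (0 < y)%N by exact: ltnW.
have h := @expect_wt_le R (primes_le y) (fun p => 2 * ln p%:R) f
   (fun x => (tau <= x)%R%:R) 0 (@ind_mono tau) _.
rewrite (@eq_expect _ _ _ (fun S => wt (fun p => 2 * ln p%:R) S * (tau <= 0 + wt f S)%R%:R));
  last by move=> S; rewrite add0r.
apply: le_trans (h _) _.
  apply/allP => p; rewrite mem_primes_le => /andP[pp _].
  by rewrite mulr_ge0 ?ln_ge0 ?ler1n ?prime_gt0 //= ltW // f_gt0.
apply: (@le_trans _ _ (2 * expR 1 * G tau *
   \sum_(p <- primes_le y) expR (4 * f p) * ((1 + ln p%:R) / p%:R))).
  rewrite mulr_sumr big_seq [leRHS]big_seq; apply: ler_sum => p.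
  rewrite mem_primes_le => /andP[pp _].
  have fp := f_gt0 pp; have p0 := prime_gt0 pp.
  have lp : 0 <= ln p%:R :> R by rewrite ln_ge0 // ler1n.
  rewrite add0r expect_shift_tail.
  apply: (@le_trans _ _ (2 * ln p%:R / p%:R * (expR (c * (f p + 1)) * G tau))).
    apply: ler_wpM2l; first by rewrite divr_ge0 // mulr_ge0.
    by apply: reg; exact: ltW.
  have -> : 2 * ln p%:R / p%:R * (expR (c * (f p + 1)) * G tau) =
    2 * G tau / p%:R * (ln p%:R * expR (c * (f p + 1))) by ring.
  have -> : 2 * expR 1 * G tau * (expR (4 * f p) * ((1 + ln p%:R) / p%:R)) =
    2 * G tau / p%:R * ((1 + ln p%:R) * (expR 1 * expR (4 * f p))) by ring.
  apply: ler_wpM2l; first by rewrite divr_ge0 // mulr_ge0.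
  apply: ler_pM; rewrite ?expR_ge0 //; first by lra.
  rewrite -expRD ler_expR.
  have : c * (f p + 1) <= 1 * (f p + 1) by rewrite ler_wpM2r //; have := c_le; lra.
  lra.
have h1 : \sum_(p <- primes_le y) expR (4 * f p) * ((1 + ln p%:R) / p%:R) <=
    K4 * (3 * (ln y%:R + 4)).
  apply: le_trans (ler_wpM2l _ (sum_ln_primes_le y0)); last by have := K4_ge1; lra.
  apply: (@exp_moment_weighted _ f K4 f_exp_moment (fun p => (1 + ln p%:R) / p%:R)) => n /andP[n0 ny].
    have n0R : 0 < n%:R :> R by rewrite ltr0n.
    have n1R : 0 < n.+1%:R :> R by rewrite ltr0n.
    rewrite ler_pdivrMr // mulrAC ler_pdivlMr // -natr1.
    have := ler_wpM2l (ltW n0R) (ln_succ_le R n0); rewrite divff ?gt_eqF //.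
    have : 0 <= ln n%:R :> R by rewrite ln_ge0 // ler1n.
    rewrite -[n.+1%:R]natr1; lra.
  by rewrite divr_ge0 // addr_ge0 // ln_ge0 // ler1n.
have : 0 <= 2 * expR 1 * G tau by rewrite !mulr_ge0 ?expR_ge0.
move=> g0; apply: le_trans (ler_wpM2l g0 h1) _.
by rewrite /K_lnwt le_eqVlt; apply/orP; left; apply/eqP; ring.
Qed.

Lemma bernoulli_pow (x : R) n : 0 <= x <= 1 -> 1 - n%:R * x <= (1 - x) ^+ n.
Proof.
move=> /andP[x0 x1]; elim: n => [|n IHn]; first by rewrite mul0r subr0 expr0.
rewrite exprS -natr1.
have h : (1 - x) * (1 - n%:R * x) <= (1 - x) * (1 - x) ^+ n by rewrite ler_wpM2l //; lra.
apply: le_trans h; have : 0 <= n%:R * x * x by rewrite !mulr_ge0.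
lra.
Qed.

(** The loss [ln y / ln N] comes from the logarithm of the smooth part, and
    [N^-1] from the cap on the exponents, taken to be [2 * N]. *)
Lemma lnratio_count_lower : 8 <= ln N%:R :> R ->
  V * C * G tau * (1 - N%:R^-1 - 4 * K_lnwt * (ln y%:R + 4) / ln N%:R) <= lnratio_count N tau.
Proof.
move=> lN8; have N0R : 0 < N%:R :> R by rewrite ltr0n.
have h := @sum_additive_ge R f f_add f_prime_power f_gt0 y N (2 * N)
   (fun x => (tau <= x)%R%:R) _ (@ind_mono tau) _.
apply: le_trans (h _ _); last 2 first.
- by rewrite N_gt0 leq_pmull.
- by [].
rewrite -/V -/C -/B.
set E := expect (primes_le y) (fun S => wt _ S * _).
have hE : E <= K_lnwt * (ln y%:R + 4) * G tau := expect_ln_le.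
have C0 : 0 <= C by apply: le_trans C_ge_ln.
have B0 : 0 <= B by apply: sumr_ge0 => b _; rewrite invr_ge0.
have K50 : 0 <= K_lnwt.
  by rewrite /K_lnwt !mulr_ge0 ?expR_ge0 //; have := K4_ge1; lra.
have ly0 : 0 <= ln y%:R :> R by rewrite ln_ge0 // ler1n ltnW.
have hB : B <= 4 * C / ln N%:R.
  have := rough_ln_harm R y N_gt0; rewrite -/C -/B => hCB.
  rewrite ler_pdivlMr; last by lra.
  have : ln N%:R / 2 * B <= (ln N%:R - 4) * B by rewrite ler_wpM2r //; lra.
  lra.
have hp : 1 - N%:R^-1 <= (1 - (1 / 2) ^+ (2 * N)) ^+ size (primes_le y) :> R.
  have x0 : 0 <= (1 / 2 : R) ^+ (2 * N) <= 1.
    have h0 : 0 <= 1 / 2 :> R by lra.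
    by rewrite exprn_ge0 //= exprn_ile1 //; lra.
  apply: le_trans (bernoulli_pow _ x0); rewrite lerD2l lerN2.
  have s1 : (size (primes_le y))%:R <= N%:R :> R.
    rewrite ler_nat (leq_trans _ y_le) // size_filter.
    by apply: leq_trans (count_size _ _) _; rewrite size_iota subn1.
  have [xx0 xx1] := andP x0.
  apply: le_trans (ler_wpM2r xx0 s1) _.
  rewrite -[leRHS]div1r ler_pdivlMr // mulrAC -expr2 expr_div_n expr1n mulrA mulr1.
  rewrite ler_pdivrMr ?exprn_gt0 // mul1r -!natrX ler_nat mulnC expnM.
  by rewrite leq_sqr ltnW // ltn_expl.
have VG0 : 0 <= V * G tau * C.
  by rewrite !mulr_ge0 // ltW.
have -> : expect (primes_le y) (fun S => (tau <= wt f S)%R%:R) = G tau by [].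
set P := (1 - _) ^+ _ in hp *.
have t1 : (1 - N%:R^-1) * (V * G tau * C) <= P * (V * G tau * C) by rewrite ler_wpM2r.
have t2 : V * E * B <= V * (K_lnwt * (ln y%:R + 4) * G tau) * (4 * C / ln N%:R).
  apply: (@le_trans _ _ (V * (K_lnwt * (ln y%:R + 4) * G tau) * B)).
    by rewrite ler_wpM2r // ler_wpM2l // ltW.
  rewrite ler_wpM2l // mulr_ge0 ?(ltW V_gt0) // mulr_ge0 // mulr_ge0 //; lra.
apply: le_trans (lerB _ t2); last first.
  by apply: le_trans t1 _; rewrite !mulrA.
by rewrite le_eqVlt; apply/orP; left; apply/eqP; ring.
Qed.

Lemma selberg_quot m : (0 < m <= N)%N ->
  `|\sum_(1 <= k < (N %/ m).+1) vm2 R k - 2 * (N%:R / m%:R * (ln N%:R - ln m%:R))| <=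
  (KS + 4) * (N%:R / m%:R).
Proof.
move=> /andP[m0 mN]; set n := (N %/ m)%N; set z : R := N%:R / m%:R.
have n0 : (0 < n)%N by rewrite divn_gt0.
have m0R : 0 < m%:R :> R by rewrite ltr0n.
have n0R : 0 < n%:R :> R by rewrite ltr0n.
have n1R : 1 <= n%:R :> R by rewrite ler1n.
have nz : n%:R <= z by rewrite ler_pdivlMr // -natrM ler_nat leq_trunc_div.
have zn : z <= n%:R + 1 by rewrite ler_pdivrMr // natr1 -natrM ler_nat; exact/ltnW/ltn_ceil.
have z0 : 0 < z by apply: lt_le_trans nz.
rewrite -ln_div ?posrE ?ltr0n // -/z.
have lnz : ln n%:R <= ln z by rewrite ler_ln ?posrE.
have ln0 : 0 <= ln n%:R :> R by rewrite ln_ge0.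
have lzz : ln z < z by exact: ln_sublinear.
have ratio : n%:R * (ln z - ln n%:R) <= 1.
  have e : z = n%:R * (1 + (z - n%:R) / n%:R) by field; rewrite gt_eqF.
  have q0 : 0 <= (z - n%:R) / n%:R by rewrite divr_ge0 // subr_ge0.
  have := @le_ln1Dx R ((z - n%:R) / n%:R) ltac:(lra).
  have -> : ln (1 + (z - n%:R) / n%:R) = ln z - ln n%:R.
    by rewrite [in RHS]e lnM ?posrE //; [ring | lra].
  move=> h; have := ler_wpM2l (ltW n0R) h.
  have -> : n%:R * ((z - n%:R) / n%:R) = z - n%:R by field; rewrite gt_eqF.
  lra.
have low : z * ln z - n%:R * ln n%:R <= 2 * z.
  have : (z - n%:R) * ln z <= 1 * ln z by rewrite ler_wpM2r //; lra.
  lra.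
have up : n%:R * ln n%:R <= z * ln z by apply: ler_pM => //; exact: ltW.
have := selberg n0; have : KS * n%:R <= KS * z by rewrite ler_wpM2l.
rewrite !ler_norml => h /andP[s1 s2].
by apply/andP; split; lra.
Qed.

Lemma lnsqr_count_hyper (t : R) :
  lnsqr_count N t = \sum_(1 <= m < N.+1) \sum_(1 <= k < (N %/ m).+1)
     vm2 R k * (t <= f (k * m)%N)%R%:R.
Proof.
pose h k m := vm2 R k * (t <= f (k * m)%N)%R%:R.
rewrite -(sum_hyper_swap N h) -sum_divsum /lnsqr_count big_seq [RHS]big_seq.
apply: eq_bigr => n; rewrite mem_index_iota => /andP[n0 _].
rewrite ln_sqr_divsum // mulrC /divsum mulr_suml; apply: eq_bigr => d dn.
by rewrite /h mulnC divnK.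
Qed.

Lemma sum_weighted_quot (u : nat -> R) : (forall m, (0 < m)%N -> 0 <= u m) ->
  N%:R * (2 * \sum_(1 <= m < N.+1) u m * (ln N%:R - ln m%:R) / m%:R -
     (KS + 4) * \sum_(1 <= m < N.+1) u m * 1 / m%:R) <=
  \sum_(1 <= m < N.+1) u m * \sum_(1 <= k < (N %/ m).+1) vm2 R k /\
  \sum_(1 <= m < N.+1) u m * \sum_(1 <= k < (N %/ m).+1) vm2 R k <=
  N%:R * (2 * \sum_(1 <= m < N.+1) u m * (ln N%:R - ln m%:R) / m%:R +
     (KS + 4) * \sum_(1 <= m < N.+1) u m * 1 / m%:R).
Proof.
move=> u0; split.
  rewrite !mulr_sumr -sumrB mulr_sumr big_seq [leRHS]big_seq; apply: ler_sum => m.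
  rewrite mem_index_iota ltnS => mN; have /andP[m0 _] := mN.
  have := selberg_quot mN; rewrite ler_norml => /andP[h _].
  have := ler_wpM2l (u0 m m0) h; lra.
rewrite !mulr_sumr -big_split mulr_sumr big_seq [leRHS]big_seq; apply: ler_sum => m.
rewrite mem_index_iota ltnS => mN; have /andP[m0 _] := mN.
have := selberg_quot mN; rewrite ler_norml => /andP[_ h].
have := ler_wpM2l (u0 m m0) h => /=; lra.
Qed.

Lemma lnsqr_count_lower : N%:R * (2 * lnratio_count N tau - (KS + 4) * harm_count N tau) <= lnsqr_count N tau.
Proof.
have [h _] := @sum_weighted_quot (fun m => (tau <= f m)%R%:R) (fun _ _ => ler0n _ _).
apply: le_trans h _; rewrite lnsqr_count_hyper big_seq [leRHS]big_seq; apply: ler_sum => m.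
rewrite mem_index_iota => /andP[m0 _].
rewrite mulr_sumr big_seq [leRHS]big_seq; apply: ler_sum => k.
rewrite mem_index_iota => /andP[k0 _].
rewrite mulrC ler_wpM2l ?vm2_ge0 //; apply: ind_mono.
by rewrite mulnC; exact: (f_le_mul f_add f_prime_power f_gt0).
Qed.

(** A softened indicator of [tau <= x].  Unlike the indicator it grows by a
    factor of at most [expR x] under a shift by [x >= 0], and its mean is still
    of the order of the tail. *)
Definition soft (x : R) : R := expR (Num.min 0 (x - tau)).

Lemma soft_mono x x' : x <= x' -> soft x <= soft x'.
Proof.
move=> xx; rewrite ler_expR; case: (leP 0 (x - tau)) => h1; case: (leP 0 (x' - tau)) => h2 //; lra.
Qed.

Lemma soft_shift x z : 0 <= x -> soft (x + z) <= expR x * soft z.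
Proof.
move=> x0; rewrite -expRD ler_expR.
by case: (leP 0 (z - tau)) => h1; case: (leP 0 (x + z - tau)) => h2; lra.
Qed.

(** Layers [tau - j.+1 <= wt f S < tau - j], each bounded by flatness. *)
Lemma expect_soft_le : expect (primes_le y) (fun S => soft (wt f S)) <= 3 * expR 1 * G tau.
Proof.
pose J := (Num.truncn `|tau|).+1.
apply: (@le_trans _ _ (\sum_(0 <= j < J) expR (- j%:R) * G (tau - j.+1%:R))).
  under eq_bigr => j _ do rewrite -expectZ.
  rewrite -expect_sum; apply: (@expect_le _ prime); first exact: all_prime_primes_le.
  move=> S pS; have W0 : 0 <= wt f S.
    by rewrite /wt big_seq; apply: sumr_ge0 => p /(allP pS) /f_gt0/ltW.
  set W := wt f S in W0 *.
  pose r := Num.max 0 (tau - W).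
  have r0 : 0 <= r by rewrite le_max lexx.
  have rt : r <= `|tau|.
    by rewrite ge_max normr_ge0 /=; have := ler_norm tau; lra.
  pose j := Num.truncn r.
  have jr : j%:R <= r by rewrite truncn_le.
  have rj : r < j.+1%:R by exact: truncnS_gt.
  have jJ : (j < J)%N.
    by rewrite /J ltnS; exact: le_truncn.
  rewrite (bigD1_seq j) ?iota_uniq ?mem_index_iota //=.
  apply: ler_wpDr; first by apply: sumr_ge0 => i _; rewrite mulr_ge0 ?expR_ge0.
  have -> : tau - j.+1%:R <= W.
    by rewrite lerBlDr addrC -lerBlDr; apply: le_trans (ltW rj); rewrite le_max lexx orbT.
  rewrite mulr1 ler_expR.
  have -> : Num.min 0 (W - tau) = - r.
    by rewrite /r; case: (leP 0 (W - tau)) => h1; case: (leP 0 (tau - W)) => h2; lra.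
  by rewrite lerN2.
have e2 : expR (- (1 / 2)) <= 2 / 3 :> R.
  rewrite expRN; have := expR_ge1Dx (1 / 2 : R) => h.
  by rewrite -div1r ler_pdivrMr ?expR_gt0 //; lra.
apply: (@le_trans _ _ (\sum_(0 <= j < J) expR 1 * G tau * (2 / 3) ^+ j)).
  apply: ler_sum => j _.
  apply: le_trans (ler_wpM2l (expR_ge0 _) (reg (ler0n R j.+1))) _.
  rewrite mulrA -expRD mulrAC ler_wpM2r //.
  apply: (@le_trans _ _ (expR 1 * expR (- (1 / 2)) ^+ j)).
    rewrite -expRM_natl -expRD ler_expR.
    have : c * (j.+1%:R + 1) <= 1 / 2 * (j.+1%:R + 1).
      by rewrite ler_wpM2r // addr_ge0.
    by rewrite -natr1; lra.
  rewrite ler_wpM2l ?expR_ge0 //; apply: lerXn2r; rewrite ?nnegrE ?expR_ge0 //; lra.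
rewrite -mulr_sumr.
have h : \sum_(0 <= j < J) (2 / 3 : R) ^+ j <= 3.
  have e : \sum_(0 <= j < J) (2 / 3 : R) ^+ j = 3 - 3 * (2 / 3) ^+ J.
    elim: (J) => [|n IHn]; first by rewrite big_geq // expr0; lra.
    by rewrite big_nat_recr //= IHn exprS; lra.
  by rewrite e lerBlDr lerDl mulr_ge0 // exprn_ge0 //; lra.
have := ler_wpM2l (mulr_ge0 (expR_ge0 1) (G_ge0 tau)) h; lra.
Qed.

Lemma soft_sum_upper :
  \sum_(1 <= m < N.+1) soft (f m) * 1 / m%:R <= V * (X * (3 * expR 1 * G tau)).
Proof.
apply: le_trans (harm_additive_upper soft_mono (fun x => expR_ge0 _)) _.
apply: ler_wpM2l; first exact: ltW.
have hX := @rough_exp_le_X 1 ltac:(apply/andP; split; lra).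
have E0 : 0 <= expect (primes_le y) (fun S => soft (wt f S)).
  by apply: expect_ge0 => S; exact: expR_ge0.
apply: (@le_trans _ _ (X * expect (primes_le y) (fun S => soft (wt f S)))); last first.
  apply: ler_wpM2l; last exact: expect_soft_le.
  by apply: le_trans X_def; exact: expR_ge0.
apply: le_trans (ler_wpM2r E0 hX); rewrite mulr_suml big_seq_cond [leRHS]big_seq_cond.
apply: ler_sum => b; rewrite mem_index_iota ltnS => /andP[/andP[b0 bN] _].
have fb0 := f_nat_ge0 f_add f_prime_power f_gt0 b0.
have -> : expR (1 * f b) / b%:R * expect (primes_le y) (fun S => soft (wt f S)) =
  1 / b%:R * (expR (f b) * expect (primes_le y) (fun S => soft (wt f S))).
  by rewrite mul1r; ring.
apply: ler_wpM2l; first by rewrite divr_ge0.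
by rewrite -expectZ; apply: expect_mono => S; exact: soft_shift.
Qed.

(** Write [n = k * m] with [tau <= f n].  Either [tau - v <= f m], or
    [f k > v] and then [expR (- v) * soft (f m) * expR (2 * f k) >= 1]. *)
Lemma lnsqr_count_upper v : 0 <= v ->
  lnsqr_count N tau <= N%:R * (2 * lnratio_count N (tau - v) + (KS + 4) * harm_count N (tau - v)) +
    N%:R * (expR (- v) * K_vm2 * (1 + ln N%:R) * (V * (X * (3 * expR 1 * G tau)))).
Proof.
move=> v0.
have [_ h] := @sum_weighted_quot (fun m => (tau - v <= f m)%R%:R) (fun _ _ => ler0n _ _).
have KM0 : 0 <= K_vm2.
  by rewrite addr_ge0 ?sqr_ge0 // mulr_ge0 //; have := K4_ge1; lra.
have h2 : \sum_(1 <= m < N.+1) \sum_(1 <= k < (N %/ m).+1)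
     expR (- v) * soft (f m) * (vm2 R k * expR (2 * f k)) <=
   N%:R * (expR (- v) * K_vm2 * (1 + ln N%:R) * (V * (X * (3 * expR 1 * G tau)))).
  have -> : N%:R * (expR (- v) * K_vm2 * (1 + ln N%:R) * (V * (X * (3 * expR 1 * G tau)))) =
    (N%:R * (expR (- v) * K_vm2 * (1 + ln N%:R))) * (V * (X * (3 * expR 1 * G tau))) by ring.
  have q0 : 0 <= N%:R * (expR (- v) * K_vm2 * (1 + ln N%:R)).
    by rewrite !mulr_ge0 ?expR_ge0 // addr_ge0.
  apply: le_trans (ler_wpM2l q0 soft_sum_upper).
  rewrite mulr_sumr big_seq [leRHS]big_seq; apply: ler_sum => m.
  rewrite mem_index_iota ltnS => /andP[m0 mN].
  have n0 : (0 < N %/ m)%N by rewrite divn_gt0.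
  rewrite -mulr_sumr.
  have s0 : 0 <= expR (- v) * soft (f m) by rewrite mulr_ge0 ?expR_ge0.
  apply: le_trans (ler_wpM2l s0 (vm2_exp_moment n0)) _.
  have -> : N%:R * (expR (- v) * K_vm2 * (1 + ln N%:R)) * (soft (f m) * 1 / m%:R) =
    expR (- v) * soft (f m) * (K_vm2 * (N%:R / m%:R * (1 + ln N%:R))) by ring.
  apply: ler_wpM2l => //; apply: ler_wpM2l => //; apply: ler_pM => //.
  - by rewrite addr_ge0 // ln_ge0 // ler1n.
  - by rewrite ler_pdivlMr ?ltr0n // -natrM ler_nat leq_trunc_div.
  - by rewrite lerD2l ler_ln ?posrE ?ltr0n // ler_nat leq_div.
apply: le_trans (lerD h h2); rewrite lnsqr_count_hyper -big_split /= big_seq [leRHS]big_seq.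
apply: ler_sum => m; rewrite mem_index_iota => /andP[m0 _].
rewrite mulr_sumr -big_split /= big_seq [leRHS]big_seq; apply: ler_sum => k.
rewrite mem_index_iota => /andP[k0 _].
have w0 := vm2_ge0 R k.
have -> : (tau - v <= f m)%R%:R * vm2 R k + expR (- v) * soft (f m) * (vm2 R k * expR (2 * f k)) =
  vm2 R k * ((tau - v <= f m)%R%:R + expR (- v) * soft (f m) * expR (2 * f k)) by ring.
apply: ler_wpM2l => //.
have fk0 := f_nat_ge0 f_add f_prime_power f_gt0 k0.
have fkm : f (k * m)%N <= f k + f m := f_mul_le f_add f_prime_power f_gt0 k0 m0.
have s0 : 0 <= expR (- v) * soft (f m) * expR (2 * f k) by rewrite !mulr_ge0 ?expR_ge0.
case: (leP tau (f (k * m)%N)) => t1; last by rewrite addr_ge0.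
case: (leP (tau - v) (f m)) => t2; first by rewrite lerDl.
rewrite add0r -!expRD; apply: (@le_trans _ _ (expR 0)); first by rewrite expR0.
rewrite ler_expR.
by case: (leP 0 (f m - tau)) => h1; lra.
Qed.

Lemma nat_count_ge : 0 < ln N%:R :> R -> lnsqr_count N tau <= ln N%:R ^+ 2 * nat_count N tau.
Proof.
move=> lN; rewrite /lnsqr_count /nat_count mulr_sumr big_seq [leRHS]big_seq; apply: ler_sum => n.
rewrite mem_index_iota ltnS => /andP[n0 nN]; rewrite mulrC ler_wpM2r //.
apply: lerXn2r; rewrite ?nnegrE ?ln_ge0 ?ler1n // ler_ln ?posrE ?ltr0n ?ler_nat //.
Qed.

(** At most [N * expR (- (theta * ln N))] integers are below [N^(1 - theta)], and
    for the others [ln n] is at least [(1 - theta) * ln N]. *)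
Lemma nat_count_le (theta : R) : 0 < theta < 1 -> 0 < ln N%:R :> R ->
  (1 - theta) ^+ 2 * ln N%:R ^+ 2 * (nat_count N tau - N%:R * expR (- (theta * ln N%:R))) <=
  lnsqr_count N tau.
Proof.
move=> /andP[t0 t1] lN; set u := (1 - theta) * ln N%:R.
have u0 : 0 < u by rewrite mulr_gt0 // subr_gt0.
rewrite -exprMn -/u.
have e : N%:R * expR (- (theta * ln N%:R)) = expR u.
  rewrite -{1}[N%:R](@lnK R) ?posrE ?ltr0n // -expRD; congr expR; rewrite /u; ring.
rewrite e.
have cnt : \sum_(1 <= n < N.+1) (ln n%:R < u)%R%:R <= expR u :> R.
  pose j := Num.truncn (expR u).
  have jx : j%:R <= expR u by rewrite truncn_le expR_ge0.
  apply: le_trans jx.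
  apply: (@le_trans _ _ (\sum_(1 <= n < N.+1) (n <= j)%N%:R)).
    rewrite big_seq [leRHS]big_seq; apply: ler_sum => n.
    rewrite mem_index_iota => /andP[n0 _]; rewrite ler_nat.
    case: (ltP (ln n%:R) u) => //= h.
    have : n%:R < expR u by rewrite -[n%:R](@lnK R) ?posrE ?ltr0n // ltr_expR.
    move=> /ltW; rewrite -truncn_ge_nat ?expR_ge0 // => ->.
    by [].
  rewrite -natr_sum ler_nat.
  have -> : (\sum_(1 <= n < N.+1) (n <= j) = count (fun n => n <= j) (index_iota 1 N.+1))%N.
    by rewrite -sum1_count [RHS]big_mkcond; apply: eq_bigr => n _ /=; case: (_ <= _)%N.
  rewrite -size_filter -[leqRHS](size_iota 1); apply: uniq_leq_size.
    by rewrite filter_uniq // iota_uniq.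
  move=> n; rewrite mem_filter mem_index_iota mem_iota add1n ltnS.
  by case/and3P => nj -> _; rewrite ltnS.
have h : u ^+ 2 * (nat_count N tau - \sum_(1 <= n < N.+1) (ln n%:R < u)%R%:R) <= lnsqr_count N tau.
  rewrite /nat_count -sumrB mulr_sumr /lnsqr_count big_seq [leRHS]big_seq; apply: ler_sum => n.
  rewrite mem_index_iota => /andP[n0 _].
  case: (ltP (ln n%:R) u) => h.
    apply: (@le_trans _ _ 0); last by rewrite mulr_ge0 // sqr_ge0.
    rewrite mulr_ge0_le0 ?sqr_ge0 // subr_le0 lern1 leq_b1 //.
  rewrite subr0 mulrC ler_wpM2l //; apply: lerXn2r; rewrite ?nnegrE //; first exact: ltW.
  by rewrite ln_ge0 // ler1n.
apply: le_trans h; apply: ler_wpM2l; first exact: sqr_ge0.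
by rewrite lerD2l lerN2.
Qed.

End FixedScale.

Lemma tail_nonpos l (t : R) : all prime l -> t <= 0 -> tail f l t = 1.
Proof.
move=> pl t0; rewrite -(expect_cst l 1); apply/eqP; rewrite eq_le.
apply/andP; split; apply: (@expect_le _ prime) => // S pS.
  by rewrite lern1 leq_b1.
suff -> : t <= wt f S by [].
apply: le_trans t0 _; rewrite /wt big_seq; apply: sumr_ge0 => p /(allP pS) /f_gt0/ltW //.
Qed.

Lemma square_loss_le (eta : R) : 0 < eta -> eta <= 1 / 100 ->
  (1 + 3 * eta) * (1 + 5 * eta) <= (1 - eta) ^+ 2 * (1 + 14 * eta).
Proof.
move=> eta0 eta1.
have : 0 <= eta * (1 / 100 - eta) by rewrite mulr_ge0 //; lra.
have : 0 <= eta * eta * eta by rewrite !mulr_ge0 // ltW.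
by rewrite expr2; lra.
Qed.

(** Comparing the two bounds of [lnratio_count] with its exact value for the
    threshold 0, where all tails are 1, determines the factor
    [theta]. *)
Lemma euler_rough_ln_bounds (y N : nat) (c X D eta : R) :
  let theta := euler_factor R (primes_le y) * rough_ln R y N in
  let l := ln N%:R in
  (1 < y)%N -> (y <= N)%N -> 0 < c -> c <= 1 / 2 ->
  \sum_(p <- primes_between y N) (1 + expR (2 * f p)) / p%:R <= D ->
  expR D <= X -> 0 < eta -> eta <= 1 / 100 -> c * (1 + X) <= eta ->
  8 <= l -> 2 <= eta * l ->
  N%:R^-1 + 4 * K_lnwt * (ln y%:R + 4) / l <= eta ->
  1 / 2 * l ^+ 2 * (1 - 2 * eta) <= theta <= 1 / 2 * l ^+ 2 * (1 + 3 * eta).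
Proof.
move=> theta l y1 yN c0 c12 hD hX eta0 eta1 hcX l8 hl hdel.
have N0 : (0 < N)%N by apply: leq_trans yN; exact: ltnW.
have V0 : 0 < euler_factor R (primes_le y) by exact/euler_factor_gt0/all_prime_primes_le.
have lC : l <= rough_ln R y N by exact: rough_ln_ge_ln.
have th0 : 0 <= theta by rewrite mulr_ge0 ?(ltW V0) //; lra.
have reg0 u : 0 <= u -> tail f (primes_le y) (0 - u) <=
    expR (c * (u + 1)) * tail f (primes_le y) 0.
  move=> u0; rewrite !tail_nonpos ?all_prime_primes_le //; last by lra.
  rewrite mulr1; apply: (@le_trans _ _ (expR 0)); first by rewrite expR0.
  by rewrite ler_expR mulr_ge0 ?(ltW c0) // addr_ge0.
have [t1 t2] := sum_ln_ratio_bounds R N0; rewrite -/l in t1 t2.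
have T0E : lnratio_count N 0 = \sum_(1 <= m < N.+1) (l - ln m%:R) / m%:R.
  rewrite /lnratio_count big_seq [RHS]big_seq; apply: eq_bigr => m.
  rewrite mem_index_iota => /andP[m0 _].
  by rewrite (f_nat_ge0 f_add f_prime_power f_gt0 m0) mul1r.
have tail0 : tail f (primes_le y) 0 = 1 by rewrite tail_nonpos // all_prime_primes_le.
have up := @lnratio_count_upper y N c 0 X D y1 yN c0 c12 reg0 hD hX 0 (lexx _).
rewrite subr0 T0E mulr0 expR0 tail0 !mulr1 -/theta in up.
have low := @lnratio_count_lower y N c 0 y1 yN c12 reg0 l8.
rewrite T0E tail0 mulr1 -/theta -/l in low.
have rho : expR c * (1 + c * X) <= expR eta.
  apply: (@le_trans _ _ (expR (c * (1 + X)))); last by rewrite ler_expR.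
  have -> : c * (1 + X) = c + c * X by ring.
  by rewrite expRD ler_wpM2l ?expR_ge0 // expR_ge1Dx.
have q0 : 0 <= 1 / 2 * l ^+ 2 by rewrite mulr_ge0 ?sqr_ge0 // divr_ge0.
have h1 : 1 / 2 * l ^+ 2 <= theta * expR eta.
  by apply: le_trans t1 _; apply: le_trans up _; rewrite ler_wpM2l.
have h2 : theta * (1 - eta) <= 1 / 2 * l ^+ 2 + l.
  by apply: le_trans t2; apply: le_trans low; rewrite ler_wpM2l //; lra.
have e1 := expR_onem_le1 eta.
apply/andP; split.
  have p0 : 0 <= 1 - 2 * eta by lra.
  apply: le_trans (ler_wpM2r p0 h1) _.
  rewrite -mulrA -[leRHS]mulr1 ler_wpM2l //; apply: le_trans e1.
  by rewrite ler_wpM2l ?expR_ge0 //; lra.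
have p0 : 0 < 1 - eta by lra.
rewrite -(ler_pM2r p0); apply: le_trans h2 _.
apply: (@le_trans _ _ (1 / 2 * l ^+ 2 * (1 + eta))).
  have := ler_wpM2r (le_trans (ler0n R 8) l8) hl; rewrite expr2; lra.
rewrite -[leRHS]mulrA ler_wpM2l //.
by have := ler_wpM2l (ltW eta0) eta1; lra.
Qed.

Lemma expR_le_1D3 (eta x : R) : 0 < eta -> eta <= 1 / 100 -> x <= 2 * eta ->
  expR x <= 1 + 3 * eta.
Proof.
move=> eta0 eta1 x2; have h3 : expR x * (1 - 2 * eta) <= 1.
  by apply: le_trans (expR_onem_le1 x); rewrite ler_wpM2l ?expR_ge0 //; lra.
have h4 : 1 <= (1 + 3 * eta) * (1 - 2 * eta) by nra.
have p0 : 0 < 1 - 2 * eta by lra.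
by rewrite -(ler_pM2r p0); apply: le_trans h3 h4.
Qed.

Lemma count_lower_assembly (l n G Th T H Q S eta : R) :
  0 < l -> 0 <= n -> 0 <= G -> 0 < eta -> eta <= 1 / 100 ->
  1 / 2 * l ^+ 2 * (1 - 2 * eta) <= Th -> Th * G * (1 - eta) <= T ->
  H <= 2 * eta * (Th * G) -> n * (2 * T - H) <= Q -> Q <= l ^+ 2 * S ->
  n * ((1 - 4 * eta) * G) <= S.
Proof.
move=> l0 n0 G0 eta0 eta1 hTh hT hH hQ hS.
have l20 : 0 < l ^+ 2 by rewrite exprn_gt0.
rewrite -(ler_pM2l l20); apply: le_trans (le_trans hQ hS).
apply: (@le_trans _ _ (n * (Th * G * (2 - 4 * eta)))); last by rewrite ler_wpM2l //; lra.
rewrite mulrCA ler_wpM2l //.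
have p0 : 0 <= G * (2 - 4 * eta) by rewrite mulr_ge0 //; lra.
rewrite -[leRHS]mulrA; apply: le_trans (ler_wpM2r p0 hTh).
have : 0 <= l ^+ 2 * G * eta ^+ 2 by rewrite mulr_ge0 ?sqr_ge0 // mulr_ge0 // ltW.
lra.
Qed.

Lemma count_upper_assembly (l n G Th T H E Q S s eta : R) :
  0 < l -> 0 <= n -> 0 <= G -> 0 < eta -> eta <= 1 / 100 ->
  Th <= 1 / 2 * l ^+ 2 * (1 + 3 * eta) -> T <= Th * G * (1 + 3 * eta) ->
  H <= 2 * eta * (Th * G) -> E <= 2 * eta * (Th * G) ->
  Q <= n * (2 * T + H) + n * E ->
  (1 - eta) ^+ 2 * l ^+ 2 * (S - n * s) <= Q -> s <= eta * G ->
  S <= (1 + 15 * eta) * G * n.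
Proof.
move=> l0 n0 G0 eta0 eta1 hTh hT hH hE hQ hS hs.
have l20 : 0 < l ^+ 2 by rewrite exprn_gt0.
have p2 : 0 < (1 - eta) ^+ 2 by rewrite exprn_gt0 // subr_gt0 (le_lt_trans eta1) //; lra.
have nG : 0 <= n * G by rewrite mulr_ge0.
have hQ2 : Q <= n * G * l ^+ 2 * ((1 + 3 * eta) * (1 + 5 * eta)).
  apply: (@le_trans _ _ (n * (Th * G * (2 + 10 * eta)))).
    by apply: le_trans hQ _; rewrite -mulrDr ler_wpM2l //; lra.
  have p0 : 0 <= G * (2 + 10 * eta) by rewrite mulr_ge0 //; lra.
  have := ler_wpM2l n0 (ler_wpM2r p0 hTh); lra.
have hS2 : S - n * s <= n * G * (1 + 14 * eta).
  have p3 : 0 < (1 - eta) ^+ 2 * l ^+ 2 by rewrite mulr_gt0.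
  rewrite -(ler_pM2l p3); apply: le_trans hS _; apply: le_trans hQ2 _.
  have p4 : 0 <= n * G * l ^+ 2 by rewrite mulr_ge0 // ltW.
  have := ler_wpM2l p4 (square_loss_le eta0 eta1); lra.
have := ler_wpM2l n0 hs; lra.
Qed.

(** All error terms of one scale, made at most [eta]: [c] small makes the
    shifts by [v] and by the rough part harmless, [v] large disposes of the
    factors [k] with [f k] large, and [ln N] large absorbs the error
    term of Selberg's formula. *)
Lemma nat_count_near_tail (y N : nat) (c tau X D KS eta v : R) :
  let G := tail f (primes_le y) tau in
  (1 < y)%N -> (y <= N)%N -> 0 < c -> c <= 1 / 2 ->
  (forall u, 0 <= u -> tail f (primes_le y) (tau - u) <= expR (c * (u + 1)) * G) ->
  \sum_(p <- primes_between y N) (1 + expR (2 * f p)) / p%:R <= D ->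
  expR D <= X -> 0 <= KS ->
  (forall n, (0 < n)%N ->
    `|\sum_(1 <= k < n.+1) vm2 R k - 2 * (n%:R * ln n%:R)| <= KS * n%:R) ->
  0 < eta -> eta <= 1 / 100 -> 0 <= v -> 8 <= ln N%:R :> R ->
  N%:R^-1 + 4 * K_lnwt * (ln y%:R + 4) / ln N%:R <= eta ->
  c * (1 + X) <= eta -> c * v <= eta ->
  (KS + 4) * (expR 1 * X) <= eta * ln N%:R ->
  expR (- v) * K_vm2 * (X * (3 * expR 1)) <= eta ->
  2 <= eta * ln N%:R ->
  expR (- (eta * ln N%:R)) <= eta * G ->
  (1 - 4 * eta) * G <= nat_count N tau / N%:R /\
  nat_count N tau / N%:R <= (1 + 15 * eta) * G.
Proof.
move=> G y1 yN c0 c12 reg hD hX KS0 sel eta0 eta1 v0 l8 hdel hcX hcv hKS hv hl hG.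
have G0 : 0 <= G := tail_ge0 _ _ _.
have N0 : (0 < N)%N by apply: leq_trans yN; exact: ltnW.
have N0R : 0 < N%:R :> R by rewrite ltr0n.
have /andP[Thlow Thup] := @euler_rough_ln_bounds y N c X D eta y1 yN c0 c12 hD hX
  eta0 eta1 hcX l8 hl hdel.
have Tlow := @lnratio_count_lower y N c tau y1 yN c12 reg l8.
have Tup := @lnratio_count_upper y N c tau X D y1 yN c0 c12 reg hD hX v v0.
have Hup u : 0 <= u -> harm_count N (tau - u) <= _ := @harm_count_upper y N c tau X D c12 reg hD hX u.
have Qlow := @lnsqr_count_lower y N tau KS y1 yN KS0 sel.
have Qup := @lnsqr_count_upper y N c tau X D KS y1 yN c12 reg hD hX KS0 sel v v0.
have l0 : 0 < ln N%:R :> R by lra.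
have Slow := @nat_count_ge y N tau y1 yN l0.
have eta01 : 0 < eta < 1 by rewrite eta0; lra.
have Sup := @nat_count_le y N tau y1 yN eta eta01 l0.
have V0 : 0 < euler_factor R (primes_le y) by exact/euler_factor_gt0/all_prime_primes_le.
have lC : ln N%:R <= rough_ln R y N by exact: rough_ln_ge_ln.
have X0 : 0 < X by apply: lt_le_trans hX; exact: expR_gt0.
have KM0 : 0 <= K_vm2 by rewrite addr_ge0 ?sqr_ge0 // mulr_ge0 //; have := K4_ge1; lra.
move: Thlow Thup Tlow Tup Hup Qlow Qup Slow Sup V0 lC; rewrite -/G.
set l := ln N%:R in l8 hdel hKS hl hG l0 *.
set V := euler_factor R _; set C := rough_ln R y N; set Th := V * C.
move=> Thlow Thup Tlow Tup Hup Qlow Qup Slow Sup V0 lC.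
have Th0 : 0 <= Th by rewrite mulr_ge0 ?(ltW V0) // (le_trans (ltW l0)).
have ThG : 0 <= Th * G by rewrite mulr_ge0.
have VG : 0 <= V * G by rewrite mulr_ge0 // ltW.
have VlG : V * l * G <= Th * G by rewrite ler_wpM2r // ler_wpM2l // ltW.
have expb (x : R) : x <= 2 * eta -> expR x <= 1 + 3 * eta := expR_le_1D3 eta0 eta1.
have K0 : 0 <= KS + 4 by lra.
have {}Hup u : 0 <= u -> c * u <= eta -> (KS + 4) * harm_count N (tau - u) <= 2 * eta * (Th * G).
  move=> u0 cu; have {}cu : expR (c * u) <= 2.
    by apply: le_trans (expb _ _) _; lra.
  apply: le_trans (ler_wpM2l K0 (Hup u u0)) _.
  have -> : (KS + 4) * (V * G * expR (c * u) * (expR 1 * X)) =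
    V * G * expR (c * u) * ((KS + 4) * (expR 1 * X)) by ring.
  have q0 : 0 <= V * G * expR (c * u) by rewrite mulr_ge0 ?expR_ge0.
  apply: le_trans (ler_wpM2l q0 hKS) _.
  have -> : V * G * expR (c * u) * (eta * l) = eta * (V * l * G * expR (c * u)) by ring.
  have -> : 2 * eta * (Th * G) = eta * (Th * G * 2) by ring.
  rewrite ler_wpM2l ?(ltW eta0) //; apply: ler_pM => //; rewrite ?expR_ge0 //.
  by rewrite !mulr_ge0 // ltW.
split.
  rewrite ler_pdivlMr // mulrC.
  have h0 := Hup 0 (lexx _); rewrite mulr0 subr0 in h0.
  apply: (count_lower_assembly l0 (ltW N0R) G0 eta0 eta1 Thlow _ (h0 (ltW eta0)) Qlow Slow).
  by apply: le_trans Tlow; rewrite ler_wpM2l //; lra.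
rewrite ler_pdivrMr //.
apply: (count_upper_assembly l0 (ltW N0R) G0 eta0 eta1 Thup _ (Hup v v0 hcv) _ Qup Sup hG).
  apply: le_trans Tup _; rewrite -mulrA ler_wpM2l //.
  apply: (@le_trans _ _ (expR (c * v + c * (1 + X)))); last first.
    by apply: expb; lra.
  have -> : c * v + c * (1 + X) = c * v + (c + c * X) by ring.
  rewrite !expRD ler_wpM2l ?expR_ge0 //.
  by rewrite ler_wpM2l ?expR_ge0 // expR_ge1Dx.
have -> : expR (- v) * K_vm2 * (1 + l) * (V * (X * (3 * expR 1 * G))) =
  expR (- v) * K_vm2 * (X * (3 * expR 1)) * (V * (1 + l) * G) by ring.
have -> : 2 * eta * (Th * G) = eta * (2 * (Th * G)) by ring.
apply: ler_pM => //.
- by rewrite !mulr_ge0 ?expR_ge0 // ltW.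
- by apply: (mulr_ge0 _ G0); apply: (mulr_ge0 (ltW V0)); exact: addr_ge0 (ltW l0).
have l1 : V * (1 + l) * G <= V * (2 * l) * G.
  by rewrite ler_wpM2r // ler_wpM2l ?(ltW V0) //; lra.
by apply: le_trans l1 _; lra.
Qed.

(** The primes above [y] shift the threshold by a quantity of bounded exponential
    moment. *)
Lemma tail_cat_le (y N : nat) (tau c D : R) : (y <= N)%N -> 0 <= c -> c <= 1 ->
  (forall u, 0 <= u -> tail f (primes_le y) (tau - u) <=
     expR (c * (u + 1)) * tail f (primes_le y) tau) ->
  \sum_(p <- primes_between y N) (1 + expR (2 * f p)) / p%:R <= D ->
  tail f (primes_le N) tau <= expR (c * (1 + D)) * tail f (primes_le y) tau.
Proof.
move=> yN c0 c1 reg hD; set G := tail f (primes_le y) tau.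
have G0 : 0 <= G := tail_ge0 _ _ _.
have pl : all prime (primes_between y N) := all_prime_between y N.
rewrite (primes_le_cat yN) -/(primes_between y N) /tail expect_cat expect_swap.
apply: (@le_trans _ _ (expR c * G *
   expect (primes_between y N) (fun S => expR (c * wt f S)))).
  rewrite -expectZ; apply: (@expect_le _ prime) => // S pS.
  have W0 : 0 <= wt f S.
    by rewrite /wt big_seq; apply: sumr_ge0 => p /(allP pS) /f_gt0/ltW.
  have -> : expR c * G * expR (c * wt f S) = expR (c * (wt f S + 1)) * G.
    by rewrite mulrDr mulr1 expRD; ring.
  apply: le_trans (reg _ W0); rewrite le_eqVlt; apply/orP; left; apply/eqP.
  by apply: eq_expect => S1; rewrite wt_cat lerBlDr.
have -> : expR (c * (1 + D)) = expR c * expR (c * D) by rewrite -expRD; congr expR; ring.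
rewrite mulrAC ler_wpM2r // ler_wpM2l ?expR_ge0 //.
apply: le_trans (expect_expR_between_le f_gt0 pl c0) _.
rewrite ler_expR; apply: le_trans (ler_wpM2l c0 hD).
rewrite mulr_sumr big_seq [leRHS]big_seq; apply: ler_sum => p.
move=> /(allP pl) pp; have fp := f_gt0 pp.
rewrite mulrA ler_wpM2r ?invr_ge0 //.
apply: le_trans (expR_sub1_le _) _; rewrite -mulrA; apply: ler_wpM2l => //.
apply: (@le_trans _ _ (expR (f p) * expR (f p))).
  apply: ler_pM; rewrite ?expR_ge0 ?le_expR ?(ltW fp) //.
  by rewrite ler_expR -[leRHS]mul1r ler_wpM2r // ltW.
have e2 : f p + f p = 2 * f p by ring.
by rewrite -expRD e2 lerDr.
Qed.

Lemma between_moment_le (y N w : nat) : (1 < y)%N -> (y <= N)%N ->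
  ln N%:R <= 2 * w%:R * ln y%:R :> R ->
  \sum_(p <- primes_between y N) expR (4 * f p) / p%:R <= K4 * (2 * w%:R + 9).
Proof.
move=> y1 yN hw; have y0 : (0 < y)%N by exact: ltnW.
have yR : 0 < y%:R :> R by rewrite ltr0n.
have ly : 1 / 2 <= ln y%:R :> R.
  apply: (@le_trans _ _ (ln 2%:R)).
    by have := @ln_succ_ge R 1 isT; rewrite ln1 subr0; lra.
  by rewrite ler_ln ?posrE ?ltr0n // ler_nat.
(* The weights [1/p] for [p > y], extended by a constant to be decreasing. *)
pose a n : R := (maxn y n)%:R^-1.
have a_decr n : (0 < n < N)%N -> a n.+1 <= a n.
  move=> /andP[n0 _]; rewrite /a lef_pV2 ?posrE ?ltr0n ?leq_max ?y0 //.
  by rewrite ler_nat geq_max leq_maxl leq_max leqnSn orbT.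
have a_ge0 n : (0 < n <= N)%N -> 0 <= a n by rewrite /a invr_ge0.
have h := @exp_moment_weighted R f K4 f_exp_moment a N a_decr a_ge0.
have e1 : \sum_(p <- primes_between y N) expR (4 * f p) / p%:R <=
    \sum_(p <- primes_le N) expR (4 * f p) * a p.
  rewrite (primes_le_cat yN) big_cat /= -/(primes_between y N) ler_wpDl //.
    by apply: sumr_ge0 => p _; rewrite mulr_ge0 ?expR_ge0 // invr_ge0.
  rewrite big_seq [leRHS]big_seq; apply: ler_sum => p.
  by rewrite mem_primes_between => /and3P[_ yp _]; rewrite /a (maxn_idPr (ltnW yp)).
apply: le_trans e1 _; apply: le_trans h _; apply: ler_wpM2l.
  by have := K4_ge1; lra.
rewrite (primes_le_cat yN) big_cat /= -/(primes_between y N).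
have -> : 2 * w%:R + 9 = 1 + (2 * w%:R + 8) :> R by ring.
apply: lerD.
  apply: (@le_trans _ _ (\sum_(p <- primes_le y) y%:R^-1)).
    rewrite big_seq [leRHS]big_seq; apply: ler_sum => p.
    by rewrite mem_primes_le => /andP[_ py]; rewrite /a (maxn_idPl py).
  rewrite big_const_seq count_predT iter_addr_0 -[_ *+ _]mulr_natr.
  rewrite mulrC ler_pdivrMr // mul1r ler_nat size_filter.
  by apply: leq_trans (count_size _ _) _; rewrite size_iota subn1.
apply: (@le_trans _ _ ((ln N%:R + 4) / ln y%:R)).
  apply: le_trans (sum_inv_between_le R (y := y) (N := N) _); last by rewrite y1.
  rewrite big_seq [leRHS]big_seq; apply: ler_sum => p.
  by rewrite mem_primes_between => /and3P[_ yp _]; rewrite /a (maxn_idPr (ltnW yp)).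
by rewrite ler_pdivrMr; lra.
Qed.

Lemma between_total_le (y N w : nat) : (1 < y)%N -> (y <= N)%N ->
  ln N%:R <= 2 * w%:R * ln y%:R :> R ->
  \sum_(p <- primes_between y N) (1 + expR (2 * f p)) / p%:R <=
  2 * (K4 * (2 * w%:R + 9)).
Proof.
move=> y1 yN hw.
apply: le_trans (ler_wpM2l (ler0n R 2) (between_moment_le y1 yN hw)).
rewrite mulr_sumr big_seq [leRHS]big_seq; apply: ler_sum => p.
rewrite mem_primes_between => /andP[/f_gt0 fp _].
rewrite mulrA ler_wpM2r ?invr_ge0 //.
have : expR (2 * f p) <= expR (4 * f p) by rewrite ler_expR; lra.
have := expR_ge1Dx (4 * f p); lra.
Qed.

(** The largest [y] with [y ^ w <= N]. *)
Lemma exists_root_scale (w N m : nat) : (0 < w)%N -> (m ^ w <= N)%N ->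
  exists y, [/\ (m <= y)%N, (y ^ w <= N)%N & (N < y.+1 ^ w)%N].
Proof.
move=> w0 mN; have exP : exists k, (k ^ w <= N)%N by exists m.
have ub k : (k ^ w <= N)%N -> (k <= N)%N.
  move=> kN; case: (posnP k) => [->//|k0]; apply: leq_trans kN.
  by rewrite -{1}(expn1 k) leq_pexp2l.
case: (ex_maxnP exP ub) => y yN ymax; exists y; split=> //; first exact: ymax.
by rewrite ltnNge; apply/negP => /ymax; rewrite ltnn.
Qed.

Lemma scale_ln (w N y : nat) : (1 < y)%N -> (y ^ w <= N)%N -> (N < y.+1 ^ w)%N ->
  w%:R * ln y%:R <= ln N%:R :> R /\ ln N%:R <= 2 * w%:R * ln y%:R :> R.
Proof.
move=> y1 yN Ny; have y0 : (0 < y)%N by exact: ltnW.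
have yw0 : (0 < y ^ w)%N by rewrite expn_gt0 y0.
have N0 : (0 < N)%N by exact: leq_trans yN.
have y0R : 0 < y%:R :> R by rewrite ltr0n.
split.
  rewrite mulr_natl -lnXn // -natrX ler_ln ?posrE ?ltr0n //.
  by rewrite ler_nat.
have -> : 2 * w%:R * ln y%:R = w%:R * ln (y * y)%:R :> R.
  by rewrite natrM lnM ?posrE //; ring.
have yy0 : (0 < y * y)%N by rewrite muln_gt0 y0.
rewrite mulr_natl -lnXn ?ltr0n // -natrX ler_ln ?posrE ?ltr0n ?expn_gt0 ?yy0 //.
rewrite ler_nat; apply: leq_trans (ltnW Ny) _.
have h : (y.+1 <= y * y)%N.
  apply: leq_trans (_ : 2 * y <= _)%N; last by rewrite leq_mul2r y1 orbT.
  by rewrite mul2n -addnn -addn1 leq_add2l.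
by case: (posnP w) => [->|w0]; rewrite ?expn0 // leq_exp2r.
Qed.

Lemma mean_le_between (y N : nat) (D : R) : (y <= N)%N ->
  \sum_(p <- primes_between y N) (1 + expR (2 * f p)) / p%:R <= D ->
  mean_le f N <= mean_le f y + D.
Proof.
move=> yN hD; rewrite /mean_le /mean (primes_le_cat yN) big_cat /= lerD2l.
rewrite -/(primes_between y N); apply: le_trans hD.
rewrite big_seq [leRHS]big_seq; apply: ler_sum => p.
rewrite mem_primes_between => /andP[/f_gt0 fp _].
by rewrite ler_wpM2r ?invr_ge0 //; have := le_expR (2 * f p); lra.
Qed.

Lemma lsum_between (y N : nat) (D : R) : (y <= N)%N ->
  \sum_(p <- primes_between y N) (1 + expR (2 * f p)) / p%:R <= D ->
  lsum R N <= lsum R y + D.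
Proof.
move=> yN hD; rewrite /lsum (primes_le_cat yN) big_cat /= lerD2l.
rewrite -/(primes_between y N); apply: le_trans hD; apply: ler_sum => p _.
by rewrite -[leLHS]mul1r ler_wpM2r ?invr_ge0 // lerDl expR_ge0.
Qed.

Lemma lsum_le_ln (y : nat) (l : R) : (0 < y)%N -> ln y%:R <= l -> lsum R y <= 1 + l.
Proof.
move=> y0 yl; apply: (@le_trans _ _ (harm R y)).
  rewrite /lsum big_primes_le; apply: ler_sum => p _.
  by case: (prime p); rewrite ?mul1r // mul0r invr_ge0.
by apply: le_trans (harm_le R y0) _; rewrite lerD2l.
Qed.

Lemma smooth_error_le (K eta n l ly w : R) : 0 < eta -> 0 < l -> 0 < n -> 0 <= ly ->
  l <= n -> 4 <= eta * l -> 64 * K <= eta * l -> 16 * K <= eta * w -> w * ly <= l ->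
  n^-1 + 4 * K * (ly + 4) / l <= eta.
Proof.
move=> eta0 l0 n0 ly0 ln l2 l1 hw lyw.
have d1 : n^-1 <= eta / 4.
  by rewrite -div1r ler_pdivrMr //; have := ler_wpM2l (ltW eta0) ln; lra.
have d2 : 4 * K * (ly + 4) / l <= eta / 2.
  rewrite ler_pdivrMr //.
  by have := ler_wpM2r ly0 hw; have := ler_wpM2l (ltW eta0) lyw; lra.
lra.
Qed.

Lemma large_ln_bounds (eta K A : R) : 0 < eta -> 0 <= K -> 0 <= A ->
  exists Lam, forall l, Lam <= l ->
  [/\ 8 <= l, 64 * K <= eta * l, 4 <= eta * l, A <= eta * l & 2 <= eta ^+ 2 * (l - 1)].
Proof.
move=> eta0 K0 A0.
exists (8 + 64 * K / eta + 4 / eta + A / eta + 2 / eta ^+ 2 + 1) => l hl.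
have t1 : 0 <= 64 * K / eta by apply: divr_ge0; [exact: mulr_ge0 | exact: ltW].
have t2 : 0 <= 4 / eta by apply: divr_ge0; last exact: ltW.
have t3 : 0 <= A / eta by apply: divr_ge0; last exact: ltW.
have t4 : 0 <= 2 / eta ^+ 2 by apply: divr_ge0; last exact: sqr_ge0.
split; first by lra.
- by rewrite [leRHS]mulrC -ler_pdivrMr //; lra.
- by rewrite [leRHS]mulrC -ler_pdivrMr //; lra.
- by rewrite [leRHS]mulrC -ler_pdivrMr //; lra.
- by rewrite [leRHS]mulrC -ler_pdivrMr ?exprn_gt0 //; lra.
Qed.

Lemma expR_absorb (eta l : R) : 0 < eta -> 2 <= eta ^+ 2 * (l - 1) ->
  expR (- (eta * l)) <= eta * expR (- (eta / 2 * (1 + l))).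
Proof.
move=> eta0 hl.
have -> : - (eta * l) = - (eta / 2 * (l - 1)) + - (eta / 2 * (1 + l)) by field.
rewrite expRD ler_wpM2r ?expR_ge0 // expRN -div1r ler_pdivrMr ?expR_gt0 //.
apply: (@le_trans _ _ (eta * (eta / 2 * (l - 1)))); first by move: hl; rewrite expr2; lra.
by rewrite ler_wpM2l ?le_expR // ltW.
Qed.

Lemma tail_transfer (eta eps G GN S : R) : 0 < eta -> eta <= 1 / 100 -> 20 * eta <= eps ->
  0 <= GN -> G <= GN -> GN <= expR eta * G ->
  (1 - 4 * eta) * G <= S -> S <= (1 + 15 * eta) * G ->
  (1 - eps) * GN <= S /\ S <= (1 + eps) * GN.
Proof.
move=> eta0 eta1 eta_eps GN0 g1 g2 b1 b2.
have p0 : 0 <= 1 - eta by lra.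
have p4 : 0 <= 1 - 4 * eta by lra.
have G0 : 0 <= G by rewrite -(pmulr_rge0 _ (expR_gt0 eta)); exact: le_trans g2.
have g3 : (1 - eta) * GN <= G.
  apply: le_trans (ler_wpM2l p0 g2) _.
  by rewrite mulrA [X in X * _]mulrC -[leRHS]mul1r ler_wpM2r // expR_onem_le1.
have e2 := ler_wpM2r GN0 eta_eps; split.
  apply: le_trans b1; apply: le_trans (ler_wpM2l p4 g3).
  have := mulr_ge0 (sqr_ge0 eta) GN0; rewrite expr2; have := mulr_ge0 (ltW eta0) GN0; lra.
apply: le_trans b2 _; have := ler_wpM2l (ltW eta0) g1; lra.
Qed.

Variables c0 c1 Kg : R.
Hypothesis c0_gt0 : 0 < c0.
Hypothesis c0_le1 : c0 <= 1.
Hypothesis c1_gt0 : 0 < c1.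
Hypothesis Kg_ge0 : 0 <= Kg.
Hypothesis f_often_large : forall n,
  c1 * (size (primes_le n))%:R - Kg <= (count (fun p => c0 < f p) (primes_le n))%:R.

(** The parameters are chosen in the order [eta], [w] (with [y] about
    [N^(1/w)]), [D] and [X], [v], then [c], which may therefore be small in
    terms of all the others; [kappa] comes from flatness for this [c], and
    [N] is large in terms of everything. *)
Theorem nat_count_tail_uniform (eps : R) : 0 < eps ->
  exists2 kappa : R, 0 < kappa & exists N0, forall N, (N0 <= N)%N ->
    forall tau, tau <= mean_le f N + kappa * lsum R N ->
    [/\ 0 < tail f (primes_le N) tau,
        (1 - eps) * tail f (primes_le N) tau <= nat_count N tau / N%:R &
        nat_count N tau / N%:R <= (1 + eps) * tail f (primes_le N) tau].
Proof.
move=> eps0.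
have [eta [eta0 eta1 eta_eps]] : exists eta : R, [/\ 0 < eta, eta <= 1 / 100 & 20 * eta <= eps].
  exists (Num.min 1 eps / 100); split.
  - by rewrite divr_gt0 // lt_min ltr01.
  - by have := min_lel 1 eps; lra.
  - by have := min_ler 1 eps; have := eps0; lra.
have K40 : 0 < K4 by have := K4_ge1; lra.
have [KS KS0 sel] := selberg_formula R.
have K50 : 0 < K_lnwt by rewrite /K_lnwt !mulr_gt0 ?expR_gt0.
have KM0 : 0 < K_vm2 by rewrite /K_vm2 addr_gt0 ?exprn_gt0 // mulr_gt0.
have [w [w0 hw]] : exists w : nat, (0 < w)%N /\ 16 * K_lnwt <= eta * w%:R.
  exists (Num.truncn (16 * K_lnwt / eta)).+1; split=> //.
  by rewrite [leRHS]mulrC -ler_pdivrMr // ltW // truncnS_gt.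
have wR : 0 < w%:R :> R by rewrite ltr0n.
have [D DE] : exists D : R, D = 2 * (K4 * (2 * w%:R + 9)) by eexists.
have D0 : 0 < D by rewrite DE mulr_gt0 // mulr_gt0 //; lra.
have [X XE] : exists X : R, X = expR D by eexists.
have X0 : 0 < X by rewrite XE expR_gt0.
have DX : D <= X by rewrite XE le_expR.
have [Kv KvE] : exists Kv : R, Kv = K_vm2 * (X * (3 * expR 1)) by eexists.
have Kv0 : 0 < Kv by rewrite KvE !mulr_gt0 ?expR_gt0.
have [v vE] : exists v : R, v = Kv / eta by eexists.
have v0 : 0 < v by rewrite vE divr_gt0.
have hv : expR (- v) * K_vm2 * (X * (3 * expR 1)) <= eta.
  have -> : expR (- v) * K_vm2 * (X * (3 * expR 1)) = expR (- v) * Kv by rewrite KvE; ring.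
  have -> : Kv = eta * v by rewrite vE; field; rewrite gt_eqF.
  have h := le_expR v; rewrite expRN mulrCA -[leRHS]mulr1 ler_wpM2l ?(ltW eta0) //.
  by rewrite mulrC ler_pdivrMr ?expR_gt0 // mul1r.
have [c cE] : exists c : R, c = eta / (2 * (1 + v + X)) by eexists.
have den0 : 0 < 2 * (1 + v + X) by lra.
have c_gt0 : 0 < c by rewrite cE divr_gt0.
have cden : c * (1 + v + X) = eta / 2 by rewrite cE; field; rewrite gt_eqF //; lra.
have cv0 : 0 < c * v by rewrite mulr_gt0.
have cX0 : 0 < c * X by rewrite mulr_gt0.
have hcX : c * (1 + X) <= eta by lra.
have hcv : c * v <= eta by lra.
have c_eta : c <= eta / 2 by lra.
have c12 : c <= 1 / 2 by lra.
have c_le1 : c <= 1 by lra.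
have [kap kap0 [N1 hN1]] := @tail_regular R f f_gt0 K4 K4_ge1 f_exp_moment c0 c1 Kg
  c0_gt0 c1_gt0 Kg_ge0 f_often_large (@lsum_unbounded_primes R f f_add f_prime_power f_gt0) c0_le1 c c_gt0.
have [N2 hN2] := @lsum_unbounded_primes R f f_add f_prime_power f_gt0 (2 * (1 + kap) * D / kap).
have A0 : 0 <= (KS + 4) * (expR 1 * X).
  by apply: mulr_ge0; [exact: addr_ge0 | apply: mulr_ge0; [exact: expR_ge0 | exact: ltW]].
have [Lam hLam] := large_ln_bounds eta0 (ltW K50) A0.
exists (kap / 2); first by rewrite divr_gt0.
pose m := maxn 2 (maxn N1 N2).
exists (maxn (Num.truncn (expR Lam)).+1 (m ^ w)%N) => N.
rewrite geq_max => /andP[NLam mN] tau htau.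
have [y [my yN Ny]] := exists_root_scale w0 mN.
move: my; rewrite /m !geq_max => /and3P[y1 yN1 yN2].
have y0 : (0 < y)%N by exact: ltnW.
have yleN : (y <= N)%N.
  by apply: leq_trans yN; rewrite -{1}(expn1 y) leq_pexp2l.
have N0 : (0 < N)%N by exact: leq_trans yleN.
have N0R : 0 < N%:R :> R by rewrite ltr0n.
have y0R : 0 < y%:R :> R by rewrite ltr0n.
have lLam : Lam <= ln N%:R.
  rewrite -[Lam]expRK ler_ln ?posrE ?expR_gt0 //.
  by apply: le_trans (ltW (truncnS_gt _)) _; rewrite ler_nat.
set l : R := ln N%:R in lLam *.
have [l8 l1 l2 l3 l4] := hLam l lLam.
have l0 : 0 < l by lra.
have [lyw hlw] := scale_ln y1 yN Ny.
have hD : \sum_(p <- primes_between y N) (1 + expR (2 * f p)) / p%:R <= D.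
  by rewrite DE; exact: between_total_le.
have meanD := mean_le_between yleN hD.
have lsumD := lsum_between yleN hD.
have hL := hN2 y yN2; rewrite ler_pdivrMr // in hL.
have htauy : tau <= mean_le f y + kap * lsum R y.
  apply: le_trans htau _.
  have := mulr_ge0 (ltW kap0) (ltW D0); have := ler_wpM2l (ltW kap0) lsumD; lra.
have [Glow reg] := hN1 y yN1 tau htauy.
set G := tail f (primes_le y) tau in Glow reg.
have G0 : 0 < G by apply: lt_le_trans Glow; exact: expR_gt0.
have hG : expR (- (eta * l)) <= eta * G.
  have Ll : lsum R y <= 1 + l.
    by apply: lsum_le_ln => //; rewrite ler_ln ?posrE // ler_nat.
  have hc : c * lsum R y <= eta / 2 * (1 + l).
    by apply: ler_pM => //; [exact: ltW | exact: lsum_ge0].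
  apply: le_trans (expR_absorb eta0 l4) _; apply: ler_wpM2l; first exact: ltW.
  by apply: le_trans Glow; rewrite ler_expR lerN2.
have ly0 : 0 <= ln y%:R :> R by rewrite ln_ge0 // ler1n.
have hdel : N%:R^-1 + 4 * K_lnwt * (ln y%:R + 4) / l <= eta :=
  smooth_error_le eta0 l0 N0R ly0 (ltW (ln_sublinear N0R)) l2 l1 hw lyw.
have l2' : 2 <= eta * l by apply: le_trans l2; rewrite ler_nat.
have [b1 b2] := @nat_count_near_tail y N c tau X D KS eta v y1 yleN c_gt0 c12 reg hD
  ltac:(by rewrite XE) KS0 sel eta0 eta1 (ltW v0) l8 hdel hcX hcv l3 hv l2' hG.
have g1 : G <= tail f (primes_le N) tau := tail_le_cat tau yleN.
have g2 := @tail_cat_le y N tau c D yleN (ltW c_gt0) c_le1 reg hD.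
rewrite -/G in g2 b1 b2; set GN := tail f (primes_le N) tau in g1 g2 *.
have GN0 : 0 < GN by exact: lt_le_trans g1.
have ce : expR (c * (1 + D)) <= expR eta.
  by rewrite ler_expR; apply: le_trans hcX; rewrite ler_wpM2l ?(ltW c_gt0) // lerD2l.
have {}g2 : GN <= expR eta * G by apply: le_trans g2 _; rewrite ler_wpM2r // ltW.
by have [] := tail_transfer eta0 eta1 eta_eps (ltW GN0) g1 g2 b1 b2.
Qed.

End Comparison.

(** * Consequences of membership in the class C *)

Section ClassC.
Variable R : realType.
Variable f : nat -> R.
Hypothesis f_gt0 : forall p, prime p -> 0 < f p.

Lemma primes_uptoE (x : R) : primes_upto x = primes_le (Num.truncn x).
Proof. by []. Qed.

Lemma primes_upto_nat (n : nat) : primes_upto (n%:R : R) = primes_le n.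
Proof. by rewrite primes_uptoE natrK. Qed.

Lemma size_primes_le_gt0 n : (1 < n)%N -> (0 < size (primes_le n))%N.
Proof.
move=> n1; have : 2%N \in primes_le n by rewrite mem_primes_le.
by case: (primes_le n).
Qed.

(** Layers [j <= f p < j + 1], with the tail bound of exponent 5. *)
Lemma tail_bound_exp_moment : prime_tail_bound f -> exists2 K4 : R, 1 <= K4 &
  forall n, \sum_(p <- primes_le n) expR (4 * f p) <= K4 * (size (primes_le n))%:R.
Proof.
move=> /(_ 5 ltac:(by [])) [K hK].
exists (1 + 2 * expR 4 * `|K|).
  by rewrite lerDl !mulr_ge0 ?expR_ge0.
move=> n; case: (leqP n 1) => n1.
  have -> : primes_le n = [::] by case: n n1 => [|[|n]].
  by rewrite big_nil mulr0.
have s0 : 0 < (size (primes_le n))%:R :> R by rewrite ltr0n size_primes_le_gt0.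
have cnt t : 0 <= t -> (count (fun p => t <= f p) (primes_le n))%:R <=
    `|K| * expR (- (5 * t)) * (size (primes_le n))%:R.
  move=> t0; have := hK t n%:R t0 ltac:(by rewrite ler_nat).
  rewrite /prime_freq /prime_pi primes_upto_nat ler_pdivrMr // => h.
  apply: le_trans h _; rewrite ler_wpM2r ?ler0n // ler_wpM2r ?expR_ge0 //.
  exact: ler_norm.
pose J := (\sum_(p <- primes_le n) Num.truncn (f p)).+1.
apply: (@le_trans _ _ (\sum_(p <- primes_le n) \sum_(0 <= j < J)
   expR (4 * (j%:R + 1)) * (j%:R <= f p)%R%:R)).
  rewrite big_seq [leRHS]big_seq; apply: ler_sum => p pn.
  have pp : prime p by move: pn; rewrite mem_primes_le => /andP[].
  have fp := ltW (f_gt0 pp); pose j := Num.truncn (f p).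
  have jJ : (j < J)%N by rewrite ltnS (big_rem p) //= leq_addr.
  rewrite (bigD1_seq j) ?iota_uniq ?mem_index_iota //=.
  have -> : j%:R <= f p by rewrite truncn_le.
  apply: ler_wpDr; first by apply: sumr_ge0 => i _; rewrite mulr_ge0 ?expR_ge0.
  by rewrite mulr1 ler_expR ler_wpM2l // natr1 ltW // truncnS_gt.
rewrite exchange_big /=.
apply: (@le_trans _ _ (\sum_(0 <= j < J)
   (expR 4 * `|K| * (size (primes_le n))%:R) * (1 / 2) ^+ j)).
  apply: ler_sum => j _; rewrite -mulr_sumr.
  have -> : \sum_(p <- primes_le n) (j%:R <= f p)%R%:R =
      (count (fun p => j%:R <= f p) (primes_le n))%:R :> R.
    rewrite -sum1_count natr_sum [RHS]big_mkcond /=; apply: eq_bigr => p _.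
    by case: (j%:R <= f p).
  apply: le_trans (ler_wpM2l (expR_ge0 _) (cnt _ (ler0n R j))) _.
  have -> : expR (4 * (j%:R + 1)) * (`|K| * expR (- (5 * j%:R)) * (size (primes_le n))%:R) =
     expR 4 * `|K| * (size (primes_le n))%:R * (expR (4 * j%:R) * expR (- (5 * j%:R))).
    by rewrite mulrDr mulr1 expRD; ring.
  rewrite ler_wpM2l ?mulr_ge0 ?expR_ge0 // -expRD.
  have -> : 4 * j%:R - 5 * j%:R = j%:R * (-1) :> R by ring.
  have e1 : expR (- 1) <= 1 / 2 :> R.
    have := expR_ge1Dx (1 : R).
    by rewrite expRN -div1r ler_pdivrMr ?expR_gt0 // => ?; lra.
  rewrite expRM_natl; apply: lerXn2r; rewrite ?nnegrE ?expR_ge0 //.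
rewrite -mulr_sumr.
have h : \sum_(0 <= j < J) (1 / 2 : R) ^+ j <= 2.
  have e k : \sum_(0 <= j < k) (1 / 2 : R) ^+ j = 2 - 2 * (1 / 2) ^+ k.
    elim: k => [|k IHk]; first by rewrite big_geq // expr0; lra.
    by rewrite big_nat_recr //= IHk exprS; lra.
  by rewrite e lerBlDr lerDl mulr_ge0 // exprn_ge0 //; lra.
have q0 : 0 <= expR 4 * `|K| * (size (primes_le n))%:R by rewrite !mulr_ge0 ?expR_ge0.
have := ler_wpM2l q0 h; lra.
Qed.

(** As [f] is positive, the limit distribution vanishes at 0, and by right
    continuity it is at most [1/4] at some [c0 > 0].  Thus eventually at least
    half of the primes satisfy [c0 < f p]; the constant [Kg] covers the
    smaller [n]. *)
Lemma equidistribution_often_large : prime_equidistribution f ->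
  exists c0 c1 Kg : R, [/\ 0 < c0, c0 <= 1, 0 < c1, 0 <= Kg &
    forall n, c1 * (size (primes_le n))%:R - Kg <=
      (count (fun p => c0 < f p) (primes_le n))%:R].
Proof.
move=> [Psi [_ /(_ 1 ltr01) [K hK]]].
have bound (x t : R) : 2 <= x -> `|prime_freq (fun p => f p <= t) x - Psi t| <= `|K| / ln x.
  move=> x2; apply: le_trans (hK x x2 t) _.
  have lx : 0 <= ln x by rewrite ln_ge0 //; lra.
  by rewrite powRN powRr1 // ler_wpM2r ?invr_ge0 // ler_norm.
have big (e : R) : 0 < e -> exists2 x0 : R, 2 <= x0 & forall x, x0 <= x -> `|K| / ln x <= e.
  move=> e0; have K0 : 0 <= `|K| / e by rewrite divr_ge0 // ltW.
  have h1 := expR_ge1Dx (1 + `|K| / e).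
  exists (expR (1 + `|K| / e)); first by lra.
  move=> x x0.
  have lx : 1 + `|K| / e <= ln x.
    by rewrite -[leLHS]expRK ler_ln ?posrE ?expR_gt0 //; lra.
  rewrite ler_pdivrMr; last by lra.
  apply: (@le_trans _ _ (e * (`|K| / e))); last by rewrite ler_wpM2l //; lra.
  by rewrite mulrCA divff ?gt_eqF // mulr1.
have Psi0 : Psi 0 <= 0.
  apply/ler_addgt0Pr => e e0; have [x0 x02 hx] := big e e0.
  have := bound x0 0 x02; have := hx x0 (lexx _).
  have -> : prime_freq (fun p => f p <= 0) x0 = 0.
    rewrite /prime_freq; suff -> : count (fun p => f p <= 0) (primes_upto x0) = 0%N.
      by rewrite mul0r.
    apply/eqP; rewrite -leqn0 leqNgt -has_count; apply/hasPn => p.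
    by rewrite primes_uptoE mem_primes_le => /andP[/f_gt0 fp _]; rewrite -ltNge.
  by rewrite ler_norml => h1 /andP[h2 h3]; lra.
have [d hd] := nondecreasing_right_continuousP 0 Psi (ltac:(lra) : 0 < 1 / 4).
rewrite add0r in hd.
exists (Num.min d%:num 1), (1 / 4).
have [x0 x02 hx] := big (1 / 4) ltac:(lra).
exists ((Num.truncn x0).+1%:R); split=> //.
move=> n; case: (leqP n (Num.truncn x0)) => nx.
  apply: (@le_trans _ _ 0); last by rewrite ler0n.
  have : (size (primes_le n))%:R <= (Num.truncn x0).+1%:R :> R.
    rewrite ler_nat size_filter; apply: leq_trans (count_size _ _) _.
    by rewrite size_iota subn1 ltnW.
  have := ler0n R (size (primes_le n)); lra.
have xn : x0 <= n%:R.
  by apply: le_trans (ltW (truncnS_gt x0)) _; rewrite ler_nat.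
have n2 : 2 <= n%:R :> R by lra.
have n1 : (1 < n)%N by rewrite -(ltr_nat R); lra.
have s0 : 0 < (size (primes_le n))%:R :> R by rewrite ltr0n size_primes_le_gt0.
set c0 := Num.min _ _.
have P0 : Psi c0 <= 1 / 4.
  apply: (@le_trans _ _ (Psi d%:num)).
    by apply: cumulative_is_nondecreasing; rewrite ge_min lexx.
  by apply: le_trans hd _; rewrite -[leRHS]add0r lerD2r.
have := bound n%:R c0 n2; have := hx n%:R xn.
rewrite ler_norml => h1 /andP[_ h2].
have : prime_freq (fun p => f p <= c0) (n%:R : R) <= 1 / 2 by lra.
rewrite /prime_freq /prime_pi primes_upto_nat ler_pdivrMr // => h3.
have := count_predC (fun p => f p <= c0) (primes_le n) => /(congr1 (fun k => k%:R : R)).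
rewrite natrD.
have -> : count (predC (fun p => f p <= c0)) (primes_le n) = count (fun p => c0 < f p) (primes_le n).
  by apply: eq_count => p /=; rewrite ltNge.
have := ler0n R (Num.truncn x0).+1; lra.
Qed.

End ClassC.

(** * Independent Bernoulli variables *)

Section ProbabilisticModel.
Local Open Scope classical_set_scope.
Context d (T : measurableType d) (R : realType) (P : probability T R).
Variable X : nat -> {RV P >-> R}.
Hypothesis hX : prime_bernoulli_model X.
Variable f : nat -> R.

Let lincomb (l : seq nat) (t : R) : set T :=
  [set w | t <= \sum_(p <- l) f p * X p w].

Let cyl (s : seq nat) (B : nat -> set R) : set T :=
  \bigcap_(i in [set` s]) (X i @^-1` B i).

Lemma measurable_lincomb l t : measurable (lincomb l t).
Proof.
rewrite -[lincomb l t]setTI; apply: measurable_fun_le => //.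
by apply: measurable_sum => p; apply: measurable_realfun.measurable_funM.
Qed.

Lemma measurable_cyl s B : (forall i, measurable (B i)) -> measurable (cyl s B).
Proof.
move=> mB; rewrite /cyl bigcap_seq; apply: bigsetI_measurable => i _.
exact: measurable_funPTI.
Qed.

(** [X p] takes almost surely one of the values 1 and 0. *)
Lemma prob_split p (A : set T) : prime p -> measurable A ->
  P A = (P (A `&` X p @^-1` [set 1%R]) + P (A `&` X p @^-1` [set 0%R]))%E.
Proof.
move=> pp mA; have [P1 P0] := hX.2 p pp.
have mE (r : R) : measurable (X p @^-1` [set r]) by exact: measurable_funPTI.
have E10 : X p @^-1` [set (0 : R)] `<=` ~` (X p @^-1` [set 1%R]).
  by move=> w /= -> /eqP; rewrite eq_sym oner_eq0.
have mU : measurable (X p @^-1` [set 1%R] `|` X p @^-1` [set 0%R]).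
  exact: measurableU.
have PU : P (~` (X p @^-1` [set 1%R] `|` X p @^-1` [set 0%R])) = 0%E.
  have PU1 : P (X p @^-1` [set 1%R] `|` X p @^-1` [set 0%R]) = 1%E.
    transitivity (P (X p @^-1` [set 1%R]) + P (X p @^-1` [set 0%R]))%E.
      by rewrite measureU //; apply/seteqP; split=> // w [h1 /E10].
    by rewrite P1 P0 -EFinD; congr EFin; ring.
  by rewrite probability_setC // PU1 subee.
rewrite (measureDI P mA (mE 1)) addeC; congr (_ + _)%E.
rewrite (measureDI P (measurableD mA (mE 1)) (mE 0)).
rewrite [X in (X + _)%E](_ : _ = 0%E); last first.
  apply: (subset_measure0 _ _ _ PU); rewrite ?in_setE.
  - by apply: measurableD => //; exact: measurableD.
  - exact: measurableC.
  - by move=> w [[_ h1] h0] [].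
rewrite add0e; congr (P _); apply/seteqP; split=> w.
  by move=> [[]].
by move=> [Aw w0]; split=> //; split=> //; exact: E10.
Qed.

(** Induction on [l], splitting on the value [r] of the first variable: the event
    [X p = r] joins the cylinder and lowers the threshold by [f p * r], as in
    the recursion that defines [expect].  Mutual independence enters at
    [l = [::]], where only the cylinder is left. *)
Lemma prob_cyl_lincomb l s B t : uniq (s ++ l) -> all prime (s ++ l) ->
  (forall i, measurable (B i)) ->
  P (cyl s B `&` lincomb l t) =
  ((\prod_(i <- s) P (X i @^-1` B i)) * (tail f l t)%:E)%E.
Proof.
elim: l s B t => [|p l IHl] s B t.
  rewrite cats0 => us ps mB; rewrite -(hX.1 s B us ps mB) /tail /= /wt.
  case t0: (t <= \sum_(p <- [::]) f p).
    rewrite mule1; congr (P _); apply/seteqP; split=> w; first by case.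
    by move=> ?; split=> //; move: t0; rewrite /lincomb /= !big_nil.
  rewrite mule0 -[RHS](measure0 P); congr (P _).
  apply/seteqP; split=> w //= -[_]; move: t0.
  by rewrite /lincomb /= !big_nil => ->.
move=> us ps mB.
have pm : perm_eq (s ++ p :: l) ((p :: s) ++ l).
  by rewrite -cat1s perm_catCA.
have us' : uniq ((p :: s) ++ l) by rewrite -(perm_uniq pm).
have ps' : all prime ((p :: s) ++ l) by rewrite -(perm_all _ pm).
have pp : prime p by move: ps' => /= /andP[].
have ps'' : p \notin s.
  by move: us' => /= /andP[]; rewrite mem_cat negb_or => /andP[].
have mcl t' : measurable (cyl s B `&` lincomb l t').
  by apply: measurableI; [exact: measurable_cyl|exact: measurable_lincomb].
have [P1 P0] := hX.2 p pp.
have step (r : R) : P (cyl s B `&` lincomb (p :: l) t `&` X p @^-1` [set r]) =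
   (P (X p @^-1` [set r]) * ((\prod_(i <- s) P (X i @^-1` B i)) *
      (tail f l (t - f p * r))%:E))%E.
  pose B' q := if q == p then [set r] else B q.
  have mB' i : measurable (B' i) by rewrite /B'; case: ifP.
  have BB' i : i \in s -> B' i = B i.
    by rewrite /B'; case: eqP => // -> h; move: ps''; rewrite h.
  have -> : cyl s B `&` lincomb (p :: l) t `&` X p @^-1` [set r] =
            cyl (p :: s) B' `&` lincomb l (t - f p * r).
    apply/seteqP; split=> w.
      move=> [[Bw]]; rewrite /lincomb /= big_cons => tw wr; split.
        move=> i /=; rewrite inE => /orP[/eqP ->|si]; first by rewrite /B' eqxx.
        by rewrite BB' //; exact: Bw.
      by rewrite /= lerBlDl -{1}wr.
    move=> [Bw]; rewrite /lincomb /= => tw.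
    have wr : X p w = r.
      by have := Bw p; rewrite /= inE eqxx /B' eqxx; apply.
    split=> //; split.
      by move=> i /= si; rewrite -BB' //; apply: Bw; rewrite /= inE si orbT.
    by rewrite big_cons wr -lerBlDl.
  rewrite IHl // big_cons {1}/B' eqxx -muleA; congr (_ * (_ * _))%E.
  by rewrite big_seq [RHS]big_seq; apply: eq_bigr => i si; rewrite BB'.
rewrite (prob_split pp); last first.
  by apply: measurableI; [exact: measurable_cyl|exact: measurable_lincomb].
rewrite !step P1 P0.
have [c ->] : exists c : R, (\prod_(i <- s) P (X i @^-1` B i))%E = c%:E.
  elim: (s) => [|i s' [c cE]]; first by exists 1; rewrite big_nil.
  rewrite big_cons cE; exists (fine (P (X i @^-1` B i)) * c).
  by rewrite EFinM fineK // fin_num_measure //; exact: measurable_funPTI.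
rewrite -!EFinM -EFinD; congr EFin.
rewrite mulr1 mulr0 subr0 /tail /=.
under [in X in _ = c * (_ + p%:R^-1 * X)]eq_expect => S.
  rewrite wt_cons -lerBlDl; over.
by ring.
Qed.

Lemma fine_prob_lincomb l t : uniq l -> all prime l ->
  fine (P [set w | t <= \sum_(p <- l) f p * X p w]) = tail f l t.
Proof.
move=> ul pl; have := @prob_cyl_lincomb l [::] (fun=> setT) t ul pl.
rewrite big_nil mul1e => /(_ (fun=> measurableT)) h.
transitivity (fine (tail f l t)%:E) => //; rewrite -h; congr (fine (P _)).
by apply/seteqP; split=> w; [move=> ?; split|case].
Qed.

Lemma model_tailE x D :
  model_tail X f x D =
  tail f (primes_le (Num.truncn x)) (mu f x + D * sigma f x).
Proof.
rewrite -fine_prob_lincomb ?uniq_primes_le ?all_prime_primes_le //.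
rewrite /model_tail; congr (fine (P _)); apply/seteqP.
have e w : \sum_(p <- primes_upto x) f p * (X p w - p%:R^-1) =
   \sum_(p <- primes_le (Num.truncn x)) f p * X p w - mu f x.
  by rewrite /mu -sumrB; apply: eq_bigr => p _; rewrite mulrBr.
by split=> w /=; rewrite e lerBrDl.
Qed.

End ProbabilisticModel.

(** * The two tails *)

Section FinalComparison.
Variable R : realType.
Variable f : nat -> R.
Hypothesis f_gt0 : forall p, prime p -> 0 < f p.

Lemma sigma2_gt0 (x : R) : 2 <= x -> 0 < sigma2 f x.
Proof.
move=> x2; rewrite /sigma2 (bigD1_seq 2%N) ?uniq_primes_le //=; last first.
  by rewrite primes_uptoE mem_primes_le /= truncn_gt_nat.
apply: ltr_wpDr.
  by apply: sumr_ge0 => p _; rewrite mulr_ge0 ?onem_invn_ge0 // divr_ge0 ?sqr_ge0.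
have f2 := f_gt0 (isT : prime 2).
by rewrite mulr_gt0 ?divr_gt0 ?exprn_gt0 // subr_gt0 invf_lt1 // ltr1n.
Qed.

Lemma sqr_sigma (x : R) : 2 <= x -> sigma f x ^+ 2 = sigma2 f x.
Proof. by move=> /sigma2_gt0/ltW; exact: sqr_sqrtr. Qed.

Lemma sigma2_le_lsum (K4 x : R) :
  (forall n, \sum_(p <- primes_le n) expR (4 * f p) <= K4 * (size (primes_le n))%:R) ->
  sigma2 f x <= K4 * lsum R (Num.truncn x).
Proof.
move=> hK; apply: le_trans (exp_moment_lsum hK _).
rewrite /sigma2 primes_uptoE big_seq [leRHS]big_seq; apply: ler_sum => p.
rewrite mem_primes_le => /andP[/f_gt0 fp _].
apply: (@le_trans _ _ (f p ^+ 2 / p%:R)).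
  by rewrite ler_piMr ?divr_ge0 ?sqr_ge0 // gerBl invn_ge0.
rewrite ler_wpM2r ?invn_ge0 //.
have h : f p <= expR (f p) by have := expR_ge1Dx (f p); lra.
have -> : 4 * f p = f p *+ 2 + f p *+ 2 by ring.
apply: (@le_trans _ _ (expR (f p *+ 2))).
  by rewrite mulr2n expRD expr2; apply: ler_pM => //; exact: ltW.
by rewrite ler_expR; lra.
Qed.

Lemma natural_tailE (x D : R) : 2 <= x ->
  natural_tail f x D = nat_count f (Num.truncn x) (mu f x + D * sigma f x) / x.
Proof.
move=> x2; rewrite /natural_tail /nat_count; congr (_ / x).
have s0 : 0 < sigma f x by rewrite /sigma sqrtr_gt0 sigma2_gt0.
rewrite -sum1_count natr_sum big_mkcond /=; apply: eq_bigr => n _.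
by rewrite ler_pdivlMr // lerBrDl; case: ifP.
Qed.

End FinalComparison.

Theorem theorem2p1 (R : realType) (d : measure_display) (T : measurableType d)
    (P : probability T R) (X : nat -> {RV P >-> R}) (f : nat -> R)
    (hX : prime_bernoulli_model X) (hf : classC f) :
  equiv_unif_upto_o (natural_tail f) (model_tail X f) (sigma f).
Proof.
case: hf => -[f_add f_pow] f_gt0 f_tail f_equi.
have [K4 K41 hK4] := tail_bound_exp_moment f_gt0 f_tail.
have [c0 [c1 [Kg [c00 c01 c10 Kg0 hc]]]] := equidistribution_often_large f_gt0 f_equi.
move=> kappa kappa0 eps eps0.
pose e := Num.min eps 1 / 4.
have e0 : 0 < e by rewrite divr_gt0 // lt_min eps0 ltr01.
have e1 : e <= 1 / 4 by have := min_ler eps 1; rewrite /e; lra.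
have e2 : 4 * e <= eps by have := min_lel eps 1; rewrite /e; lra.
have [kap kap0 [N0 hN]] := nat_count_tail_uniform f_add f_pow f_gt0 K41 hK4 c00 c01 c10 Kg0 hc e0.
have K40 : 0 < K4 by lra.
have hk : \forall x \near +oo, `|kappa x| < kap / K4.
  by apply: (cvgr0_norm_lt _ kappa0); rewrite divr_gt0.
have hx : \forall x \near +oo, N0.+1%:R + 2 + e^-1 <= x :> R.
  exact/nbhs_pinfty_ge/num_real.
near=> x; move=> D D1 hD.
have kx : `|kappa x| < kap / K4 by near: x.
have xx : N0.+1%:R + 2 + e^-1 <= x by near: x.
have ei : 0 < e^-1 by rewrite invr_gt0.
have n0 : 0 < N0.+1%:R :> R by rewrite ltr0n.
have x2 : 2 <= x by lra.
have x0 : 0 < x by lra.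
pose N := Num.truncn x.
have N0N : (N0 <= N)%N.
  by rewrite ltnW // /N truncn_gt_nat; lra.
have Nx : N%:R <= x by rewrite truncn_le; lra.
have xN : x < N%:R + 1 by rewrite natr1 truncnS_gt.
have Npos : 0 < N%:R :> R by lra.
have s2 := sqr_sigma f_gt0 x2; have sK := @sigma2_le_lsum _ _ f_gt0 K4 x hK4.
have s0 : 0 < sigma f x by rewrite /sigma sqrtr_gt0 sigma2_gt0.
have htau : mu f x + D * sigma f x <= mean_le f N + kap * lsum R N.
  have -> : mu f x = mean_le f N by [].
  rewrite lerD2l; apply: (@le_trans _ _ (kappa x * sigma f x ^+ 2)).
    by rewrite expr2 mulrA ler_wpM2r // ltW.
  apply: (@le_trans _ _ (kap / K4 * sigma2 f x)).
    rewrite s2 ler_wpM2r //; first by rewrite -s2 sqr_ge0.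
    by apply: le_trans (ler_norm _) (ltW kx).
  apply: (@le_trans _ _ (kap / K4 * (K4 * lsum R N))).
    by rewrite ler_wpM2l // ltW // divr_gt0.
  by rewrite mulrA divfK ?gt_eqF.
have [G0 lo hi] := hN N N0N _ htau.
rewrite (model_tailE hX) (natural_tailE f_gt0) // -/N.
move: G0 lo hi; set G := tail _ _ _; set C := nat_count _ _ _ => G0 lo hi.
have r1 : N%:R / x <= 1 by rewrite ler_pdivrMr // mul1r.
have r0 : 1 - e <= N%:R / x.
  rewrite ler_pdivlMr //.
  have : e * e^-1 <= e * x by rewrite ler_wpM2l //; lra.
  by rewrite divff ?gt_eqF //; lra.
have -> : C / x / G = (N%:R / x) * (C / N%:R / G).
  by field; rewrite !gt_eqF.
have q0 : 1 - e <= C / N%:R / G by rewrite ler_pdivlMr.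
have q1 : C / N%:R / G <= 1 + e by rewrite ler_pdivrMr.
move: r0 r1 q0 q1; set r := N%:R / x; set q := C / N%:R / G => r0 r1 q0 q1.
have b1 : (1 - e) * (1 - e) <= r * q by apply: ler_pM => //; lra.
have b2 : r * q <= 1 * (1 + e) by apply: ler_pM => //; lra.
rewrite ltr_norml; apply/andP; split; last by lra.
have := sqr_ge0 e; rewrite expr2; lra.
Unshelve. all: by end_near.
Qed.
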